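(* Let $(\Omega,\mathbf{\Sigma},\mu)$ be a complete probability space, let $1\leq p<\infty$ with $p\notin 2\mathbb{N}$, and let $X$ be a closed subspace of $L^p(\mu)$ containing the constant functions. Let $P$ be a contractive projection on $X$ satisfying $P\mathbf{1}=\mathbf{1}$. Then $$Pf=\mathbb{E}(f\,|\,\mathbf{\Sigma}'),\quad \forall f\in X,$$ where $\mathbf{\Sigma}'$ is the sub $\sigma$-algebra generated by the functions in $\mathrm{Ran}\,P$.
   Context: $L^p(\mu)=L^p(\Omega,\mathbf{\Sigma},\mu)$ consists of complex-valued functions; $\mathbf{1}$ is the constant function 1; $\mathbb{N}$ is the set of positive integers, so $2\mathbb{N}=\{2,4,6,\dots\}$. A projection on a Banach space $X$ is a nonzero linear operator $P:X\to X$ with $P^2=P$; it is contractive if $\|P\|=1$; $\mathrm{Ran}\,P$ is its range. The $\sigma$-algebra generated by a family of measurable functions is the smallest complete (containing all $\mu$-null sets) sub $\sigma$-algebra of $\mathbf{\Sigma}$ for which every function in the family is measurable. $\mathbb{E}(\cdot|\mathbf{\Sigma}')$ is the conditional expectation with respect to $\mu$. *)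

(* Defs.v *)
From HB Require Import structures.
From mathcomp Require Import all_boot all_order all_algebra.
From mathcomp Require Import complex.
From mathcomp Require Import all_classical all_reals all_analysis.
Set Implicit Arguments.
Unset Strict Implicit.
Unset Printing Implicit Defensive.
Import Order.TTheory GRing.Theory Num.Theory.
Import numFieldNormedType.Exports.

Local Open Scope classical_set_scope.
Local Open Scope ring_scope.

(* Elements of the complex space L^p(mu) are handled through representatives
   f : T -> R[i]; equality in L^p(mu) is equality mu-almost everywhere. *)

Section ComplexLp.
Context {d : measure_display} {T : measurableType d} {R : realType}.
Variable mu : {measure set T -> \bar R}.
Implicit Types (p : R) (f g : T -> R[i]) (X F : set (T -> R[i])).
Implicit Types (G : set (set T)) (P : (T -> R[i]) -> (T -> R[i])).

(* Borel measurability of f with respect to the sigma-algebra G; the Borel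
   sigma-algebra of R[i] is the product one. *)
Definition cmeasurable_wrt G f :=
  preimage_set_system [set: T] (fun x => complex.Re (f x)) measurable `<=` G /\
  preimage_set_system [set: T] (fun x => complex.Im (f x)) measurable `<=` G.

Definition cLnorm p f : \bar R :=
  Lnorm mu p%:E (fun x => (ComplexField.Normc.normc (f x))%:E).

Definition cLp p : set (T -> R[i]) :=
  [set f | cmeasurable_wrt measurable f /\ (cLnorm p f < +oo)%E].

(* The closure condition also makes X stable under mu-a.e. equality, so that X
   is the set of all representatives of a closed subspace of L^p(mu). *)
Definition closed_subspace p X :=
  [/\ X `<=` cLp p,
      X (fun=> 0),
      forall (a : R[i]) f g, X f -> X g -> X (fun x => a * f x + g x) &
      forall f, cLp p f ->
        (forall e : R, 0 < e ->
           exists2 g, X g & (cLnorm p (fun x => f x - g x)%R < e%:E)%E) ->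
        X f].

(* The values of P outside X are irrelevant; the second condition says that P
   is well defined on classes modulo mu-a.e. equality. *)
Definition projection_on X P :=
  [/\ forall f, X f -> X (P f),
      forall f g, X f -> X g -> f = g %[ae mu] -> P f = P g %[ae mu],
      forall (a : R[i]) f g, X f -> X g ->
        P (fun y => a * f y + g y) = (fun x => a * P f x + P g x) %[ae mu],
      forall f, X f -> P (P f) = P f %[ae mu] &
      exists2 f, X f & ~ (P f = (fun=> 0) %[ae mu])].

Definition operator_norm p X P : \bar R :=
  ereal_sup [set cLnorm p (P f) | f in [set f | X f /\ (cLnorm p f <= 1)%E]].

Definition contractive_projection p X P :=
  projection_on X P /\ operator_norm p X P = 1%E.

Definition complete_sub_sigma_algebra G :=
  [/\ sigma_algebra [set: T] G,
      G `<=` d.-measurable &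
      mu.-negligible `<=` G].

Definition generated_sigma_algebra F : set (set T) :=
  smallest [set G | complete_sub_sigma_algebra G /\
                    forall f, F f -> cmeasurable_wrt G f]
           mu.-negligible.

Definition cintegrable f :=
  mu.-integrable [set: T] (fun x => (complex.Re (f x))%:E) /\
  mu.-integrable [set: T] (fun x => (complex.Im (f x))%:E).

Definition cintegral (A : set T) f : R[i] :=
  Complex (\int[mu]_(x in A) complex.Re (f x))%R
          (\int[mu]_(x in A) complex.Im (f x))%R.

(* g is a version of the conditional expectation of f given G. *)
Definition is_condexp G f g :=
  [/\ cintegrable f,
      cintegrable g,
      cmeasurable_wrt G g &
      forall A, G A -> cintegral A g = cintegral A f].

End ComplexLp.

(* Main.v *)
Require Import Defs.
From HB Require Import structures.
From mathcomp Require Import all_boot all_order all_algebra.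
From mathcomp Require Import complex.
From mathcomp Require Import all_classical all_reals all_analysis.
From mathcomp Require Import measurable_realfun.
From mathcomp Require Import ring lra.

(** Put h = f - P f for f in X, so that P h = 0. The claim is that h has
    integral 0 over every set of the sigma-algebra generated by Ran P.

    If u is fixed by P then P (u + eps h) = u, and contractivity says that the
    p-th power of the norm of u + eps h is minimal at eps = 0. Differentiating
    there ([first_variation]) shows that the integral of
      |u|^(p-2) (Re u Re h + Im u Im h)
    vanishes as soon as u is almost nowhere 0. The fixed functions form a complex
    vector space containing the constants, so u may be replaced by x + i y + u
    for all real x and almost every real y.

    This two-parameter family of relations determines the integrals of
    h cos (Re u) and h sin (Re u): they are 0 ([homogeneous_orthogonality]). Let
    b = p/2 - 1. The relations say that h is orthogonal to the translates of
    the kernels x (x^2 + y^2)^b and y (x^2 + y^2)^b composed with u. These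
    kernels are not integrable, but an iterated difference in x makes them so.
    Integrating the differenced relations over y kills the second kernel, which
    is odd in y, and turns the first one into an odd integrable function kappa
    of x; integrating then over x against sin x and cos x splits off a factor,
    the integral of sin x kappa(x), and leaves the two integrals of interest
    ([deconvolution]). Everything thus depends on this factor being nonzero,
    and here the exclusion of even p is decisive: for even p the number b is
    natural, the kernels are polynomials and their differences are 0. For the
    other p there is a natural number k with k - 1 < b < k, and, up to a positive
    factor, r^b is the integral over s of exp(-b s) rho_k(exp(s) r), where rho_k
    is the Taylor remainder of order k of exp(-z) with the sign that makes it
    positive ([power_as_mixture]). The differences annihilate the polynomial part of
    rho_k, so that kappa is, up to sign, a superposition with positive weights of
    differences of the functions x exp(-t x^2). The sine transform of
    x exp(-t x^2) is explicit and positive, and differences only multiply it by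
    an even power of 2 cos 1 - 2, hence the factor is nonzero
    ([kappa_sin_neq0]).

    It remains to pass from trigonometric functions of u to sets. Consider the
    bounded functions phi such that phi h is again orthogonal to all cos v and
    sin v, v the real part of a fixed function, whenever h is. They form an
    algebra closed under bounded pointwise limits; it contains the functions
    sin v by the addition formulas, then the signs of the v by a polynomial
    iteration, then the indicators of the sets v > a. The sets whose
    indicator belongs to it therefore form a complete sigma-algebra for which
    the functions of Ran P are measurable, and taking v = 0 gives the integral of
    h over any of them ([annihilated_integral]). *)

Set Implicit Arguments.
Unset Strict Implicit.
Unset Printing Implicit Defensive.
Import Order.TTheory GRing.Theory Num.Theory.
Import numFieldNormedType.Exports.
Local Open Scope classical_set_scope.
Local Open Scope ring_scope.

(** * Integrable real functions and their integrals *)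

Definition L1 {d} {T : measurableType d} {R : realType}
    (mu : {measure set T -> \bar R}) (f : T -> R) : Prop :=
  mu.-integrable [set: T] (EFin \o f).

Section L1.
Context {d : measure_display} {T : measurableType d} {R : realType}.
Variable mu : {measure set T -> \bar R}.
Implicit Types f g : T -> R.

Lemma L1_measurable f : L1 mu f -> measurable_fun setT f.
Proof. by move=> /measurable_int /measurable_EFinP. Qed.

Lemma L1_le f g : measurable_fun setT f -> L1 mu g ->
  (forall x, `|f x| <= g x) -> L1 mu f.
Proof.
move=> mf ig fg; apply: le_integrable ig => //; first exact/measurable_EFinP.
by move=> x _ /=; rewrite lee_fin (le_trans (fg x))// ler_norm.
Qed.

Lemma L1_ge0P f : measurable_fun setT f -> (forall x, 0 <= f x) ->
  L1 mu f <-> (\int[mu]_x (f x)%:E < +oo)%E.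
Proof.
move=> mf f0; have E : (\int[mu]_x `|(f x)%:E| = \int[mu]_x (f x)%:E)%E.
  by apply: eq_integral => x _; rewrite gee0_abs// lee_fin.
split; first by move/integrableP => [_]; rewrite E.
by move=> h; apply/integrableP; split; [exact/measurable_EFinP|rewrite E].
Qed.

Lemma L1_abs f : L1 mu f -> L1 mu (fun x => `|f x|).
Proof. exact: integrable_norm. Qed.

Lemma L1D f g : L1 mu f -> L1 mu g -> L1 mu (fun x => f x + g x).
Proof. by move=> hf hg; exact: (integrableD measurableT hf hg). Qed.

Lemma L1N f : L1 mu f -> L1 mu (fun x => - f x).
Proof. by move=> hf; apply: eq_integrable (integrableN hf) => // x _. Qed.

Lemma L1B f g : L1 mu f -> L1 mu g -> L1 mu (fun x => f x - g x).
Proof. by move=> hf hg; apply: L1D => //; exact: L1N. Qed.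

Lemma L1Zl (k : R) f : L1 mu f -> L1 mu (fun x => k * f x).
Proof. by move=> hf; exact: (integrableZl measurableT k hf). Qed.

Lemma L1Zr (k : R) f : L1 mu f -> L1 mu (fun x => f x * k).
Proof.
by move=> /(L1Zl k); under [fun x => k * f x]eq_fun do rewrite mulrC.
Qed.

Lemma eq_L1 f g : f =1 g -> L1 mu f -> L1 mu g.
Proof. by move=> /funext ->. Qed.

Lemma RintD f g : L1 mu f -> L1 mu g ->
  \int[mu]_x (f x + g x) = \int[mu]_x f x + \int[mu]_x g x.
Proof. exact: RintegralD. Qed.

Lemma RintB f g : L1 mu f -> L1 mu g ->
  \int[mu]_x (f x - g x) = \int[mu]_x f x - \int[mu]_x g x.
Proof. exact: RintegralB. Qed.

Lemma RintZl (k : R) f : L1 mu f -> \int[mu]_x (k * f x) = k * \int[mu]_x f x.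
Proof. exact: RintegralZl. Qed.

Lemma RintZr (k : R) f : L1 mu f -> \int[mu]_x (f x * k) = \int[mu]_x f x * k.
Proof. exact: RintegralZr. Qed.

Lemma RintN f : L1 mu f -> \int[mu]_x (- f x) = - \int[mu]_x f x.
Proof.
by move=> hf; under eq_Rintegral do rewrite -mulN1r; rewrite RintZl// mulN1r.
Qed.

Lemma eq_Rint f g : f =1 g -> \int[mu]_x f x = \int[mu]_x g x.
Proof. by move=> /funext ->. Qed.

Lemma Rint_ge0 f : (forall x, 0 <= f x) -> 0 <= \int[mu]_x f x.
Proof. by move=> f0; apply: Rintegral_ge0. Qed.

Lemma le_Rint f g : L1 mu f -> L1 mu g -> (forall x, f x <= g x) ->
  \int[mu]_x f x <= \int[mu]_x g x.
Proof. by move=> hf hg fg; apply: le_Rintegral. Qed.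

Lemma EFin_Rint f : L1 mu f ->
  (\int[mu]_x f x)%:E = (\int[mu]_x (f x)%:E)%E.
Proof. by move=> hf; rewrite fineK//; exact: integrable_fin_num. Qed.

Lemma ae_eq_Rint f g : measurable_fun setT f -> measurable_fun setT g ->
  {ae mu, forall x, f x = g x} -> \int[mu]_x f x = \int[mu]_x g x.
Proof.
move=> mf mg fg; congr fine; apply: ae_eq_integral => //;
  [exact/measurable_EFinP|exact/measurable_EFinP|].
by apply: filterS fg => x /= -> _.
Qed.

Lemma ae_le_L1 f g : measurable_fun setT f -> L1 mu g ->
  {ae mu, forall x, `|f x| <= g x} -> L1 mu f.
Proof.
move=> mf ig fg; apply/integrableP; split; first exact/measurable_EFinP.
case/integrableP: (ig) => mg; apply: le_lt_trans.
apply: ae_ge0_le_integral => //.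
- by apply/measurable_EFinP; exact: measurableT_comp.
- exact: measurableT_comp.
- by apply: filterS fg => x /= h _; rewrite lee_fin (le_trans h)// ler_norm.
Qed.

Lemma ae_eq_L1 f g : measurable_fun setT g -> L1 mu f ->
  {ae mu, forall x, f x = g x} -> L1 mu g.
Proof.
move=> mg hf fg; apply: (@ae_le_L1 _ (fun x => `|f x|)) => //; first exact: L1_abs.
by apply: filterS fg => x /= ->.
Qed.

Lemma dominated_Rint (f_ : nat -> T -> R) f g :
  (forall n, measurable_fun setT (f_ n)) -> measurable_fun setT f -> L1 mu g ->
  {ae mu, forall x, f_ n x @[n --> \oo] --> f x} ->
  (forall n x, `|f_ n x| <= g x) ->
  L1 mu f /\ \int[mu]_x f_ n x @[n --> \oo] --> \int[mu]_x f x.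
Proof.
move=> mf_ mf ig cvf le_g.
have cvf' : {ae mu, forall x, [set: T] x ->
    (fun n => (f_ n x)%:E) @ \oo --> (f x)%:E}.
  by apply: filterS cvf => x /= hx _; apply: cvg_EFin => //; exact: nearW.
have le_g' : {ae mu, forall x n, [set: T] x -> (`|(f_ n x)%:E| <= (g x)%:E)%E}.
  by apply: aeW => x n _; exact: le_g.
have [hf _ h] := @dominated_convergence _ _ _ mu setT measurableT
  (fun n x => (f_ n x)%:E) (EFin \o f) (EFin \o g)
  (fun n => (measurable_EFinP _ _).2 (mf_ n)) ((measurable_EFinP _ _).2 mf)
  cvf' ig le_g'.
by split=> //; apply: fine_cvg; rewrite fineK//; exact: integrable_fin_num.
Qed.

(** A nonnegative function with zero integral vanishes almost everywhere, which
    a positive one can do only on a space of measure 0. *)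
Lemma Rint_gt0 f : L1 mu f -> (0 < mu setT)%E -> (forall x, 0 < f x) ->
  0 < \int[mu]_x f x.
Proof.
move=> hf mu0 f0; rewrite lt_def Rint_ge0 ?andbT; last by move=> x; exact: ltW.
apply/negP => /eqP h.
have : (\int[mu]_x `|(f x)%:E| = 0)%E.
  rewrite -[RHS]/(0%:E) -h EFin_Rint//; apply: eq_integral => x _.
  by rewrite gee0_abs// lee_fin ltW.
move/(ae_eq_integral_abs mu measurableT) => /(_ _)/wrap[].
  by case/integrableP: hf.
case=> N [mN N0 sN]; suff : (mu setT <= mu N)%E by rewrite N0 leNgt mu0.
apply: le_measure; rewrite ?inE//.
move=> x _; apply: sN => /= /(_ I) [fx0].
by have := f0 x; rewrite fx0 ltxx.
Qed.

End L1.

(** For almost every x the slice [f x] is integrable, and only there do its real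
    and extended integrals agree; both iterated integrals are therefore
    compared with those of the extended-real theorem almost everywhere. *)
Lemma Rfubini {d1 d2} {T1 : measurableType d1} {T2 : measurableType d2}
    {R : realType} (m1 : {sigma_finite_measure set T1 -> \bar R})
    (m2 : {sigma_finite_measure set T2 -> \bar R}) (f : T1 -> T2 -> R) :
  measurable_fun setT (fun z : T1 * T2 => f z.1 z.2) ->
  (\int[m1]_x \int[m2]_y `|f x y|%:E < +oo)%E ->
  [/\ measurable_fun setT (fun x => \int[m2]_y f x y),
      L1 m1 (fun x => \int[m2]_y f x y),
      L1 m2 (fun y => \int[m1]_x f x y) &
      \int[m1]_x \int[m2]_y f x y = \int[m2]_y \int[m1]_x f x y].
Proof.
move=> mf foo.
pose F := fun z : T1 * T2 => (f z.1 z.2)%:E.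
have mF : measurable_fun setT F by exact/measurable_EFinP.
have iF : (m1 \x m2)%E.-integrable setT F by apply/integrable12ltyP.
have m1f : measurable_fun setT (fun x => \int[m2]_y f x y).
  by apply: (measurableT_comp (fine_measurable measurableT)); exact: (measurable_fubini_F iF).
have m2f : measurable_fun setT (fun y => \int[m1]_x f x y).
  by apply: (measurableT_comp (fine_measurable measurableT)); exact: (measurable_fubini_G iF).
have E1 : ae_eq m1 setT (fun x => (\int[m2]_y f x y)%:E)
                       (fun x => \int[m2]_y (f x y)%:E)%E.
  apply: filterS (ae_integrable1 iF) => x /= h _; exact: EFin_Rint.
have E2 : ae_eq m2 setT (fun y => (\int[m1]_x f x y)%:E)
                       (fun y => \int[m1]_x (f x y)%:E)%E.
  apply: filterS (ae_integrable2 iF) => y /= h _; exact: EFin_Rint.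
have I1 : L1 m1 (fun x => \int[m2]_y f x y).
  apply/integrableP; split; first exact/measurable_EFinP.
  have /integrableP[mm] := integrable_fubini_F iF.
  apply: le_lt_trans; rewrite le_eqVlt; apply/orP; left; apply/eqP.
  apply: ae_eq_integral => //.
  - by apply: measurableT_comp => //; exact/measurable_EFinP.
  - exact: measurableT_comp.
  - by apply: filterS E1 => x h Ix; congr abse; exact: h.
split=> //.
  apply/integrableP; split; first exact/measurable_EFinP.
  have := (integrable21ltyP _ _ mF).1 iF.
  apply: le_lt_trans; apply: ae_ge0_le_integral => //.
  - by apply: measurableT_comp => //; exact/measurable_EFinP.
  - by move=> y _; exact: integral_ge0.
  - apply: (measurable_fun_fubini_tonelli_G (abse \o F)) => //=.
    exact: measurableT_comp.
  - apply: filterS2 E2 (ae_integrable2 iF) => y h hy Iy; rewrite [X in (`|X| <= _)%E](h Iy).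
    by apply: le_abse_integral => //; exact: measurable_int hy.
congr fine.
rewrite (ae_eq_integral _ _ _ _ _ E1)//; last 2 first.
  exact/measurable_EFinP.
  exact: measurable_fubini_F iF.
rewrite (ae_eq_integral _ _ _ _ _ E2)//; last 2 first.
  exact/measurable_EFinP.
  exact: measurable_fubini_G iF.
exact: (Fubini iF).
Qed.

(** * Affine changes of variable on the line *)

Section lebesgue_affine.
Context {R : realType}.
Notation leb := (@lebesgue_measure R).

(** Both sides are measures in A, so it suffices to compare them on intervals;
    the two cases are the orientations of the affine map. *)
Lemma lebesgue_preimage_affine (c a : R) (A : set R) : c != 0 -> measurable A ->
  leb A = (`|c|%:E * leb ((fun x => c * x + a)%R @^-1` A))%E.
Proof.
move=> c0 mA.
pose phi : measurableTypeR R -> measurableTypeR R := fun x => (c * x + a)%R.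
have mphi : measurable_fun setT phi.
  by apply: measurable_funD => //; exact: measurable_funM.
pose nu := mscale (NngNum (normr_ge0 c)) (pushforward leb phi).
suff h : leb A = nu mphi A by rewrite h.
apply: lebesgue_measure_unique => // X [[u v] _ <-] /=.
rewrite lebesgue_measure_itv/= lte_fin.
transitivity (`|c|%:E * leb (phi @^-1` `]u, v]%classic))%E; last by [].
have [c_gt0|c_lt0|/eqP] := ltgtP 0 c; last by rewrite eq_sym (negbTE c0).
- have -> : phi @^-1` `]u, v] = `](u - a) / c, (v - a) / c]%classic.
    apply/seteqP; split=> x /=; rewrite /phi !in_itv/= => /andP[h1 h2];
      apply/andP; split.
    + by rewrite ltr_pdivrMr// mulrC ltrBlDr.
    + by rewrite ler_pdivlMr// mulrC lerBrDr.
    + by move: h1; rewrite ltr_pdivrMr// mulrC ltrBlDr.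
    + by move: h2; rewrite ler_pdivlMr// mulrC lerBrDr.
  rewrite lebesgue_measure_itv/= lte_fin ltr_pM2r ?invr_gt0// ltrD2r.
  case: ifPn => _; last by rewrite mule0.
  by rewrite -!EFinB -EFinM gtr0_norm//; congr EFin; field.
- have -> : phi @^-1` `]u, v] = `[(v - a) / c, (u - a) / c[%classic.
    apply/seteqP; split=> x /=; rewrite /phi !in_itv/= => /andP[h1 h2];
      apply/andP; split.
    + by rewrite ler_ndivrMr// mulrC lerBrDr.
    + by rewrite ltr_ndivlMr// mulrC ltrBlDr.
    + by move: h2; rewrite ltr_ndivlMr// mulrC ltrBlDr.
    + by move: h1; rewrite ler_ndivrMr// mulrC lerBrDr.
  rewrite lebesgue_measure_itv/= lte_fin ltr_nM2r ?invr_lt0// ltrD2r.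
  case: ifPn => _; last by rewrite mule0.
  by rewrite -!EFinB -EFinM ltr0_norm//; congr EFin; field.
Qed.

Lemma ge0_integral_affine (c a : R) (f : R -> \bar R) : c != 0 ->
  measurable_fun setT f -> (forall x, 0 <= f x)%E ->
  (\int[leb]_x f x = `|c|%:E * \int[leb]_x f (c * x + a)%R)%E.
Proof.
move=> c0 mf f0.
pose phi : measurableTypeR R -> measurableTypeR R := fun x => (c * x + a)%R.
have mphi : measurable_fun setT phi.
  by apply: measurable_funD => //; exact: measurable_funM.
pose nu := mscale (NngNum (normr_ge0 c)) (pushforward leb phi).
rewrite (eq_measure_integral (nu mphi)); last first.
  by move=> A mA _; rewrite [LHS](lebesgue_preimage_affine a c0 mA).
rewrite ge0_integral_mscale//=; congr (_ * _)%E.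
by rewrite ge0_integral_pushforward// ?preimage_setT.
Qed.

Lemma L1_shift (a : R) (f : R -> R) : L1 leb f -> L1 leb (fun x => f (x + a)).
Proof.
move=> hf; have mf := L1_measurable hf.
have ms : measurable_fun setT (fun x : R => f (x + a)).
  by apply: (measurableT_comp mf); exact: measurable_funD.
apply/integrableP; split; first exact/measurable_EFinP.
have /integrableP[_] := hf.
rewrite (@ge0_integral_affine 1 a _ (oner_neq0 R))//; last first.
  by apply: measurableT_comp => //; exact/measurable_EFinP.
rewrite normr1 mul1e; congr (_ < _)%E; apply: eq_integral => x _ /=.
by rewrite mul1r.
Qed.

Lemma L1_opp (f : R -> R) : L1 leb f -> L1 leb (fun x => f (- x)).
Proof.
move=> hf; have mf := L1_measurable hf.
have ms : measurable_fun setT (fun x : R => f (- x)).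
  by apply: (measurableT_comp mf); exact: measurable_funN.
apply/integrableP; split; first exact/measurable_EFinP.
have /integrableP[_] := hf.
have c0 : (-1 : R) != 0 by rewrite oppr_eq0 oner_eq0.
rewrite (@ge0_integral_affine (-1) 0 _ c0)//; last first.
  by apply: measurableT_comp => //; exact/measurable_EFinP.
rewrite normrN1 mul1e; congr (_ < _)%E; apply: eq_integral => x _ /=.
by rewrite mulN1r addr0.
Qed.

Lemma Rint_affine1 (c a : R) (f : R -> R) : `|c| = 1 -> L1 leb f ->
  \int[leb]_x f (c * x + a) = \int[leb]_x f x.
Proof.
move=> c1 hf; have mf := L1_measurable hf.
have c0 : c != 0 by rewrite -normr_gt0 c1.
rewrite /Rintegral; congr fine.
rewrite [LHS]integralE [RHS]integralE; congr (_ - _)%E.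
- rewrite [RHS](@ge0_integral_affine c a)// ?c1 ?mul1e//.
    by apply: eq_integral => x _; rewrite !funeposE.
  by apply: measurable_funepos; exact/measurable_EFinP.
- rewrite [RHS](@ge0_integral_affine c a)// ?c1 ?mul1e//.
    by apply: eq_integral => x _; rewrite !funenegE.
  by apply: measurable_funeneg; exact/measurable_EFinP.
Qed.

Lemma Rint_shift (a : R) (f : R -> R) : L1 leb f ->
  \int[leb]_x f (x + a) = \int[leb]_x f x.
Proof.
move=> hf; rewrite -[RHS](@Rint_affine1 1 a _ (normr1 _) hf).
by apply: eq_Rint => x; rewrite mul1r.
Qed.

Lemma Rint_opp (f : R -> R) : L1 leb f ->
  \int[leb]_x f (- x) = \int[leb]_x f x.
Proof.
move=> hf; rewrite -[RHS](@Rint_affine1 (-1) 0 _ (normrN1 _) hf).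
by apply: eq_Rint => x; rewrite mulN1r addr0.
Qed.

Lemma Rint_odd (f : R -> R) : L1 leb f -> (forall x, f (- x) = - f x) ->
  \int[leb]_x f x = 0.
Proof.
move=> hf fN; have := Rint_opp hf.
rewrite (eq_Rint leb fN) RintN// => h.
by apply/eqP; rewrite -[X in X == _]addr0 -(subrr (\int[leb]_x f x)); lra.
Qed.

End lebesgue_affine.

(** * Gaussian functions *)

Ltac mfun := repeat first
  [ assumption
  | apply: measurable_cst | exact: measurable_id
  | exact: measurable_fst | exact: measurable_snd
  | apply: measurable_funD | apply: measurable_funB | apply: measurable_funN
  | apply: measurable_funM | apply: measurable_funX
  | apply: (measurableT_comp (@measurable_expR _))
  | apply: (measurableT_comp (continuous_measurable_fun (@continuous_sin _)))
  | apply: (measurableT_comp (continuous_measurable_fun (@continuous_cos _)))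
  | apply: (measurableT_comp (@normr_measurable _ setT)) ].

Section gauss.
Context {R : realType}.
Notation leb := (@lebesgue_measure R).
Implicit Types s t x g : R.

(** The two-sided exponential is dominated by the exponential density plus its
    reflection. *)
Lemma L1_expR_normN g : 0 < g -> L1 leb (fun x => expR (- (g * `|x|))).
Proof.
move=> g0.
have h : L1 leb (exponential_pdf g) := integrable_exponential_pdf g0.
have h' := L1Zl g^-1 (L1D h (L1_opp h)).
apply: (L1_le _ h'); first by mfun.
move=> x; rewrite ger0_norm ?expR_ge0//.
rewrite mulrDr; have [x0|x0] := lerP 0 x.
  rewrite (exponential_pdfE _ x0) mulKf ?gt_eqF// mulNr (ger0_norm x0) lerDl.
  by rewrite mulr_ge0 ?invr_ge0 ?(ltW g0)// exponential_pdf_ge0// ltW.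
have Nx0 : 0 <= - x by lra.
rewrite (exponential_pdfE _ Nx0) mulKf ?gt_eqF// mulNr (ltr0_norm x0) lerDr.
by rewrite mulr_ge0 ?invr_ge0 ?(ltW g0)// exponential_pdf_ge0// ltW.
Qed.

Definition gauss t x := expR (- (t * x ^+ 2)).

Lemma gauss_ge0 t x : 0 <= gauss t x. Proof. exact: expR_ge0. Qed.

Lemma measurable_gauss t : measurable_fun setT (gauss t).
Proof. by rewrite /gauss; mfun. Qed.

Lemma gauss_le1 t x : 0 <= t -> gauss t x <= 1.
Proof. by move=> t0; rewrite expR_le1 oppr_le0 mulr_ge0// sqr_ge0. Qed.

Lemma integral_gauss t : 0 < t ->
  (\int[leb]_x (gauss t x)%:E = (Num.sqrt pi / Num.sqrt t)%:E)%E.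
Proof.
move=> t0; have c0 : Num.sqrt t != 0 by rewrite gt_eqF// sqrtr_gt0.
have := @integralT_gauss R.
rewrite (@ge0_integral_affine R (Num.sqrt t) 0 (EFin \o gauss_fun) c0); last 2 first.
- by apply/measurable_EFinP; exact: measurable_gauss_fun.
- by move=> x; rewrite lee_fin gauss_fun_ge0.
rewrite ger0_norm ?sqrtr_ge0//.
under eq_integral => x _.
  rewrite /= /gauss_fun addr0 exprMn sqr_sqrtr ?ltW// -[expR _]/(gauss t x).
  over.
move=> h; rewrite mulrC EFinM -h muleA -EFinM mulVf// mul1e.
by [].
Qed.

Lemma L1_gauss t : 0 < t -> L1 leb (gauss t).
Proof.
move=> t0; apply/(L1_ge0P leb (measurable_gauss t) (gauss_ge0 t)).
by rewrite integral_gauss// ltry.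
Qed.

Lemma Rint_gauss t : 0 < t -> \int[leb]_x gauss t x = Num.sqrt pi / Num.sqrt t.
Proof. by move=> t0; rewrite /Rintegral integral_gauss. Qed.

(** Half of the Gaussian decay pays for the factor [`|x|]: with
    z = sqrt(t) |x| this is z <= exp(z^2 / 2). *)
Lemma norm_mul_gauss_le t x : 0 < t ->
  `|x| * gauss t x <= (Num.sqrt t)^-1 * gauss (t / 2) x.
Proof.
move=> t0; have s0 : 0 < Num.sqrt t by rewrite sqrtr_gt0.
rewrite ler_pdivlMl//.
have E : gauss (t / 2) x = gauss t x * expR (t * x ^+ 2 / 2).
  by rewrite /gauss -expRD; congr expR; field.
rewrite E mulrA [leRHS]mulrC; apply: ler_wpM2r; first exact: gauss_ge0.
apply: (le_trans _ (expR_ge1Dx _)).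
have -> : t * x ^+ 2 = (Num.sqrt t * `|x|) ^+ 2.
  by rewrite exprMn sqr_sqrtr ?ltW// real_normK// num_real.
set z := Num.sqrt t * `|x|; nra.
Qed.

Lemma L1_mul_gauss t : 0 < t -> L1 leb (fun x => x * gauss t x).
Proof.
move=> t0; have t2 : 0 < t / 2 by lra.
apply: (L1_le _ (L1Zl (Num.sqrt t)^-1 (L1_gauss t2))).
  by apply: measurable_funM => //; exact: measurable_gauss.
by move=> x; rewrite normrM (ger0_norm (gauss_ge0 _ _)); exact: norm_mul_gauss_le.
Qed.

(** As in [norm_mul_gauss_le], half of the decay absorbs the power, now because
    y^n / n! <= exp(y) for y >= 0. *)
Lemma L1_expr_gauss (n : nat) : L1 leb (fun x => x ^+ (2 * n) * gauss 1 x).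
Proof.
have h2 : 0 < (1 / 2 : R) by lra.
apply: (L1_le _ (L1Zl (2 ^+ n * n`!%:R) (L1_gauss h2))).
  by apply: measurable_funM; [mfun|exact: measurable_gauss].
move=> x; rewrite normrM (ger0_norm (gauss_ge0 _ _)).
have -> : gauss 1 x = gauss (1 / 2) x * gauss (1 / 2) x.
  by rewrite /gauss -expRD; congr expR; field.
rewrite mulrA; apply: ler_wpM2r; first exact: gauss_ge0.
rewrite exprM (ger0_norm (exprn_ge0 _ (sqr_ge0 _))).
rewrite /gauss expRN ler_pdivrMr ?expR_gt0//.
have -> : x ^+ 2 = 2 * (1 / 2 * x ^+ 2) by field.
set y := 1 / 2 * x ^+ 2; have y0 : 0 <= y by rewrite mulr_ge0 ?sqr_ge0//; lra.
have -> : 1 / 2 * (2 * y) = y by field.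
rewrite exprMn -mulrA ler_pM2l ?exprn_gt0//.
case: n => [|n].
  (* The bound of the exponential by its n-th Taylor term is for n >= 1. *)
  by rewrite expr0 fact0 mul1r; apply: (le_trans _ (expR_ge1Dx _)); lra.
rewrite -ler_pdivrMl ?ltr0n ?fact_gt0// mulrC.
by have := expR_ge1Dxn n y0; lra.
Qed.

Lemma cvg_gauss_nat t : 0 < t -> gauss t n%:R @[n --> \oo] --> 0.
Proof.
move=> t0.
have h : (1 + t^-1) * harmonic n @[n --> \oo] --> (1 + t^-1) * (0 : R).
  by apply: cvgMr; exact: cvg_harmonic.
rewrite mulr0 in h.
apply: (squeeze_cvgr _ (cvg_cst 0) h); apply: nearW => n /=.
rewrite gauss_ge0/= /gauss expRN /harmonic/= ler_pdivlMr ?ltr0n//.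
rewrite mulrC ler_pdivrMr ?expR_gt0//.
apply: (@le_trans _ _ ((1 + t^-1) * (1 + t * n%:R ^+ 2))); last first.
  by rewrite ler_pM2l ?expR_ge1Dx// addr_gt0// invr_gt0.
have -> : (1 + t^-1) * (1 + t * n%:R ^+ 2) = 1 + t * n%:R ^+ 2 + t^-1 + n%:R ^+ 2.
  by field; rewrite gt_eqF.
rewrite -natr1; have : (n%:R : R) <= n%:R ^+ 2.
  by rewrite -natrX ler_nat; case: n {h} => // n; rewrite leq_pmulr.
have : 0 <= t * n%:R ^+ 2 by rewrite mulr_ge0 ?sqr_ge0 ?ltW.
have : 0 < t^-1 by rewrite invr_gt0.
lra.
Qed.

(** The fundamental theorem of calculus on [-n, n], followed by dominated
    convergence. *)
Lemma Rint_derivative_eq0 (F f : R -> R) :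
  (forall x, is_derive x 1 F (f x)) -> continuous f -> L1 leb f ->
  F n%:R @[n --> \oo] --> 0 -> F (- n%:R) @[n --> \oo] --> 0 ->
  \int[leb]_x f x = 0.
Proof.
move=> dF cf hf Fy FNy.
have cF : continuous F.
  by move=> x; apply: differentiable_continuous; apply/derivable1_diffP; have [] := dF x.
pose I n : set R := `[(- n%:R), n%:R]%classic.
have mI n : measurable (I n) by exact: measurable_itv.
have mf := L1_measurable hf.
have h : \int[leb]_x (f x * \1_(I n) x) @[n --> \oo] --> \int[leb]_x f x.
  apply: (@dominated_Rint _ _ _ leb _ f (fun x => `|f x|) _ mf (L1_abs hf) _ _).2.
  - by move=> n; apply: (measurable_funM mf); apply: measurable_indic; exact: mI.
  - apply: aeW => x; apply: cvg_near_cst.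
    exists (Num.truncn `|x|).+1 => // n /= xn.
    have {}xn : `|x| <= n%:R.
      by apply: (le_trans (ltW (truncnS_gt _))); rewrite ler_nat.
    by rewrite indicE mem_set ?mulr1// /I/= in_itv/= -ler_norml.
  - move=> n x; rewrite normrM ler_piMr//.
    by rewrite indicE; case: (_ \in _); rewrite ?normr1 ?normr0.
have lim0 : \int[leb]_x (f x * \1_(I n) x) @[n --> \oo] --> 0.
  have H : F n%:R - F (- n%:R) @[n --> \oo] --> 0.
    by rewrite -(subr0 0); exact: cvgB.
  apply: (cvg_trans _ H); apply: near_eq_cvg.
  exists 1%N => // n /= n1.
  have nn : - n%:R < n%:R :> R by rewrite gtrN// ltr0n.
  have E := @continuous_FTC2 R f F (- n%:R) n%:R nn.
  have -> : \int[leb]_x (f x * \1_(I n) x) = \int[leb]_(x in I n) f x.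
    rewrite [RHS]Rintegral_mkcond; apply: eq_Rint => x.
    by rewrite patchE indicE; case: ifPn => _; rewrite ?mulr1 ?mulr0.
  rewrite /Rintegral E//.
  - exact: continuous_subspaceT.
  - split.
    + by move=> x _; have [] := dF x.
    + by apply: cvg_at_right_filter; exact: cF.
    + by apply: cvg_at_left_filter; exact: cF.
  - by move=> x _; rewrite derive1E; apply: derive_val.
by apply: (cvg_unique _ h lim0).
Qed.

End gauss.

(** * Fourier transforms of Gaussian functions *)

Section gauss_fourier.
Context {R : realType}.
Notation leb := (@lebesgue_measure R).
Variable t : R.
Hypothesis t0 : 0 < t.
Implicit Types s x : R.

Lemma L1_cos_gauss s : L1 leb (fun x => cos (s * x) * gauss t x).
Proof.
apply: (L1_le _ (L1_gauss t0)).
  by apply: measurable_funM; [mfun|exact: measurable_gauss].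
move=> x; rewrite normrM (ger0_norm (gauss_ge0 _ _)) ler_piMl ?gauss_ge0//.
exact: cos_max.
Qed.

Lemma L1_sin_gauss s : L1 leb (fun x => x * sin (s * x) * gauss t x).
Proof.
apply: (L1_le _ (L1_abs (L1_mul_gauss t0))).
  by apply: measurable_funM; [mfun|exact: measurable_gauss].
move=> x; rewrite !normrM (ger0_norm (gauss_ge0 _ _)) ler_wpM2r ?gauss_ge0//.
by rewrite ler_piMr// sin_max.
Qed.

Lemma is_derive_gauss x : is_derive x 1 (gauss t) (- (2 * t * x) * gauss t x).
Proof.
have h : is_derive x 1 (fun y : R => - (t * y ^+ 2)) (- (2 * t * x)).
  by apply: is_derive_eq; rewrite /GRing.scale/=; ring.
apply: (@is_derive_eq _ _ _ (expR \o (fun y : R => - (t * y ^+ 2)))).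
by rewrite /GRing.scale/= mulrC.
Qed.

Lemma continuous_gauss : continuous (gauss t).
Proof.
by move=> x; apply: differentiable_continuous; apply/derivable1_diffP; have [] := is_derive_gauss x.
Qed.

Lemma is_derive_sinM s x : is_derive x 1 (fun y => sin (s * y)) (s * cos (s * x)).
Proof.
apply: (@is_derive_eq _ _ _ (sin \o (fun y : R => s * y))).
by rewrite /GRing.scale/= mulr1 mulrC.
Qed.

Lemma is_derive_cosM s x :
  is_derive x 1 (fun y => cos (s * y)) (- (s * sin (s * x))).
Proof.
apply: (@is_derive_eq _ _ _ (cos \o (fun y : R => s * y))).
by rewrite /GRing.scale/=; ring.
Qed.

(** The difference of the two sides is the integral of the derivative of
    - exp(- t x^2) sin(s x), a function that vanishes at both infinities. *)
Lemma gauss_sin_by_parts s :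
  2 * t * \int[leb]_x (x * sin (s * x) * gauss t x) =
  s * \int[leb]_x (cos (s * x) * gauss t x).
Proof.
apply/eqP; rewrite -subr_eq0 -!RintZl -?RintB//; first last.
- exact: L1_sin_gauss.
- exact: L1_cos_gauss.
- by apply: L1Zl; exact: L1_cos_gauss.
- by apply: L1Zl; exact: L1_sin_gauss.
apply/eqP.
pose F x := - (gauss t x * sin (s * x)).
have Fle x : `|F x| <= gauss t x.
  rewrite normrN normrM (ger0_norm (gauss_ge0 _ _)) ler_piMr ?gauss_ge0//.
  exact: sin_max.
have cvF (u : nat -> R) : (forall n, gauss t (u n) = gauss t n%:R) ->
    F (u n) @[n --> \oo] --> 0.
  move=> un; apply/cvgr0Pnorm_le => e e0.
  have /cvgr0Pnorm_le/(_ _ e0) := cvg_gauss_nat t0.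
  apply: filterS => n; rewrite (ger0_norm (gauss_ge0 _ _)).
  by apply: le_trans; rewrite -un; exact: Fle.
apply: (@Rint_derivative_eq0 R F).
- move=> x; have h1 := is_derive_gauss x; have h2 := is_derive_sinM s x.
  apply: (@is_derive_eq _ _ _ (- ((gauss t) * (fun x => sin (s * x))))).
  by rewrite /GRing.scale/=; ring.
- move=> x; have cg := continuous_gauss (x := x).
  have cs : {for x, continuous (fun x => sin (s * x))}.
    by apply: continuous_comp; [exact: mulrl_continuous|exact: continuous_sin].
  have cc : {for x, continuous (fun x => cos (s * x))}.
    by apply: continuous_comp; [exact: mulrl_continuous|exact: continuous_cos].
  apply: cvgB; apply: cvgM; [exact: cvg_cst| | exact: cvg_cst|].
    by apply: cvgM => //; apply: cvgM => //; exact: cvg_id.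
  by apply: cvgM.
- by apply: L1B; apply: L1Zl; [exact: L1_sin_gauss|exact: L1_cos_gauss].
- by apply: cvF.
- by apply: cvF => n; rewrite /gauss sqrrN.
Qed.

(** Differentiation under the integral sign; |x| exp(- t x^2) dominates the
    derivative for all s. *)
Lemma is_derive_gauss_cos s :
  is_derive s 1 (fun s => \int[leb]_x (cos (s * x) * gauss t x))
    (- \int[leb]_x (x * sin (s * x) * gauss t x)).
Proof.
have d1 s' x : is_derive s' 1 (fun s => cos (s * x) * gauss t x)
    (- (x * sin (s' * x) * gauss t x)).
  have h : is_derive s' 1 (fun y => cos (y * x)) (- (x * sin (s' * x))).
    have := is_derive_cosM x s'; rewrite [s' * x]mulrC.
    by under eq_fun do rewrite mulrC.
  apply: (@is_derive_eq _ _ _ ((fun s => cos (s * x)) * cst (gauss t x))).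
  by rewrite /GRing.scale/= mulr0 add0r; ring.
have I1 : (`](s - 1), (s + 1)[%classic : set R) s.
  by rewrite /= in_itv/=; apply/andP; split; lra.
pose f s x := cos (s * x) * gauss t x.
have A1 : forall x : R, (`](s - 1), (s + 1)[%classic : set R) x ->
   leb.-integrable setT (EFin \o f x) by move=> x _; exact: L1_cos_gauss.
have A2 : forall x y : R, (`](s - 1), (s + 1)[%classic : set R) x -> setT y ->
   derivable (f ^~ y) x 1 by move=> x y _ _; have [] := d1 x y.
have A3 y : 0 <= `|y| * gauss t y by rewrite mulr_ge0 ?gauss_ge0.
have A4 : leb.-integrable setT (EFin \o (fun y => `|y| * gauss t y)).
  have := L1_abs (L1_mul_gauss t0); apply: eq_L1 => x.
  by rewrite normrM (ger0_norm (gauss_ge0 _ _)).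
have A5 x y : (`](s - 1), (s + 1)[%classic : set R) x -> setT y ->
    `|partial1of2 f x y| <= `|y| * gauss t y.
  move=> _ _; rewrite partial1of2E derive_val normrN !normrM (ger0_norm (gauss_ge0 _ _)).
  by rewrite ler_wpM2r ?gauss_ge0// ler_piMr// sin_max.
have B1 := derivable_under_integral measurableT I1 A1 A2 A3 A4 A5.
have B2 := differentiation_under_integral measurableT I1 A1 A2 A3 A4 A5.
apply: (DeriveDef B1); rewrite -derive1E B2 -RintN; last exact: L1_sin_gauss.
by apply: eq_Rint => x; rewrite partial1of2E derive_val.
Qed.

(** By the two previous lemmas the left-hand side F satisfies F' = - s / (2 t) F,
    hence F(s) exp(s^2 / (4 t)) is constant and can be read off at s = 0. *)
Lemma gauss_cos s : \int[leb]_x (cos (s * x) * gauss t x) =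
  Num.sqrt pi / Num.sqrt t * expR (- (s ^+ 2 / (4 * t))).
Proof.
pose F s := \int[leb]_x (cos (s * x) * gauss t x).
pose H s := F s * expR (s ^+ 2 / (4 * t)).
have t4 : 4 * t != 0 by rewrite mulf_neq0// gt_eqF.
have dH (u : R) : is_derive u 1 H 0.
  have h1 := is_derive_gauss_cos u.
  have h2 : is_derive u 1 (fun y : R => y ^+ 2 / (4 * t)) (2 * u / (4 * t)).
    by apply: is_derive_eq; rewrite /GRing.scale/=; ring.
  apply: (@is_derive_eq _ _ _ (F * (expR \o (fun y : R => y ^+ 2 / (4 * t))))).
  rewrite /GRing.scale/=.
  have := gauss_sin_by_parts u; rewrite -/(F u) => h.
  have -> : \int[leb]_x (x * sin (u * x) * gauss t x) = u * F u / (2 * t).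
    by rewrite -h; field; rewrite gt_eqF.
  by field; rewrite gt_eqF.
have : H s = H 0 by apply: is_derive_0_is_cst.
rewrite /H expr0n/= mul0r expR0 mulr1.
have -> : F 0 = Num.sqrt pi / Num.sqrt t.
  by rewrite -(Rint_gauss t0); apply: eq_Rint => x; rewrite mul0r cos0 mul1r.
by move=> <-; rewrite expRN mulfK// gt_eqF// expR_gt0.
Qed.

Lemma gauss_sin s : \int[leb]_x (x * sin (s * x) * gauss t x) =
  s / (2 * t) * (Num.sqrt pi / Num.sqrt t * expR (- (s ^+ 2 / (4 * t)))).
Proof.
rewrite -gauss_cos; have := gauss_sin_by_parts s => h.
have t2 : 2 * t != 0 by rewrite mulf_neq0// gt_eqF.
by apply: (mulfI t2); rewrite h mulrA; congr (_ * _); field; rewrite gt_eqF.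
Qed.

End gauss_fourier.

(** * Iterated differences *)

Section differences.
Context {R : realType}.
Notation leb := (@lebesgue_measure R).
Implicit Types (f g : R -> R) (x y : R) (n m : nat).

(** The central second difference: it is self-adjoint, preserves parity and
    has cos and sin as eigenvectors. *)
Definition dif f x := f (x + 1) + f (x - 1) - 2 * f x.

(** [dif] with all signs positive, so that |dif f| <= adif |f|. *)
Definition adif f x := f (x + 1) + f (x - 1) + 2 * f x.

(** Forward differences lower degrees by exactly one at a time, which makes
    them the convenient ones for annihilating polynomials. *)
Definition fdif f x := f (x + 1) - f x.

Lemma iter_fdif_comb n (a b : R) f g x :
  iter n fdif (fun u => a * f u + b * g u) x =
  a * iter n fdif f x + b * iter n fdif g x.
Proof. by elim: n x => //= n IH x; rewrite /fdif !IH; ring. Qed.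

Lemma iter_fdif0 n m f : (n <= m)%N ->
  (forall x, iter n fdif f x = 0) -> forall x, iter m fdif f x = 0.
Proof.
move=> nm f0; rewrite -(subnK nm); elim: (m - n)%N => [//|k IH] x.
by rewrite addSn iterS /fdif !IH subrr.
Qed.

(** Multiplying by the variable raises the degree by one: by the Leibniz rule,
    fdif (u f) = u fdif f + fdif f + f. *)
Lemma iter_fdifX n f : (forall x, iter n fdif f x = 0) ->
  forall x, iter n.+1 fdif (fun u => u * f u) x = 0.
Proof.
elim: n f => [|n IH] f f0 x.
  by rewrite /= /fdif; have /= -> := f0 (x + 1); have /= -> := f0 x; ring.
have E : fdif (fun u => u * f u) =
    (fun u => 1 * (u * fdif f u) + 1 * (1 * fdif f u + 1 * f u)).
  by apply/funext => u; rewrite /fdif; ring.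
rewrite iterSr E !iter_fdif_comb IH; last first.
  by move=> u; rewrite -iterSr f0.
by rewrite -iterSr f0 (iter_fdif0 _ f0)// !(mulr0, addr0).
Qed.

(** [dif] is the square of [fdif] up to a unit translation. *)
Lemma iter_dif_fdif n f x : iter n dif f x = iter n.*2 fdif f (x - n%:R).
Proof.
elim: n x => [|n IH] x; first by rewrite subr0.
have fdifE g u : fdif g u = g (u + 1) - g u by [].
rewrite iterS /dif !IH doubleS !iterS !fdifE -[n.+1%:R]natr1.
have -> : x - (n%:R + 1) + 1 + 1 = x + 1 - n%:R by ring.
have -> : x - (n%:R + 1) + 1 = x - n%:R by ring.
have -> : x - (n%:R + 1) = x - 1 - n%:R by ring.
ring.
Qed.

Lemma iter_dif_comb n (a b : R) f g x :
  iter n dif (fun u => a * f u + b * g u) x =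
  a * iter n dif f x + b * iter n dif g x.
Proof. by rewrite !iter_dif_fdif iter_fdif_comb. Qed.

Lemma iter_difZ n (a : R) f x :
  iter n dif (fun u => a * f u) x = a * iter n dif f x.
Proof. by elim: n x => //= n IH x; rewrite /dif !IH; ring. Qed.

Lemma iter_dif_odd n f : (forall x, f (- x) = - f x) ->
  forall x, iter n dif f (- x) = - iter n dif f x.
Proof.
move=> fN; elim: n => //= n IH x; rewrite /dif.
have -> : - x + 1 = - (x - 1) by ring.
have -> : - x - 1 = - (x + 1) by ring.
by rewrite !IH; ring.
Qed.

Lemma iter_dif_cos n (l x : R) :
  iter n dif (fun u => cos (l * u)) x = (2 * cos l - 2) ^+ n * cos (l * x).
Proof.
elim: n x => [x|n IH x]; first by rewrite expr0 mul1r.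
rewrite iterS /dif !IH exprS mulrDr mulrBr mulr1 cosD cosB; ring.
Qed.

Lemma iter_dif_sin n (l x : R) :
  iter n dif (fun u => sin (l * u)) x = (2 * cos l - 2) ^+ n * sin (l * x).
Proof.
elim: n x => [x|n IH x]; first by rewrite expr0 mul1r.
rewrite iterS /dif !IH exprS mulrDr mulrBr mulr1 sinD sinB; ring.
Qed.

Lemma le_iter_adif n f g : (forall x, f x <= g x) ->
  forall x, iter n adif f x <= iter n adif g x.
Proof.
move=> fg; elim: n => //= n IH x; rewrite /adif.
by have := IH (x + 1); have := IH (x - 1); have := IH x; lra.
Qed.

Lemma iter_adif_ge0 n f : (forall x, 0 <= f x) ->
  forall x, 0 <= iter n adif f x.
Proof.
move=> f0; elim: n => //= n IH x; rewrite /adif.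
by have := IH (x + 1); have := IH (x - 1); have := IH x; lra.
Qed.

Lemma iter_adif_le n f (c : R) : (forall x, f x <= c) ->
  forall x, iter n adif f x <= 4 ^+ n * c.
Proof.
move=> fc; elim: n => [x|n IH x]; first by rewrite mul1r.
rewrite iterS /adif exprS.
by have := IH (x + 1); have := IH (x - 1); have := IH x; lra.
Qed.

Lemma iter_adifZ n (a : R) f x :
  iter n adif (fun u => a * f u) x = a * iter n adif f x.
Proof. by elim: n x => //= n IH x; rewrite /adif !IH; ring. Qed.

Lemma norm_iter_dif_le n f x :
  `|iter n dif f x| <= iter n adif (fun u => `|f u|) x.
Proof.
elim: n x => //= n IH x; rewrite /dif /adif.
apply: (le_trans (ler_normB _ _)); rewrite normrM (ger0_norm (ler0n _ 2)).
have := ler_normD (iter n dif f (x + 1)) (iter n dif f (x - 1)).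
by have := IH (x + 1); have := IH (x - 1); have := IH x; lra.
Qed.

(** sqrt is subadditive and sqrt 2 <= 2. *)
Lemma sqrt_iter_adif_le n f : (forall x, 0 <= f x) ->
  forall x, Num.sqrt (iter n adif f x) <= iter n adif (fun u => Num.sqrt (f u)) x.
Proof.
move=> f0; elim: n => //= n IH x; rewrite /adif.
have h u := iter_adif_ge0 n f0 u.
set a := iter n adif f (x + 1); set b := iter n adif f (x - 1).
set c := iter n adif f x.
apply: (@le_trans _ _ (Num.sqrt a + Num.sqrt b + 2 * Num.sqrt c)); last first.
  by have := IH (x + 1); have := IH (x - 1); have := IH x; lra.
have [a0 b0 c0] : [/\ 0 <= a, 0 <= b & 0 <= c] by split; exact: h.
have sa := sqr_sqrtr a0; have sb := sqr_sqrtr b0; have sc := sqr_sqrtr c0.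
have [pa pb pc] : [/\ 0 <= Num.sqrt a, 0 <= Num.sqrt b & 0 <= Num.sqrt c].
  by split; exact: sqrtr_ge0.
have S0 : 0 <= Num.sqrt a + Num.sqrt b + 2 * Num.sqrt c by lra.
rewrite -[leRHS]ger0_norm// -sqrtr_sqr ler_sqrt ?sqr_ge0//.
rewrite -{1}sa -{1}sb -{1}sc.
have := mulr_ge0 pa pb; have := mulr_ge0 pa pc; have := mulr_ge0 pb pc.
have := sqr_ge0 (Num.sqrt c); nra.
Qed.

Lemma L1_iter_adif n f : L1 leb f -> L1 leb (iter n adif f) /\
  \int[leb]_x iter n adif f x = 4 ^+ n * \int[leb]_x f x.
Proof.
move=> hf; elim: n => [|n [IH1 IH2]]; first by rewrite expr0 mul1r.
have h1 := L1_shift 1 IH1; have h2 := L1_shift (-1) IH1; have h3 := L1Zl 2 IH1.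
split; first exact: (L1D (L1D h1 h2) h3).
rewrite iterS /adif RintD//; last exact: L1D.
rewrite (RintD h1 h2) RintZl// !Rint_shift// IH2 exprS; ring.
Qed.

Lemma L1_iter_dif n f : L1 leb f -> L1 leb (iter n dif f).
Proof.
move=> hf; elim: n => // n IH.
exact: (L1B (L1D (L1_shift 1 IH) (L1_shift (-1) IH)) (L1Zl 2 IH)).
Qed.

Lemma L1_sinM f : L1 leb f -> L1 leb (fun x => sin x * f x).
Proof.
move=> hf; apply: (L1_le _ (L1_abs hf)).
  apply: measurable_funM; last exact: L1_measurable hf.
  exact: (continuous_measurable_fun (@continuous_sin _)).
by move=> x; rewrite normrM ler_piMl// sin_max.
Qed.

Lemma L1_cosM f : L1 leb f -> L1 leb (fun x => cos x * f x).
Proof.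
move=> hf; apply: (L1_le _ (L1_abs hf)).
  apply: measurable_funM; last exact: L1_measurable hf.
  exact: (continuous_measurable_fun (@continuous_cos _)).
by move=> x; rewrite normrM ler_piMl// cos_max.
Qed.

(** [dif] is self-adjoint for Lebesgue measure, and sin is an eigenvector for
    the eigenvalue 2 cos 1 - 2. *)
Lemma Rint_sin_iter_dif n f : L1 leb f ->
  \int[leb]_x (sin x * iter n dif f x) =
  (2 * cos 1 - 2) ^+ n * \int[leb]_x (sin x * f x).
Proof.
move=> hf; elim: n => [|n IH]; first by rewrite expr0 mul1r.
set F := iter n dif f; have hF : L1 leb F by exact: L1_iter_dif.
have hs := L1_sinM hF; have hc := L1_cosM hF.
have h1 := L1_shift 1 hF; have h2 := L1_shift (-1) hF.
have e1 : \int[leb]_x (sin x * F (x + 1)) =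
    cos 1 * \int[leb]_x (sin x * F x) - sin 1 * \int[leb]_x (cos x * F x).
  have -> : (fun x => sin x * F (x + 1)) =
            (fun x => (fun y => sin (y - 1) * F y) (x + 1)).
    by apply/funext => x; rewrite addrK.
  have E : (fun y => sin (y - 1) * F y) =
           (fun y => cos 1 * (sin y * F y) - sin 1 * (cos y * F y)).
    by apply/funext => y; rewrite sinB; ring.
  rewrite (Rint_shift 1 (f := fun y => sin (y - 1) * F y)) E.
    by rewrite RintB ?RintZl//; exact: L1Zl.
  by apply: L1B; exact: L1Zl.
have e2 : \int[leb]_x (sin x * F (x - 1)) =
    cos 1 * \int[leb]_x (sin x * F x) + sin 1 * \int[leb]_x (cos x * F x).
  have -> : (fun x => sin x * F (x - 1)) =
            (fun x => (fun y => sin (y + 1) * F y) (x + -1)).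
    by apply/funext => x; rewrite subrK.
  have E : (fun y => sin (y + 1) * F y) =
           (fun y => cos 1 * (sin y * F y) + sin 1 * (cos y * F y)).
    by apply/funext => y; rewrite sinD; ring.
  rewrite (Rint_shift (-1) (f := fun y => sin (y + 1) * F y)) E.
    by rewrite RintD ?RintZl//; exact: L1Zl.
  by apply: L1D; exact: L1Zl.
rewrite iterS -/F.
have -> : (fun x => sin x * dif F x) =
    (fun x => sin x * F (x + 1) + sin x * F (x - 1) - 2 * (sin x * F x)).
  by apply/funext => x; rewrite /dif; ring.
have sM g : L1 leb g -> L1 leb (fun x => sin x * g x) by exact: L1_sinM.
rewrite RintB; [|by apply: L1D; exact: sM|exact: L1Zl].
rewrite RintD; [|exact: sM|exact: sM].
by rewrite RintZl// e1 e2 IH exprS; ring.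
Qed.

Lemma Rint_iter_dif {d} {T : measurableType d} (mu : {measure set T -> \bar R})
    n (F : T -> R -> R) : (forall x, L1 mu (fun w => F w x)) ->
  (forall x, L1 mu (fun w => iter n dif (F w) x)) /\
  (forall x, iter n dif (fun x => \int[mu]_w F w x) x =
             \int[mu]_w iter n dif (F w) x).
Proof.
move=> hF; elim: n => // n [IH1 IH2]; split=> x.
  exact: (L1B (L1D (IH1 _) (IH1 _)) (L1Zl 2 (IH1 _))).
rewrite iterS /dif !IH2 -RintZl// -RintD// -RintB//; first exact: L1D.
exact: L1Zl.
Qed.

Lemma measurable_iter_dif {d} {T : measurableType d} n (F : T -> R -> R) :
  measurable_fun setT (fun z : T * R => F z.1 z.2) ->
  measurable_fun setT (fun z : T * R => iter n dif (F z.1) z.2).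
Proof.
move=> mF; elim: n => // n IH.
have sh (c : R) : measurable_fun setT (fun z : T * R => iter n dif (F z.1) (z.2 + c)).
  apply: (measurableT_comp (f := fun z : T * R => iter n dif (F z.1) z.2)
    (g := fun z : T * R => (z.1, z.2 + c)) IH).
  by apply: measurable_fun_pair => //; mfun.
apply: measurable_funB; first by apply: measurable_funD; exact: sh.
by apply: measurable_funM => //; mfun.
Qed.

End differences.

(** * Iterated differences of Gaussian functions *)

Section gauss_differences.
Context {R : realType}.
Notation leb := (@lebesgue_measure R).
Implicit Types (f g : R -> R) (t x y : R) (n m : nat).

Lemma norm_sin_le x : `|sin x| <= `|x|.
Proof.
wlog x0 : x / 0 <= x => [h|].
  have [|x0] := lerP 0 x; first exact: h.
  by rewrite -normrN -sinN -(normrN x); apply: h; lra.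
have [] := @MVT_segment R sin cos 0 x x0 (fun y _ => is_derive_sin y).
- by apply: continuous_subspaceT; exact: continuous_sin.
- move=> c _; rewrite sin0 !subr0 => ->.
  by rewrite normrM ler_piMl// cos_max.
Qed.

(** 2 - 2 cos x = 4 sin(x/2)^2. *)
Lemma norm_cos_sub_le x : `|2 * cos x - 2| <= x ^+ 2.
Proof.
have -> : x = (x / 2) *+ 2 by rewrite -mulr_natr mulfVK.
set y := x / 2; rewrite cos_mulr2n cos2sin2.
have -> : 2 * ((1 - sin y ^+ 2) *+ 2 - 1) - 2 = - (4 * sin y ^+ 2) by ring.
rewrite normrN (ger0_norm (mulr_ge0 _ (sqr_ge0 _)))//.
have -> : (y *+ 2) ^+ 2 = 4 * y ^+ 2 by ring.
rewrite ler_pM2l//; have := norm_sin_le y => h.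
by rewrite -(real_normK (num_real (sin y))) -(real_normK (num_real y)) ler_sqr ?nnegrE.
Qed.

(** Differences act on a Gaussian through their eigenvalues once it is written
    as a superposition of cosines. *)
Lemma gauss_as_cos t x : 0 < t ->
  gauss t x = (Num.sqrt pi)^-1 *
    \int[leb]_v (cos (2 * Num.sqrt t * v * x) * gauss 1 v).
Proof.
move=> t0.
have -> : (fun v => cos (2 * Num.sqrt t * v * x) * gauss 1 v) =
    (fun v => cos (2 * Num.sqrt t * x * v) * gauss 1 v).
  by apply/funext => v; congr (cos _ * _); ring.
rewrite gauss_cos// sqrtr1 divr1 mulrA mulVf ?mul1r; last first.
  by rewrite gt_eqF// sqrtr_gt0 pi_gt0.
congr expR; have := sqr_sqrtr (ltW t0); set s := Num.sqrt t => <-.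
by field.
Qed.

Lemma mul_gauss_as_sin t x : 0 < t ->
  x * gauss t x = (Num.sqrt pi * Num.sqrt t)^-1 *
    \int[leb]_v (v * sin (2 * Num.sqrt t * v * x) * gauss 1 v).
Proof.
move=> t0.
have -> : (fun v => v * sin (2 * Num.sqrt t * v * x) * gauss 1 v) =
    (fun v => v * sin (2 * Num.sqrt t * x * v) * gauss 1 v).
  by apply/funext => v; congr (_ * sin _ * _); ring.
rewrite gauss_sin// sqrtr1 divr1.
have p0 : Num.sqrt pi != 0 :> R by rewrite gt_eqF// sqrtr_gt0 pi_gt0.
have s0 : Num.sqrt t != 0 by rewrite gt_eqF// sqrtr_gt0.
have -> : expR (- ((2 * Num.sqrt t * x) ^+ 2 / (4 * 1))) = gauss t x.
  congr expR; have := sqr_sqrtr (ltW t0); set s := Num.sqrt t => <-.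
  by field.
by field; rewrite s0 p0.
Qed.

Definition gauss_moment n : R := \int[leb]_v (v ^+ (2 * n) * gauss 1 v).

Lemma gauss_moment_ge0 n : 0 <= gauss_moment n.
Proof.
by apply: Rint_ge0 => v; rewrite exprM mulr_ge0 ?gauss_ge0// exprn_ge0 ?sqr_ge0.
Qed.

Lemma norm_multiplier_le n t v : 0 <= t ->
  `|(2 * cos (2 * Num.sqrt t * v) - 2) ^+ n| <= 4 ^+ n * t ^+ n * v ^+ (2 * n).
Proof.
move=> t0; rewrite normrX.
have -> : 4 ^+ n * t ^+ n * v ^+ (2 * n) = ((2 * Num.sqrt t * v) ^+ 2) ^+ n.
  by rewrite exprM -!exprMn; congr (_ ^+ _); rewrite !exprMn sqr_sqrtr//; ring.
by apply: lerXn2r; rewrite ?nnegrE ?sqr_ge0// norm_cos_sub_le.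
Qed.

(** Smallness for small t, uniformly in x: each cosine of [gauss_as_cos] is
    multiplied by an eigenvalue of size at most (4 t v^2)^n. *)
Lemma iter_dif_gauss_le n t x : 0 < t ->
  `|iter n dif (gauss t) x| <=
  4 ^+ n / Num.sqrt pi * gauss_moment n * t ^+ n.
Proof.
move=> t0; have p0 : 0 < Num.sqrt pi :> R by rewrite sqrtr_gt0 pi_gt0.
have -> : gauss t = (fun x => (Num.sqrt pi)^-1 *
    \int[leb]_v (cos (2 * Num.sqrt t * v * x) * gauss 1 v)).
  by apply/funext => u; exact: gauss_as_cos.
pose F v u := cos (2 * Num.sqrt t * v * u) * gauss 1 v.
have hF u : L1 leb (F ^~ u).
  have := @L1_cos_gauss R 1 ltr01 (2 * Num.sqrt t * u); apply: eq_L1 => v.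
  by rewrite /F; congr (cos _ * _); ring.
have [h1 h2] := Rint_iter_dif n hF.
rewrite iter_difZ (h2 x) normrM ger0_norm ?invr_ge0 ?(ltW p0)//.
rewrite (mulrC (4 ^+ n)) -!mulrA ler_pM2l ?invr_gt0//.
apply: (le_trans (le_normr_Rintegral measurableT (h1 x))).
have -> : 4 ^+ n * (gauss_moment n * t ^+ n) =
    \int[leb]_v ((4 ^+ n * t ^+ n) * (v ^+ (2 * n) * gauss 1 v)).
  by rewrite RintZl -/(gauss_moment n); [ring|exact: L1_expr_gauss].
apply: le_Rint; [exact: L1_abs|by apply: L1Zl; exact: L1_expr_gauss|].
move=> v; have -> : F v = (fun u => gauss 1 v * cos (2 * Num.sqrt t * v * u)).
  by apply/funext => u; rewrite mulrC.
rewrite iter_difZ iter_dif_cos normrM (ger0_norm (gauss_ge0 _ _)) mulrA [leRHS]mulrC.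
rewrite ler_wpM2l ?gauss_ge0// normrM.
apply: (@le_trans _ _ (`|(2 * cos (2 * Num.sqrt t * v) - 2) ^+ n| * 1)).
  by rewrite ler_wpM2l// cos_max.
by rewrite mulr1; exact: norm_multiplier_le (ltW t0).
Qed.

(** Same argument as for [iter_dif_gauss_le], with sines. The extra factor |v|
    is bounded by 1 + v^2, hence the second moment. *)
Lemma iter_dif_mul_gauss_le n t x : 0 < t ->
  `|iter n dif (fun u => u * gauss t u) x| <=
  (Num.sqrt t)^-1 *
  (4 ^+ n / Num.sqrt pi * (gauss_moment n + gauss_moment n.+1) * t ^+ n).
Proof.
move=> t0; have p0 : 0 < Num.sqrt pi :> R by rewrite sqrtr_gt0 pi_gt0.
have s0 : 0 < Num.sqrt t by rewrite sqrtr_gt0.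
have -> : (fun u => u * gauss t u) = (fun x => (Num.sqrt pi * Num.sqrt t)^-1 *
    \int[leb]_v (v * sin (2 * Num.sqrt t * v * x) * gauss 1 v)).
  by apply/funext => u; exact: mul_gauss_as_sin.
pose F v u := v * sin (2 * Num.sqrt t * v * u) * gauss 1 v.
have hF u : L1 leb (F ^~ u).
  have := @L1_sin_gauss R 1 ltr01 (2 * Num.sqrt t * u); apply: eq_L1 => v.
  by rewrite /F; congr (_ * sin _ * _); ring.
have [h1 h2] := Rint_iter_dif n hF.
rewrite iter_difZ (h2 x) normrM invfM ger0_norm; last first.
  by rewrite mulr_ge0 ?invr_ge0 ?ltW.
rewrite [_^-1 / _]mulrC (mulrC (4 ^+ n)) -!mulrA !ler_pM2l ?invr_gt0//.
apply: (le_trans (le_normr_Rintegral measurableT (h1 x))).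
have i1 := @L1_expr_gauss R n; have i2 := @L1_expr_gauss R n.+1.
have -> : 4 ^+ n * ((gauss_moment n + gauss_moment n.+1) * t ^+ n) =
    \int[leb]_v ((4 ^+ n * t ^+ n) *
      (v ^+ (2 * n) * gauss 1 v + v ^+ (2 * n.+1) * gauss 1 v)).
  rewrite RintZl; last exact: L1D.
  by rewrite RintD// -/(gauss_moment n) -/(gauss_moment n.+1); ring.
apply: le_Rint; [exact: L1_abs|by apply: L1Zl; exact: L1D|].
move=> v; have -> : F v = (fun u => v * gauss 1 v * sin (2 * Num.sqrt t * v * u)).
  by apply/funext => u; rewrite /F; ring.
rewrite iter_difZ iter_dif_sin !normrM (ger0_norm (gauss_ge0 _ _)).
apply: (@le_trans _ _ (`|v| * gauss 1 v *
    `|(2 * cos (2 * Num.sqrt t * v) - 2) ^+ n|)).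
  rewrite ler_wpM2l ?mulr_ge0 ?gauss_ge0//.
  by rewrite ler_piMr// sin_max.
have -> : 4 ^+ n * t ^+ n * (v ^+ (2 * n) * gauss 1 v + v ^+ (2 * n.+1) * gauss 1 v)
    = (1 + v ^+ 2) * gauss 1 v * (4 ^+ n * t ^+ n * v ^+ (2 * n)).
  by rewrite mulnS exprD; ring.
apply: ler_pM => //.
- by rewrite mulr_ge0 ?gauss_ge0.
- rewrite ler_wpM2r ?gauss_ge0// -(real_normK (num_real v)).
  by have := sqr_ge0 (`|v| - 1); nra.
- exact: norm_multiplier_le (ltW t0).
Qed.

(** One bound decays in x but is not small for small t, the other one is small
    but does not decay. Their geometric mean has both properties, at the price
    of half the power of t and half the Gaussian exponent. *)
Lemma iter_dif_interpolation n t (a c : R) f : 0 < t -> 0 <= a -> 0 <= c ->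
  (forall x, `|f x| <= a * gauss (t / 2) x) ->
  (forall x, `|iter (2 * n) dif f x| <= a * (c * t ^+ (2 * n))) ->
  forall x, `|iter (2 * n) dif f x| <=
    a * (1 + Num.sqrt c) * Num.min 1 (t ^+ n) *
    iter (2 * n) adif (gauss (t / 4)) x.
Proof.
move=> t0 a0 c0 fle dle x.
set V := iter (2 * n) adif (gauss (t / 4)) x.
have V0 : 0 <= V by apply: iter_adif_ge0 => u; exact: gauss_ge0.
pose W := iter (2 * n) adif (gauss (t / 2)) x.
have W0 : 0 <= W by apply: iter_adif_ge0 => u; exact: gauss_ge0.
have dW : `|iter (2 * n) dif f x| <= a * W.
  apply: (le_trans (norm_iter_dif_le _ _ _)); rewrite -iter_adifZ.
  exact: le_iter_adif.
have WV : W <= V.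
  apply: le_iter_adif => u; rewrite ler_expR lerN2 ler_wpM2r ?sqr_ge0//.
  by lra.
have sWV : Num.sqrt W <= V.
  have g0 u : 0 <= gauss (t / 2) u by exact: gauss_ge0.
  apply: (le_trans (sqrt_iter_adif_le (2 * n) g0 x)).
  apply: le_iter_adif => u.
  have -> : gauss (t / 2) u = gauss (t / 4) u ^+ 2.
    by rewrite /gauss -expRM_natl; congr expR; field.
  by rewrite sqrtr_sqr ger0_norm// gauss_ge0.
have sc := sqrtr_ge0 c; have tn : 0 < t ^+ n by rewrite exprn_gt0.
rewrite /Num.min; case: ifPn => _.
  rewrite mulr1; apply: (le_trans dW); rewrite -mulrA ler_wpM2l//.
  by rewrite (le_trans WV)// ler_peMl// lerDl.
have h2 : `|iter (2 * n) dif f x| <= a * (Num.sqrt c * t ^+ n * Num.sqrt W).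
  rewrite -(ger0_norm (_ : 0 <= a * (Num.sqrt c * t ^+ n * Num.sqrt W))); last first.
    by rewrite !mulr_ge0 ?sqrtr_ge0// ltW.
  rewrite -ler_sqr ?nnegrE//.
  have -> : `|a * (Num.sqrt c * t ^+ n * Num.sqrt W)| ^+ 2 =
      (a * (c * t ^+ (2 * n))) * (a * W).
    rewrite real_normK ?num_real// mulnC exprM !exprMn !sqr_sqrtr//; ring.
  by rewrite expr2; apply: ler_pM.
apply: (le_trans h2); rewrite -!mulrA ler_wpM2l//.
rewrite [t ^+ n * V]mulrC !mulrA [_ * V]mulrC.
have -> : Num.sqrt c * t ^+ n * Num.sqrt W = Num.sqrt W * (Num.sqrt c) * t ^+ n by ring.
rewrite ler_wpM2r ?(ltW tn)//; by apply: ler_pM => //; last by rewrite lerDr.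
Qed.

End gauss_differences.

(** * Powers as mixtures of exponential remainders *)

Section rho.
Context {R : realType}.
Notation leb := (@lebesgue_measure R).
Implicit Types (z t x y : R) (k n m : nat).

(** rho k z = (-1)^k (exp(- z) - sum_(j < k) (- z)^j / j!), the Taylor remainder of
    exp(- z), with the sign that makes it positive. *)
Fixpoint rho k z : R :=
  if k is n.+1 then z ^+ n / n`!%:R - rho n z else expR (- z).

Lemma rho0 k : rho k.+1 0 = 0.
Proof.
elim: k => [|k IH]; first by rewrite /= fact0 expr0 divr1 oppr0 expR0 subrr.
by rewrite [LHS]/= expr0n mul0r sub0r -[X in - X = _]/(rho k.+1 0) IH oppr0.
Qed.

Lemma is_derive_rho k z : is_derive z 1 (rho k.+1) (rho k z).
Proof.
have hX n : is_derive z 1 (fun u : R => u ^+ n.+1 / (n.+1)`!%:R) (z ^+ n / n`!%:R).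
  have hD : is_derive z 1 (fun u : R => u ^+ n.+1) (n.+1%:R * z ^+ n).
    apply: DeriveDef; first exact: exprn_derivable.
    by rewrite exp_derive /= /GRing.scale/= mulr1.
  apply: (@is_derive_eq _ _ _
    ((fun u : R => u ^+ n.+1) * cst ((n.+1)`!%:R)^-1)).
  rewrite scaler0 add0r /GRing.scale/= factS natrM.
  have n0 : n`!%:R != 0 :> R by rewrite pnatr_eq0 -lt0n fact_gt0.
  by field; rewrite n0 addrC natr1 pnatr_eq0.
have he : is_derive z 1 (fun u : R => expR (- u)) (- expR (- z)).
  apply: (@is_derive_eq _ _ _ (expR \o (-%R : R -> R))).
  by rewrite /GRing.scale/= mulrN1.
elim: k => [|k IH].
  apply: (@is_derive_eq _ _ _ (cst (1 / 1) - (fun u : R => expR (- u)))) => /=.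
  by rewrite sub0r opprK.
have := hX k => h.
by apply: (@is_derive_eq _ _ _ ((fun u : R => u ^+ k.+1 / (k.+1)`!%:R) - rho k.+1)).
Qed.

(** rho k.+1 is the antiderivative of rho k that vanishes at 0. *)
Lemma rho_gt0 k z : 0 < z -> 0 < rho k z.
Proof.
elim: k z => [|k IH] z z0; first exact: expR_gt0.
have cr : {within `[0, z], continuous (rho k.+1)}.
  apply: continuous_subspaceT => u; apply: differentiable_continuous.
  by apply/derivable1_diffP; have [] := is_derive_rho k u.
have [c cz] := MVT z0 (fun u _ => is_derive_rho k u) cr.
have /andP[c0 _] : 0 < c < z by move: cz; rewrite in_itv.
by rewrite rho0 !subr0 => ->; rewrite mulr_gt0// IH.
Qed.

Lemma rho_lt k z : 0 < z -> rho k z < z ^+ k / k`!%:R.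
Proof. by move=> z0; have := rho_gt0 k.+1 z0; rewrite /= subr_gt0. Qed.

Lemma expr_fact_le k z : 0 < z -> z ^+ k / k`!%:R <= z ^+ k.
Proof.
move=> z0; rewrite ler_pdivrMr ?ltr0n ?fact_gt0//.
by apply: ler_peMr; [rewrite exprn_ge0// ltW|rewrite ler1n fact_gt0].
Qed.

Lemma rho_le k z : 0 < z -> rho k z <= z ^+ k.
Proof. by move=> z0; apply/ltW/(lt_le_trans (rho_lt k z0))/expr_fact_le. Qed.

(** The growth of rho k at infinity, z^(k-1), as opposed to its order z^k at 0
    given by [rho_le]. *)
Lemma mul_rho_le k z : 0 < z -> z * rho k z <= z ^+ k.
Proof.
move=> z0; case: k => [|k].
  rewrite /= expRN ler_pdivrMr ?expR_gt0// mul1r.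
  by apply: (le_trans _ (expR_ge1Dx z)); rewrite lerDr.
rewrite exprS ler_pM2l// /=.
apply: (@le_trans _ _ (z ^+ k / k`!%:R)); last exact: expr_fact_le.
by rewrite gerBl ltW// rho_gt0.
Qed.

Lemma continuous_rho k : continuous (rho k).
Proof.
case: k => [|k] z.
  by apply: continuous_comp; [exact: continuousN|exact: continuous_expR].
apply: differentiable_continuous.
by apply/derivable1_diffP; have [] := is_derive_rho k z.
Qed.

(** The function is a polynomial of degree 2 n in u. *)
Lemma iter_fdif_sqr_expr n t y x :
  iter (2 * n).+1 fdif (fun u => (t * (u ^+ 2 + y ^+ 2)) ^+ n) x = 0.
Proof.
elim: n x => [x|n IH x]; first by rewrite /= /fdif subrr.
have -> : (fun u => (t * (u ^+ 2 + y ^+ 2)) ^+ n.+1) =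
    (fun u => t * (u * (u * (t * (u ^+ 2 + y ^+ 2)) ^+ n)) +
              (t * y ^+ 2) * (t * (u ^+ 2 + y ^+ 2)) ^+ n).
  by apply/funext => u; rewrite exprS; ring.
rewrite iter_fdif_comb mulnS !add2n.
have h1 := iter_fdifX (iter_fdifX IH).
rewrite h1 (iter_fdif0 _ IH) ?mulr0 ?addr0//.
by rewrite leqW// leqW.
Qed.

(** As a function of u, rho k (t (u^2 + y^2)) is a Gaussian up to a polynomial
    of degree less than 2 k. *)
Lemma rho_expansion k t y : exists q : R -> R,
  (forall u, rho k (t * (u ^+ 2 + y ^+ 2)) =
     (-1) ^+ k * (gauss t u * gauss t y) + q u) /\
  (forall x, iter (2 * k) fdif q x = 0).
Proof.
elim: k => [|k [q [hq q0]]].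
  exists (fun=> 0); split=> // u.
  by rewrite /= expr0 mul1r addr0 /gauss -expRD; congr expR; ring.
exists (fun u => (k`!%:R)^-1 * (t * (u ^+ 2 + y ^+ 2)) ^+ k + (-1) * q u).
split=> [u|x].
  rewrite /= hq [(-1) ^+ k.+1]exprS.
  by move: ((t * (u ^+ 2 + y ^+ 2)) ^+ k) => Z; ring.
rewrite iter_fdif_comb (iter_fdif0 _ (iter_fdif_sqr_expr k t y)); last first.
  by rewrite mulnS add2n ltnS leqnSn.
by rewrite (iter_fdif0 _ q0) ?mulr0 ?addr0// leq_mul2l leqnSn orbT.
Qed.

(** Enough differences see only the Gaussian part of [rho_expansion], and there
    the variables u and y separate. *)
Lemma iter_dif_rho k n t y x : (k < n)%N ->
  iter n dif (fun u => rho k (t * (u ^+ 2 + y ^+ 2))) x =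
  (-1) ^+ k * gauss t y * iter n dif (gauss t) x.
Proof.
move=> kn; have [q [hq q0]] := rho_expansion k t y.
have -> : (fun u => rho k (t * (u ^+ 2 + y ^+ 2))) =
    (fun u => ((-1) ^+ k * gauss t y) * gauss t u + 1 * q u).
  by apply/funext => u; rewrite hq; ring.
rewrite iter_dif_comb [X in _ + _ * X](_ : _ = 0) ?mulr0 ?addr0//.
by rewrite iter_dif_fdif (iter_fdif0 _ q0)// -mul2n leq_mul2l (ltnW kn).
Qed.

Lemma iter_dif_mul_rho k n t y x : (k < n)%N ->
  iter n dif (fun u => u * rho k (t * (u ^+ 2 + y ^+ 2))) x =
  (-1) ^+ k * gauss t y * iter n dif (fun u => u * gauss t u) x.
Proof.
move=> kn; have [q [hq q0]] := rho_expansion k t y.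
have -> : (fun u => u * rho k (t * (u ^+ 2 + y ^+ 2))) =
    (fun u => ((-1) ^+ k * gauss t y) * (u * gauss t u) + 1 * (u * q u)).
  by apply/funext => u; rewrite hq; ring.
rewrite iter_dif_comb [X in _ + _ * X](_ : _ = 0) ?mulr0 ?addr0//.
rewrite iter_dif_fdif (iter_fdif0 _ (iter_fdifX q0))// -mul2n.
by rewrite ltn_mul2l kn.
Qed.

End rho.

Section power_as_mixture.
Context {R : realType}.
Notation leb := (@lebesgue_measure R).
Variables (b : R) (k : nat).
Hypotheses (bk : b < k%:R) (kb : k%:R - 1 < b).

Let mix (s : R) := expR (- (b * s)) * rho k (expR s).

Let measurable_mix : measurable_fun setT mix.
Proof.
apply: measurable_funM; first by mfun.
apply: (measurableT_comp (continuous_measurable_fun (@continuous_rho _ k))).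
exact: measurable_expR.
Qed.

Let mix_gt0 s : 0 < mix s.
Proof. by rewrite mulr_gt0 ?expR_gt0// rho_gt0// expR_gt0. Qed.

Let L1_mix : L1 leb mix.
Proof.
(* The rates of decay of the mixture at the two infinities. *)
pose g : R := Num.min (k%:R - b) (b - (k%:R - 1)).
have g0 : 0 < g by rewrite lt_min !subr_gt0 bk.
have g1 : g <= k%:R - b by rewrite ge_min lexx.
have g2 : g <= b - (k%:R - 1) by rewrite ge_min lexx orbT.
apply: (L1_le _ (L1_expR_normN g0)) => [|s]; first exact: measurable_mix.
rewrite (ger0_norm (ltW (mix_gt0 s))).
have es := expR_gt0 s.
have [s0|s0] := lerP 0 s.
  have h : mix s <= expR (- (b * s)) * (expR s ^+ k * expR (- s)).
    rewrite /mix ler_wpM2l ?expR_ge0// expRN ler_pdivlMr// mulrC.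
    exact: mul_rho_le.
  apply: (le_trans h); rewrite -expRM_natl -!expRD ler_expR.
  by rewrite (ger0_norm s0); nra.
have h : mix s <= expR (- (b * s)) * expR s ^+ k.
  by rewrite /mix ler_wpM2l ?expR_ge0// rho_le.
apply: (le_trans h); rewrite -expRM_natl -!expRD ler_expR.
by rewrite (ltr0_norm s0); nra.
Qed.

Definition mixture_mass : R := \int[leb]_s (expR (- (b * s)) * rho k (expR s)).

Lemma mixture_mass_gt0 : 0 < mixture_mass.
Proof.
apply: (Rint_gt0 L1_mix) => //.
suff : (0 < leb [set` `]-oo, +oo[%R])%E by rewrite set_itvNyy.
by rewrite lebesgue_measure_itv/= addye// ltry.
Qed.

(** Translating s by ln r pulls the factor r^b out of the integral. *)
Lemma power_as_mixture (r : R) : 0 < r ->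
  L1 leb (fun s => expR (- (b * s)) * rho k (expR s * r)) /\
  \int[leb]_s (expR (- (b * s)) * rho k (expR s * r)) = r `^ b * mixture_mass.
Proof.
move=> r0.
have E : (fun s => expR (- (b * s)) * rho k (expR s * r)) =
    (fun s => r `^ b * mix (s + ln r)).
  apply/funext => s; rewrite /mix expRD lnK ?posrE// mulrA; congr (_ * _).
  rewrite /powR gt_eqF// -expRD; congr expR; ring.
have h := L1_shift (ln r) L1_mix.
rewrite E; split; first exact: L1Zl.
by rewrite (RintZl _ h); congr (_ * _); exact: (Rint_shift (ln r) L1_mix).
Qed.

End power_as_mixture.

(** * The differenced homogeneous kernels *)

(** Joint integrability from a uniform bound on the slices, the form in which
    it is available for all the double integrals below. *)
Lemma fubini_bound {d1 d2} {T1 : measurableType d1} {T2 : measurableType d2}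
    {R : realType} (m1 : {measure set T1 -> \bar R})
    (m2 : {sigma_finite_measure set T2 -> \bar R}) (f : T1 -> T2 -> R) (g : T1 -> R) :
  measurable_fun setT (fun z : T1 * T2 => f z.1 z.2) ->
  (forall x, L1 m2 (f x)) -> L1 m1 g ->
  (forall x, \int[m2]_y `|f x y| <= g x) ->
  (\int[m1]_x \int[m2]_y `|f x y|%:E < +oo)%E.
Proof.
move=> mf hf hg fg.
have mF : measurable_fun setT (fun z : T1 * T2 => `|f z.1 z.2|%:E).
  by apply/measurable_EFinP; exact: measurableT_comp.
case/integrableP: (hg) => mg; apply: le_lt_trans.
apply: ge0_le_integral => //.
- by move=> x _; apply: integral_ge0 => y _; rewrite lee_fin.
- by apply: (measurable_fun_fubini_tonelli_F (fun z : T1 * T2 => `|f z.1 z.2|%:E)).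
- exact: measurableT_comp.
- move=> x _; rewrite -EFin_Rint; last exact: L1_abs.
  by rewrite lee_fin (le_trans (fg x))// ler_norm.
Qed.

Lemma Rfubini_bound {d1 d2} {T1 : measurableType d1} {T2 : measurableType d2}
    {R : realType} (m1 : {sigma_finite_measure set T1 -> \bar R})
    (m2 : {sigma_finite_measure set T2 -> \bar R}) (f : T1 -> T2 -> R) (g : T1 -> R) :
  measurable_fun setT (fun z : T1 * T2 => f z.1 z.2) ->
  (forall x, L1 m2 (f x)) -> L1 m1 g ->
  (forall x, \int[m2]_y `|f x y| <= g x) ->
  [/\ L1 m1 (fun x => \int[m2]_y f x y), L1 m2 (fun y => \int[m1]_x f x y),
      {ae m2, forall y, L1 m1 (f ^~ y)} &
      \int[m1]_x \int[m2]_y f x y = \int[m2]_y \int[m1]_x f x y].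
Proof.
move=> mf hf hg fg; have fb := fubini_bound mf hf hg fg.
have [_ h1 h2 E] := Rfubini mf fb; split=> //.
by apply: (ae_integrable2 (m1 := m1) (f := fun z => (f z.1 z.2)%:E));
  apply/integrable12ltyP => //; exact/measurable_EFinP.
Qed.

Lemma aeS {d} {T : measurableType d} {R : realType}
    (mu : {measure set T -> \bar R}) (P Q : T -> Prop) :
  (forall x, P x -> Q x) -> {ae mu, forall x, P x} -> {ae mu, forall x, Q x}.
Proof. by move=> PQ; apply: filterS. Qed.

(** Replacing f by min f g reduces to the pointwise inequality. *)
Lemma ae_le_Rint {d} {T : measurableType d} {R : realType}
    (mu : {measure set T -> \bar R}) (f g : T -> R) : L1 mu f -> L1 mu g ->
  {ae mu, forall x, f x <= g x} -> \int[mu]_x f x <= \int[mu]_x g x.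
Proof.
move=> hf hg fg; pose h x := Num.min (f x) (g x).
have mh : measurable_fun setT h.
  by apply: measurable_minr; [exact: L1_measurable hf|exact: L1_measurable hg].
have fh : {ae mu, forall x, f x = h x}.
  by apply: filterS fg => x fg; rewrite /h min_l.
rewrite (ae_eq_Rint (L1_measurable hf) mh fh); apply: le_Rint => //.
  exact: ae_eq_L1 fh.
by move=> x; rewrite ge_min lexx orbT.
Qed.

Section lebesgue_fubini.
Context {R : realType}.
Notation leb := (@lebesgue_measure R).

Lemma Rfubini_lebesgue (f : R -> R -> R) (g : R -> R) :
  measurable_fun setT (fun z : R * R => f z.1 z.2) ->
  (forall x, L1 leb (f x)) -> L1 leb g ->
  (forall x, \int[leb]_y `|f x y| <= g x) ->
  [/\ L1 leb (fun x => \int[leb]_y f x y), L1 leb (fun y => \int[leb]_x f x y),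
      {ae leb, forall y, L1 leb (f ^~ y)} &
      \int[leb]_x \int[leb]_y f x y = \int[leb]_y \int[leb]_x f x y].
Proof.
exact: (@Rfubini_bound _ _ (measurableTypeR R) (measurableTypeR R) R leb leb f g).
Qed.

Lemma ae_lebesgue_neq0 : {ae leb, forall y : R, y != 0}.
Proof.
exists [set 0]; split; [exact: measurable_set1|exact: lebesgue_measure_set1|].
by move=> y /= /negP; rewrite negbK => /eqP.
Qed.

Lemma lebesgueT_gt0 : (0 < leb setT)%E.
Proof.
suff : (0 < leb [set` `]-oo, +oo[%R])%E by rewrite set_itvNyy.
by rewrite lebesgue_measure_itv/= addye// ltry.
Qed.

(** cos 1 = 1 would force sin 1 = 0. *)
Lemma multiplier1_neq0 : 2 * cos 1 - 2 != 0 :> R.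
Proof.
have s1 : 0 < sin (1 : R) by apply: sin2_gt0; lra.
have := cos2Dsin2 (1 : R); apply: contraPneq => h.
have -> : cos 1 = 1 :> R by lra.
by apply/eqP; rewrite gt_eqF//; nra.
Qed.

End lebesgue_fubini.

Section kernel.
Context {R : realType}.
Notation leb := (@lebesgue_measure R).
Variables (b : R) (k m : nat).
Hypotheses (bk : b < k%:R) (kb : k%:R - 1 < b).
Hypotheses (b_ge : - 2^-1 <= b) (m_ge : b + 2 <= m%:R).
Implicit Types (x y s t u : R).

(** The partial derivatives of (x^2 + y^2)^(b+1), up to a factor, after 2 m
    differences in x: this makes them integrable in y. *)
Definition kerx x y : R :=
  iter (2 * m) dif (fun u => u * (u ^+ 2 + y ^+ 2) `^ b) x.

Definition kery x y : R :=
  iter (2 * m) dif (fun u => y * (u ^+ 2 + y ^+ 2) `^ b) x.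

Let km : (k < 2 * m)%N.
Proof.
rewrite -(ltr_nat R) natrM; have : (0 : R) <= m%:R by [].
by move: kb m_ge; lra.
Qed.

(* The notation of the mixture: w is its weight, exp(s) the parameter of the
   Gaussians, G1 and G2 their differences and V a function that dominates these. *)
Let C := mixture_mass b k.
Let C0 : 0 < C. Proof. exact: mixture_mass_gt0. Qed.

Let w s := expR (- (b * s)).
Let G1 s x := iter (2 * m) dif (fun u => u * gauss (expR s) u) x.
Let G2 s x := iter (2 * m) dif (gauss (expR s)) x.
Let V s x := iter (2 * m) adif (gauss (expR s / 4)) x.

Let es0 s : 0 < expR s. Proof. exact: expR_gt0. Qed.
Let es2 s : 0 < expR s / 2. Proof. by have := es0 s; lra. Qed.
Let es4 s : 0 < expR s / 4. Proof. by have := es0 s; lra. Qed.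

Let V0 s x : 0 <= V s x.
Proof. by apply: iter_adif_ge0 => u; exact: gauss_ge0. Qed.

Let V_le s x : V s x <= 4 ^+ (2 * m).
Proof.
rewrite -[leRHS]mulr1; apply: iter_adif_le => u; apply: gauss_le1.
exact: ltW.
Qed.

(** [power_as_mixture] with r = u^2 + y^2, differenced under the integral sign.
    The point y = 0 is excluded because r must be positive at u = 0. *)
Let kerx_mixture x y : y != 0 ->
  L1 leb (fun s => w s * (G1 s x * gauss (expR s) y)) /\
  kerx x y = (-1) ^+ k / C * \int[leb]_s (w s * (G1 s x * gauss (expR s) y)).
Proof.
move=> y0.
have pos u : 0 < u ^+ 2 + y ^+ 2.
  by rewrite ltr_wpDl ?sqr_ge0// lt_def sqrf_eq0 y0 sqr_ge0.
pose F s u := u * (w s * rho k (expR s * (u ^+ 2 + y ^+ 2))).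
have hF u : L1 leb (F ^~ u) by apply: L1Zl; exact: (power_as_mixture bk kb (pos u)).1.
have [h1 h2] := Rint_iter_dif (2 * m) hF.
have E s : iter (2 * m) dif (F s) x = (-1) ^+ k * (w s * (G1 s x * gauss (expR s) y)).
  have -> : F s = (fun u => w s * (u * rho k (expR s * (u ^+ 2 + y ^+ 2)))).
    by apply/funext => u; rewrite /F; ring.
  by rewrite iter_difZ iter_dif_mul_rho// /G1; ring.
have s1 : (-1 : R) ^+ k * (-1) ^+ k = 1 by rewrite -exprMn mulrNN mulr1 expr1n.
have i1 : L1 leb (fun s => w s * (G1 s x * gauss (expR s) y)).
  have := L1Zl ((-1) ^+ k) (h1 x); apply: eq_L1 => s.
  by rewrite E [LHS]mulrA s1 mul1r.
split=> //.
have := h2 x; under [in X in _ = X -> _]eq_Rint do rewrite E.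
rewrite RintZl// => h3.
have -> : kerx x y = C^-1 * iter (2 * m) dif (fun u => \int[leb]_s F s u) x.
  rewrite -iter_difZ /kerx; congr (iter _ _ _ _); apply/funext => u.
  rewrite /F RintZl; last exact: (power_as_mixture bk kb (pos u)).1.
  rewrite (power_as_mixture bk kb (pos u)).2 -/C; field.
  by rewrite gt_eqF.
by rewrite h3; ring.
Qed.

Let kery_mixture x y : y != 0 ->
  L1 leb (fun s => w s * (G2 s x * (y * gauss (expR s) y))) /\
  kery x y = (-1) ^+ k / C * \int[leb]_s (w s * (G2 s x * (y * gauss (expR s) y))).
Proof.
move=> y0.
have pos u : 0 < u ^+ 2 + y ^+ 2.
  by rewrite ltr_wpDl ?sqr_ge0// lt_def sqrf_eq0 y0 sqr_ge0.
pose F s u := y * (w s * rho k (expR s * (u ^+ 2 + y ^+ 2))).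
have hF u : L1 leb (F ^~ u) by apply: L1Zl; exact: (power_as_mixture bk kb (pos u)).1.
have [h1 h2] := Rint_iter_dif (2 * m) hF.
have E s : iter (2 * m) dif (F s) x =
    (-1) ^+ k * (w s * (G2 s x * (y * gauss (expR s) y))).
  have -> : F s = (fun u => (y * w s) * rho k (expR s * (u ^+ 2 + y ^+ 2))).
    by apply/funext => u; rewrite /F; ring.
  by rewrite iter_difZ iter_dif_rho// /G2; ring.
have s1 : (-1 : R) ^+ k * (-1) ^+ k = 1 by rewrite -exprMn mulrNN mulr1 expr1n.
have i1 : L1 leb (fun s => w s * (G2 s x * (y * gauss (expR s) y))).
  have := L1Zl ((-1) ^+ k) (h1 x); apply: eq_L1 => s.
  by rewrite E [LHS]mulrA s1 mul1r.
split=> //.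
have := h2 x; under [in X in _ = X -> _]eq_Rint do rewrite E.
rewrite RintZl// => h3.
have -> : kery x y = C^-1 * iter (2 * m) dif (fun u => \int[leb]_s F s u) x.
  rewrite -iter_difZ /kery; congr (iter _ _ _ _); apply/funext => u.
  rewrite /F RintZl; last exact: (power_as_mixture bk kb (pos u)).1.
  rewrite (power_as_mixture bk kb (pos u)).2 -/C; field.
  by rewrite gt_eqF.
by rewrite h3; ring.
Qed.

(** The gain for s near minus infinity that 2 m differences produce. *)
Let mn s := Num.min 1 (expR s ^+ m).

(** exp(- s / 2), as it comes out of Gaussian integrals. *)
Let isq s : R := (Num.sqrt (expR s))^-1.

Let isqE s : isq s = expR (- (s / 2)).
Proof.
rewrite /isq expRN; congr (_^-1).
rewrite -[RHS]ger0_norm ?expR_ge0// -sqrtr_sqr; congr Num.sqrt.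
by rewrite -expRM_natl; congr expR; field.
Qed.

Let isq_ge0 s : 0 <= isq s. Proof. by rewrite isqE expR_ge0. Qed.

Let G_bound : exists2 A : R, 0 <= A & forall s x,
  `|G1 s x| <= isq s * A * mn s * V s x /\ `|G2 s x| <= A * mn s * V s x.
Proof.
pose M1 : R := 4 ^+ (2 * m) / Num.sqrt pi *
  (gauss_moment (2 * m) + gauss_moment (2 * m).+1).
pose M2 : R := 4 ^+ (2 * m) / Num.sqrt pi * gauss_moment (2 * m).
have M10 : 0 <= M1.
  by rewrite mulr_ge0 ?addr_ge0 ?gauss_moment_ge0// divr_ge0 ?sqrtr_ge0.
have M20 : 0 <= M2.
  by rewrite mulr_ge0 ?gauss_moment_ge0// divr_ge0 ?sqrtr_ge0.
have s1 := sqrtr_ge0 M1; have s2 := sqrtr_ge0 M2.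
exists (1 + Num.sqrt M1 + Num.sqrt M2); first lra.
move=> s x.
have mn0 : 0 <= mn s * V s x.
  by rewrite mulr_ge0// le_min ler01 exprn_ge0// ltW.
split.
  apply: (le_trans (@iter_dif_interpolation R m (expR s) (isq s) M1
    (fun u => u * gauss (expR s) u) (es0 s) (isq_ge0 s) M10 _ _ x)).
  - move=> u; rewrite normrM (ger0_norm (gauss_ge0 _ _)).
    exact: norm_mul_gauss_le.
  - by move=> u; exact: iter_dif_mul_gauss_le.
  - by rewrite -!mulrA ler_wpM2l// ler_wpM2r//; lra.
apply: (le_trans (@iter_dif_interpolation R m (expR s) 1 M2
    (gauss (expR s)) (es0 s) ler01 M20 _ _ x)).
- move=> u; rewrite mul1r (ger0_norm (gauss_ge0 _ _)) ler_expR lerN2.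
  by rewrite ler_wpM2r ?sqr_ge0//; have := es0 s; lra.
- by move=> u; rewrite mul1r; exact: iter_dif_gauss_le.
- by rewrite mul1r -!mulrA ler_wpM2r//; lra.
Qed.

(** For s >= 0 the decay comes from b + c >= 1/2. For s < 0 it comes from the
    factor exp(m s), because m - b - c >= 1/2. *)
Let weight_le s (c : R) : 1 <= c <= 3 / 2 ->
  w s * expR (- (c * s)) * mn s <= expR (- (2^-1 * `|s|)).
Proof.
move=> /andP[c1 c2]; rewrite /w -expRD.
have [s0|s0] := lerP 0 s.
  apply: (@le_trans _ _ (expR (- (b * s) + - (c * s)) * 1)).
    by rewrite ler_wpM2l ?expR_ge0// ge_min lexx.
  rewrite mulr1 ler_expR (ger0_norm s0); move: b_ge; nra.
apply: (@le_trans _ _ (expR (- (b * s) + - (c * s)) * expR s ^+ m)).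
  by rewrite ler_wpM2l ?expR_ge0// ge_min lexx orbT.
rewrite -expRM_natl -expRD ler_expR (ltr0_norm s0); move: m_ge; nra.
Qed.

Let ex s : R := expR (- (2^-1 * `|s|)).
Let L1_ex : L1 leb ex. Proof. by apply: L1_expR_normN; lra. Qed.

Let isqX2 s : isq s * isq s = expR (- (1 * s)).
Proof. by rewrite isqE -expRD; congr expR; field. Qed.

Let isqX3 s : isq s * isq s * isq s = expR (- (3 / 2 * s)).
Proof. by rewrite isqE -!expRD; congr expR; field. Qed.

Let measurable_G1 : measurable_fun setT (fun z : R * R => G1 z.1 z.2).
Proof.
apply: (measurable_iter_dif (2 * m) (F := fun s u => u * gauss (expR s) u)).
by rewrite /gauss; mfun.
Qed.

Let measurable_G2 : measurable_fun setT (fun z : R * R => G2 z.1 z.2).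
Proof.
apply: (measurable_iter_dif (2 * m) (F := fun s u => gauss (expR s) u)).
by rewrite /gauss; mfun.
Qed.

Let measurable_fst2 (F : R -> R -> R) x :
  measurable_fun setT (fun z : R * R => F z.1 z.2) ->
  measurable_fun setT (fun z : R * R => F z.1 x).
Proof.
move=> mF; apply: (measurableT_comp (f := fun z : R * R => F z.1 z.2)
  (g := fun z : R * R => (z.1, x)) mF).
by apply: measurable_fun_pair; mfun.
Qed.

Let mgauss : measurable_fun setT (fun z : R * R => gauss (expR z.1) z.2).
Proof. by rewrite /gauss; mfun. Qed.

Let measurable_w : measurable_fun setT (fun z : R * R => w z.1).
Proof. by rewrite /w; mfun. Qed.

Let w_ge0 s : 0 <= w s. Proof. exact: expR_ge0. Qed.

(** The domination that Fubini requires: absolute integrals over y, uniformly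
    in x, are bounded by an integrable function of s. *)
Let f1_bound : exists c : R, forall x,
  (forall s, L1 leb (fun y => w s * (G1 s x * gauss (expR s) y))) /\
  (forall s, \int[leb]_y `|w s * (G1 s x * gauss (expR s) y)| <= c * ex s).
Proof.
have [A A0 hA] := G_bound.
exists (A * Num.sqrt pi * 4 ^+ (2 * m)) => x.
have i1 s : L1 leb (fun y => w s * (G1 s x * gauss (expR s) y)).
  by apply: L1Zl; apply: L1Zl; exact: L1_gauss.
split=> // s.
have -> : (fun y => `|w s * (G1 s x * gauss (expR s) y)|) =
    (fun y => w s * `|G1 s x| * gauss (expR s) y).
  apply/funext => y; rewrite !normrM (ger0_norm (w_ge0 s)) mulrA.
  by rewrite (ger0_norm (gauss_ge0 _ _)).
rewrite RintZl ?Rint_gauss//; last exact: L1_gauss.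
rewrite -/(isq s).
have [h _] := hA s x; have hV := V_le s x; have hw := @weight_le s 1.
have := isqX2 s => iq; have i0 := isq_ge0 s.
have pi0 := sqrtr_ge0 (pi : R).
have mn0 : 0 <= mn s by rewrite le_min ler01 exprn_ge0// ltW.
apply: (@le_trans _ _ (w s * (isq s * A * mn s * 4 ^+ (2 * m)) * (Num.sqrt pi * isq s))).
  rewrite ler_wpM2r ?mulr_ge0// ler_wpM2l//.
  apply: (le_trans h); rewrite ler_wpM2l// !mulr_ge0//.
have -> : w s * (isq s * A * mn s * 4 ^+ (2 * m)) * (Num.sqrt pi * isq s) =
    A * Num.sqrt pi * 4 ^+ (2 * m) * (w s * (isq s * isq s) * mn s) by ring.
rewrite iq ler_wpM2l ?mulr_ge0// ?exprn_ge0//; apply: hw; lra.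
Qed.

Let f2_bound : exists c : R, forall x,
  (forall s, L1 leb (fun y => w s * (G2 s x * (y * gauss (expR s) y)))) /\
  (forall s, \int[leb]_y `|w s * (G2 s x * (y * gauss (expR s) y))| <= c * ex s).
Proof.
have [A A0 hA] := G_bound.
exists (A * (Num.sqrt pi * Num.sqrt 2) * 4 ^+ (2 * m)) => x.
have i1 s : L1 leb (fun y => w s * (G2 s x * (y * gauss (expR s) y))).
  by apply: L1Zl; apply: L1Zl; exact: L1_mul_gauss.
split=> // s.
apply: (@le_trans _ _ (\int[leb]_y (w s * `|G2 s x| * isq s * gauss (expR s / 2) y))).
  apply: le_Rint; [exact: L1_abs|by apply: L1Zl; exact: L1_gauss|].
  move=> y; rewrite !normrM (ger0_norm (w_ge0 s)) !mulrA -[leLHS]mulrA -[leRHS]mulrA.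
  rewrite ler_wpM2l ?mulr_ge0// (ger0_norm (gauss_ge0 _ _)).
  exact: norm_mul_gauss_le.
rewrite RintZl ?Rint_gauss//; last exact: L1_gauss.
have -> : Num.sqrt (expR s / 2) = Num.sqrt (expR s) / Num.sqrt 2.
  by rewrite sqrtrM ?sqrtrV// ltW.
have -> : Num.sqrt pi / (Num.sqrt (expR s) / Num.sqrt 2) =
    Num.sqrt pi * Num.sqrt 2 * isq s by rewrite invfM invrK /isq; ring.
set q := Num.sqrt pi * Num.sqrt 2.
have q0 : 0 <= q by rewrite mulr_ge0 ?sqrtr_ge0.
have [_ h] := hA s x; have hV := V_le s x; have hw := @weight_le s 1.
have := isqX2 s => iq; have i0 := isq_ge0 s.
have mn0 : 0 <= mn s by rewrite le_min ler01 exprn_ge0// ltW.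
apply: (@le_trans _ _ (w s * (A * mn s * 4 ^+ (2 * m)) * (isq s) * (q * isq s))).
  rewrite ler_wpM2r ?mulr_ge0// ler_wpM2r// ler_wpM2l//.
  by apply: (le_trans h); rewrite ler_wpM2l// !mulr_ge0.
have -> : w s * (A * mn s * 4 ^+ (2 * m)) * (isq s) * (q * isq s) =
    A * q * 4 ^+ (2 * m) * (w s * (isq s * isq s) * mn s) by ring.
rewrite iq ler_wpM2l ?mulr_ge0// ?exprn_ge0//; apply: hw; lra.
Qed.

(** The analogous domination for integrals over x, where the decay is that of
    V. *)
Let f3_bound : exists c : R,
  (forall s, L1 leb (fun x => w s * isq s * G1 s x)) /\
  (forall s, \int[leb]_x `|w s * isq s * G1 s x| <= c * ex s).
Proof.
have [A A0 hA] := G_bound.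
exists (A * (Num.sqrt pi * Num.sqrt 4) * 4 ^+ (2 * m)).
have i1 s : L1 leb (fun x => w s * isq s * G1 s x).
  by apply: L1Zl; apply: L1_iter_dif; exact: L1_mul_gauss.
split=> // s.
have [iV eV] := L1_iter_adif (2 * m) (L1_gauss (es4 s)).
apply: (@le_trans _ _ (\int[leb]_x (w s * isq s * (isq s * A * mn s) * V s x))).
  apply: le_Rint; [exact: L1_abs|by apply: L1Zl|].
  move=> x; rewrite normrM ger0_norm ?mulr_ge0// -[leRHS]mulrA ler_wpM2l ?mulr_ge0//.
  by have [] := hA s x.
rewrite RintZl// eV Rint_gauss//.
have -> : Num.sqrt (expR s / 4) = Num.sqrt (expR s) / Num.sqrt 4.
  by rewrite sqrtrM ?sqrtrV// ltW.
have -> : Num.sqrt pi / (Num.sqrt (expR s) / Num.sqrt 4) =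
    Num.sqrt pi * Num.sqrt 4 * isq s by rewrite invfM invrK /isq; ring.
set q := Num.sqrt pi * Num.sqrt 4.
have q0 : 0 <= q by rewrite mulr_ge0 ?sqrtr_ge0.
have -> : w s * isq s * (isq s * A * mn s) * (4 ^+ (2 * m) * (q * isq s)) =
    A * q * 4 ^+ (2 * m) * (w s * (isq s * isq s * isq s) * mn s) by ring.
rewrite isqX3 ler_wpM2l ?mulr_ge0// ?exprn_ge0//; apply: weight_le; lra.
Qed.

Lemma measurable_kerx : measurable_fun setT (fun z : R * R => kerx z.2 z.1).
Proof.
apply: (measurable_iter_dif (2 * m) (F := fun y u => u * (u ^+ 2 + y ^+ 2) `^ b)).
apply: measurable_funM; first by mfun.
by apply: (measurableT_comp (measurable_powR b)); mfun.
Qed.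

Lemma measurable_kery : measurable_fun setT (fun z : R * R => kery z.2 z.1).
Proof.
apply: (measurable_iter_dif (2 * m) (F := fun y u => y * (u ^+ 2 + y ^+ 2) `^ b)).
apply: measurable_funM; first by mfun.
by apply: (measurableT_comp (measurable_powR b)); mfun.
Qed.

(** Integrals over y of a kernel given by a mixture are computed and bounded
    inside the mixture. *)
Let mixture_L1 (K : R -> R) (f : R -> R -> R) (c : R) :
  measurable_fun setT K ->
  measurable_fun setT (fun z : R * R => f z.1 z.2) ->
  (forall s, L1 leb (f s)) ->
  (forall s, \int[leb]_y `|f s y| <= c * ex s) ->
  (forall y, y != 0 -> L1 leb (f ^~ y) /\
     K y = (-1) ^+ k / C * \int[leb]_s f s y) ->
  [/\ L1 leb K, \int[leb]_y `|K y| <= C^-1 * (c * \int[leb]_s ex s) &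
      \int[leb]_y K y = (-1) ^+ k / C * \int[leb]_s \int[leb]_y f s y].
Proof.
move=> mK mf hf fle hK.
have ice := L1Zl c L1_ex.
have [_ Ly _ E] := Rfubini_lebesgue mf hf ice fle.
have mfa : measurable_fun setT (fun z : R * R => `|f z.1 z.2|).
  exact: (measurableT_comp (@normr_measurable _ setT) mf).
have fle' s : \int[leb]_y `| `|f s y| | <= c * ex s.
  by under eq_Rint do rewrite normr_id.
have [Ls' Ly' _ E'] := Rfubini_lebesgue mfa (fun s => L1_abs (hf s)) ice fle'.
have KE : {ae leb, forall y, (-1) ^+ k / C * \int[leb]_s f s y = K y}.
  by apply: (aeS _ ae_lebesgue_neq0) => y /hK[_ ->].
have i2 := L1Zl ((-1) ^+ k / C) Ly.
have iK : L1 leb K by apply: (ae_eq_L1 _ i2 KE); exact: mK.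
split=> //.
- apply: (@le_trans _ _ (\int[leb]_y (C^-1 * \int[leb]_s `|f s y|))).
    apply: ae_le_Rint; [exact: L1_abs|exact: L1Zl|].
    apply: (aeS _ ae_lebesgue_neq0) => y /hK[h ->].
    rewrite !normrM normrX normrN1 expr1n mul1r normrV ?unitfE ?gt_eqF//.
    rewrite (gtr0_norm C0) ler_wpM2l ?invr_ge0 ?(ltW C0)//.
    exact: le_normr_Rintegral.
  rewrite RintZl// -E' ler_wpM2l ?invr_ge0 ?(ltW C0)// -RintZl//.
  exact: le_Rint.
- rewrite E -RintZl//; apply: ae_eq_Rint => //; first exact: L1_measurable i2.
  by apply: (aeS _ KE) => y ->.
Qed.

Let measurable_slice (F : R -> R -> R) x :
  measurable_fun setT (fun z : R * R => F z.2 z.1) -> measurable_fun setT (F x).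
Proof.
move=> mF; apply: (measurableT_comp (f := fun z : R * R => F z.2 z.1)
  (g := fun y : R => (y, x)) mF).
by apply: measurable_fun_pair; mfun.
Qed.

Let kerx_props : exists B : R, forall x,
  [/\ L1 leb (kerx x), \int[leb]_y `|kerx x y| <= B &
      \int[leb]_y kerx x y =
      (-1) ^+ k / C * Num.sqrt pi * \int[leb]_s (w s * isq s * G1 s x)].
Proof.
have [c hc] := f1_bound.
exists (C^-1 * (c * \int[leb]_s ex s)) => x; have [i1 i2] := hc x.
have mf : measurable_fun setT (fun z : R * R =>
    w z.1 * (G1 z.1 x * gauss (expR z.1) z.2)).
  apply: measurable_funM => //; apply: measurable_funM => //.
  exact: (measurable_fst2 x measurable_G1).
have [h1 h2 h3] := mixture_L1 (measurable_slice x measurable_kerx) mf i1 i2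
  (fun y => @kerx_mixture x y).
split=> //.
have E : (fun s => \int[leb]_y (w s * (G1 s x * gauss (expR s) y))) =
    (fun s => Num.sqrt pi * (w s * isq s * G1 s x)).
  apply/funext => s; rewrite RintZl; last by apply: L1Zl; exact: L1_gauss.
  rewrite RintZl; last exact: L1_gauss.
  by rewrite Rint_gauss// -/(isq s); ring.
have i3 : L1 leb (fun s => Num.sqrt pi * (w s * isq s * G1 s x)).
  rewrite -E.
  by have [h _ _ _] := Rfubini_lebesgue mf i1 (L1Zl c L1_ex) i2; exact: h.
have p0 : Num.sqrt pi != 0 :> R by rewrite gt_eqF// sqrtr_gt0 pi_gt0.
have i4 : L1 leb (fun s => w s * isq s * G1 s x).
  by have := L1Zl (Num.sqrt pi)^-1 i3; apply: eq_L1 => s; rewrite mulKf.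
by rewrite h3 E (RintZl _ i4) mulrA.
Qed.

Lemma kerx_bound : exists B : R, forall x,
  L1 leb (kerx x) /\ \int[leb]_y `|kerx x y| <= B.
Proof. by have [B hB] := kerx_props; exists B => x; have [] := hB x. Qed.

Lemma kery_bound : exists B : R, forall x,
  L1 leb (kery x) /\ \int[leb]_y `|kery x y| <= B.
Proof.
have [c hc] := f2_bound.
exists (C^-1 * (c * \int[leb]_s ex s)) => x; have [i1 i2] := hc x.
have mf : measurable_fun setT (fun z : R * R =>
    w z.1 * (G2 z.1 x * (z.2 * gauss (expR z.1) z.2))).
  apply: measurable_funM => //; apply: measurable_funM.
    exact: (measurable_fst2 x measurable_G2).
  by apply: measurable_funM => //; mfun.
have [h1 h2 h3] := mixture_L1 (measurable_slice x measurable_kery) mf i1 i2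
  (fun y => @kery_mixture x y).
by [].
Qed.

(** The kernel is odd in y. *)
Lemma kery_integral0 x : \int[leb]_y kery x y = 0.
Proof.
have [B hB] := kery_bound; have [h _] := hB x.
apply: (Rint_odd h) => y; rewrite /kery sqrrN.
by rewrite -[RHS]mulN1r -iter_difZ; congr (iter _ _ _ _); apply/funext => u; ring.
Qed.

(** What remains of the first kernel once y is integrated out. *)
Definition kappa x : R := \int[leb]_y kerx x y.

Lemma kappa_odd x : kappa (- x) = - kappa x.
Proof.
have [B hB] := kerx_bound; have [h _] := hB x.
rewrite /kappa -RintN//; apply: eq_Rint => y.
by apply: iter_dif_odd => u; rewrite sqrrN mulNr.
Qed.

Let measurable_f3 : measurable_fun setT (fun z : R * R => w z.1 * isq z.1 * G1 z.1 z.2).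
Proof.
apply: measurable_funM => //; apply: measurable_funM => //.
under eq_fun do rewrite isqE.
by mfun.
Qed.

(** Each Gaussian in y integrates to a multiple of exp(- s / 2), so kappa is a
    mixture of the functions G1. *)
Let kappaE : exists2 c : R, c != 0 &
  kappa = fun x => c * \int[leb]_s (w s * isq s * G1 s x).
Proof.
have [B hB] := kerx_props; exists ((-1) ^+ k / C * Num.sqrt pi).
  rewrite !mulf_neq0 ?signr_eq0 ?invr_neq0 ?gt_eqF//.
  by rewrite sqrtr_gt0 pi_gt0.
by apply/funext => x; have [] := hB x.
Qed.

Lemma L1_kappa : L1 leb kappa.
Proof.
have [c _ ->] := kappaE; apply: L1Zl.
have [c' [h1 h2]] := f3_bound.
have mf := measurable_f3.
by have [] := Rfubini_lebesgue mf h1 (L1Zl c' L1_ex) h2.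
Qed.

(** Up to a nonzero factor this is the integral over s of S s, in which every
    factor is positive: the sine transform of x exp(- t x^2) is, and the
    eigenvalue 2 cos 1 - 2 occurs to an even power. *)
Lemma kappa_sin_neq0 : \int[leb]_x (sin x * kappa x) != 0.
Proof.
have [c c0 ->] := kappaE.
have [c' [h1 h2]] := f3_bound.
have mf := measurable_f3.
have [_ L3 ae3 _] := Rfubini_lebesgue mf h1 (L1Zl c' L1_ex) h2.
have mf4 : measurable_fun setT (fun z : R * R =>
    sin z.2 * (w z.1 * isq z.1 * G1 z.1 z.2)).
  by apply: measurable_funM => //; mfun.
have h1' s : L1 leb (fun x => sin x * (w s * isq s * G1 s x)) by exact: L1_sinM.
have h2' s : \int[leb]_x `|sin x * (w s * isq s * G1 s x)| <= c' * ex s.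
  apply: (le_trans _ (h2 s)); apply: le_Rint; [exact: L1_abs|exact: L1_abs|].
  by move=> x; rewrite normrM ler_piMl// sin_max.
have [L4 L5 _ E4] := Rfubini_lebesgue mf4 h1' (L1Zl c' L1_ex) h2'.
have -> : (fun x => sin x * (c * \int[leb]_s (w s * isq s * G1 s x))) =
    (fun x => c * (sin x * \int[leb]_s (w s * isq s * G1 s x))).
  by apply/funext => x; ring.
rewrite RintZl; last exact: L1_sinM.
rewrite mulf_neq0//.
pose S s := w s * isq s * ((2 * cos 1 - 2) ^+ (2 * m) *
  (1 / (2 * expR s) * (Num.sqrt pi / Num.sqrt (expR s) *
     expR (- (1 ^+ 2 / (4 * expR s)))))).
have SE s : \int[leb]_x (sin x * (w s * isq s * G1 s x)) = S s.
  have i5 : L1 leb (fun x => x * gauss (expR s) x) by exact: L1_mul_gauss.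
  have -> : (fun x => sin x * (w s * isq s * G1 s x)) =
      (fun x => w s * isq s * (sin x * G1 s x)) by apply/funext => x; ring.
  rewrite RintZl; last by apply: L1_sinM; exact: L1_iter_dif.
  rewrite Rint_sin_iter_dif// /S -gauss_sin//; congr (_ * (_ * _)).
  by apply: eq_Rint => x; rewrite mul1r; ring.
have c1 := @multiplier1_neq0 R.
have S0 s : 0 < S s.
  rewrite /S !mulr_gt0 ?expR_gt0 ?invr_gt0 ?mulr_gt0 ?expR_gt0 ?sqrtr_gt0 ?pi_gt0//.
  by rewrite exprM exprn_gt0// lt_def sqrf_eq0 c1 sqr_ge0.
have -> : \int[leb]_x (sin x * \int[leb]_s (w s * isq s * G1 s x)) =
    \int[leb]_s S s.
  have -> : \int[leb]_s S s = \int[leb]_s \int[leb]_x (sin x * (w s * isq s * G1 s x)).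
    by apply: eq_Rint => s; rewrite SE.
  rewrite E4.
  apply: ae_eq_Rint.
  - by apply: L1_measurable; exact: L1_sinM L3.
  - exact: L1_measurable L5.
  - by apply: (aeS _ ae3) => x /= ix; rewrite RintZl.
have iS : L1 leb S by apply: eq_L1 L4 => s; rewrite SE.
by rewrite gt_eqF//; apply: Rint_gt0 => //; exact: lebesgueT_gt0.
Qed.

End kernel.

(** * From homogeneous kernels to trigonometric functions *)

Lemma Rint_eq0 {d} {T : measurableType d} {R : realType}
    (mu : {measure set T -> \bar R}) (f : T -> R) :
  (forall x, f x = 0) -> \int[mu]_x f x = 0.
Proof.
by move=> f0; rewrite /Rintegral integral0_eq// => x _; rewrite f0.
Qed.

Section deconvolution.
Context {d : measure_display} {T : measurableType d} {R : realType}.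
Notation leb := (@lebesgue_measure R).
Variable mu : probability T R.

Let Rfubini_mu (f : T -> R -> R) (g : T -> R) :
  measurable_fun setT (fun z : T * R => f z.1 z.2) ->
  (forall x, L1 leb (f x)) -> L1 mu g ->
  (forall x, \int[leb]_y `|f x y| <= g x) ->
  [/\ L1 mu (fun x => \int[leb]_y f x y), L1 leb (fun y => \int[mu]_x f x y),
      {ae leb, forall y, L1 mu (f ^~ y)} &
      \int[mu]_x \int[leb]_y f x y = \int[leb]_y \int[mu]_x f x y].
Proof. exact: (@Rfubini_bound _ _ T (measurableTypeR R) R mu leb f g). Qed.

Lemma iter_dif_shift n (f : R -> R) (c x : R) :
  iter n dif (fun u => f (u + c)) x = iter n dif f (x + c).
Proof.
elim: n x => // n IH x; rewrite !iterS [LHS]/dif !IH [RHS]/dif.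
by rewrite [x + 1 + c]addrAC [x - 1 + c]addrAC.
Qed.

(** By Fubini on the graph of v: every w belongs to exactly one fiber, and single
    points are Lebesgue null. *)
Lemma ae_avoid_fiber (v : T -> R) : measurable_fun setT v ->
  {ae leb, forall b, mu [set w | v w = b] = 0}.
Proof.
move=> mv.
pose D : set (T * R) := [set z | v z.1 = z.2].
have mD : measurable D.
  have -> : D = (fun z : T * R => v z.1 - z.2) @^-1` [set 0].
    apply/seteqP; split=> z /=; rewrite /D/=; first by move=> ->; rewrite subrr.
    by move/eqP; rewrite subr_eq0 => /eqP.
  rewrite -[X in measurable X]setTI.
  have mf : measurable_fun setT (fun z : T * R => v z.1 - z.2).
    by apply: measurable_funB; [exact: (measurableT_comp mv)|mfun].
  by apply: mf => //; exact: measurable_set1.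
pose F : T * R -> \bar R := fun z => (\1_D z)%:E.
have mF : measurable_fun setT F by apply/measurable_EFinP; exact: measurable_indic.
have F0 z : (0 <= F z)%E by rewrite lee_fin.
have := @fubini_tonelli _ _ T (measurableTypeR R) R mu leb F mF F0.
have -> : (\int[mu]_x \int[leb]_y F (x, y) = 0)%E.
  apply: integral0_eq => w _.
  have -> : (fun y => F (w, y)) = (fun y => (\1_[set v w] y)%:E).
    apply/funext => y; rewrite /F !indicE; congr ((_ : bool)%:R%:E).
    by apply/idP/idP; rewrite !inE /D/=; [move=> ->|move=> ->].
  by rewrite integral_indic ?setIT//; exact: lebesgue_measure_set1.
move/esym => h.
have mG := @measurable_fun_fubini_tonelli_G _ _ T (measurableTypeR R) R mu F mF F0.
have h' : (\int[leb]_y `|\int[mu]_x F (x, y)| = 0)%E.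
  rewrite -h; apply: eq_integral => y _; rewrite gee0_abs//.
  exact: integral_ge0.
have := (ae_eq_integral_abs leb measurableT mG).1 h'.
apply: filterS => b /(_ I) /= hb.
transitivity (\int[mu]_x F (x, b))%E; last exact: hb.
rewrite -[X in mu X]setIT -integral_indic//; last first.
  by have := mv measurableT [set b] (measurable_set1 b); rewrite setTI.
Qed.

Variables (u1 u2 h1 h2 : T -> R) (kx ky : R -> R -> R) (B1 B2 : R).
Hypotheses (mu1 : measurable_fun setT u1) (mu2 : measurable_fun setT u2).
Hypotheses (hh1 : L1 mu h1) (hh2 : L1 mu h2).
Hypotheses (mkx : measurable_fun setT (fun z : R * R => kx z.2 z.1)).
Hypotheses (mky : measurable_fun setT (fun z : R * R => ky z.2 z.1)).
Hypothesis hB1 : forall x, L1 leb (kx x) /\ \int[leb]_y `|kx x y| <= B1.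
Hypothesis hB2 : forall x, L1 leb (ky x) /\ \int[leb]_y `|ky x y| <= B2.
Hypothesis ky0 : forall x, \int[leb]_y ky x y = 0.

Let kap x := \int[leb]_y kx x y.
Hypotheses (ikap : L1 leb kap) (kapN : forall x, kap (- x) = - kap x).
Hypothesis kap_neq0 : \int[leb]_x (sin x * kap x) != 0.

Hypothesis orth_dif : forall x y, mu [set w | y + u2 w = 0] = 0 ->
  \int[mu]_w (kx (x + u1 w) (y + u2 w) * h1 w) +
  \int[mu]_w (ky (x + u1 w) (y + u2 w) * h2 w) = 0.

(** Integrate the hypothesis over y, for fixed x. By translation invariance
    the shift by u2 disappears, and so does the second kernel. *)
Let orth_kappa x : \int[mu]_w (kap (x + u1 w) * h1 w) = 0.
Proof.
have mh1 := L1_measurable hh1; have mh2 := L1_measurable hh2.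
have mpair : measurable_fun setT (fun z : T * R => (z.2 + u2 z.1, x + u1 z.1)).
  apply: measurable_fun_pair; apply: measurable_funD; mfun.
    exact: (measurableT_comp mu2).
  exact: (measurableT_comp mu1).
have mf1 : measurable_fun setT (fun z : T * R =>
    kx (x + u1 z.1) (z.2 + u2 z.1) * h1 z.1).
  apply: measurable_funM; last exact: (measurableT_comp mh1).
  exact: (measurableT_comp mkx mpair).
have mf2 : measurable_fun setT (fun z : T * R =>
    ky (x + u1 z.1) (z.2 + u2 z.1) * h2 z.1).
  apply: measurable_funM; last exact: (measurableT_comp mh2).
  exact: (measurableT_comp mky mpair).
have i1 w : L1 leb (fun y => kx (x + u1 w) (y + u2 w) * h1 w).
  by apply: L1Zr; apply: L1_shift; have [] := hB1 (x + u1 w).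
have i2 w : L1 leb (fun y => ky (x + u1 w) (y + u2 w) * h2 w).
  by apply: L1Zr; apply: L1_shift; have [] := hB2 (x + u1 w).
have le1 w : \int[leb]_y `|kx (x + u1 w) (y + u2 w) * h1 w| <= B1 * `|h1 w|.
  under eq_Rint do rewrite normrM.
  have [i3 i4] := hB1 (x + u1 w); have i5 := L1_abs i3.
  rewrite RintZr; last exact: (L1_shift (u2 w) i5).
  by rewrite ler_wpM2r// (Rint_shift (u2 w) i5).
have le2 w : \int[leb]_y `|ky (x + u1 w) (y + u2 w) * h2 w| <= B2 * `|h2 w|.
  under eq_Rint do rewrite normrM.
  have [i3 i4] := hB2 (x + u1 w); have i5 := L1_abs i3.
  rewrite RintZr; last exact: (L1_shift (u2 w) i5).
  by rewrite ler_wpM2r// (Rint_shift (u2 w) i5).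
have [_ j1 _ e1] := Rfubini_mu mf1 i1 (L1Zl B1 (L1_abs hh1)) le1.
have [_ j2 _ e2] := Rfubini_mu mf2 i2 (L1Zl B2 (L1_abs hh2)) le2.
have E1 : (fun w => kap (x + u1 w) * h1 w) =
    (fun w => \int[leb]_y (kx (x + u1 w) (y + u2 w) * h1 w)).
  apply/funext => w; have [i3 _] := hB1 (x + u1 w).
  by rewrite RintZr ?(Rint_shift (u2 w) i3)//; exact: L1_shift.
have E2 : (fun w => \int[leb]_y (ky (x + u1 w) (y + u2 w) * h2 w)) = cst 0.
  apply/funext => w; have [i3 _] := hB2 (x + u1 w).
  rewrite RintZr; last exact: L1_shift.
  by rewrite (Rint_shift (u2 w) i3) ky0 mul0r.
have e3 : \int[mu]_w \int[leb]_y (ky (x + u1 w) (y + u2 w) * h2 w) = 0.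
  by rewrite E2; exact: Rint_eq0.
have e4 : \int[leb]_y \int[mu]_w (ky (x + u1 w) (y + u2 w) * h2 w) = 0.
  by rewrite -e2.
rewrite E1 e1 -[LHS]addr0 -[X in _ + X = _]e4 -RintD//.
transitivity (\int[leb]_y (cst 0 : R -> R) y); last exact: Rint_eq0.
apply: ae_eq_Rint.
- exact: L1_measurable (L1D j1 j2).
- exact: measurable_cst.
- have h := ae_avoid_fiber mu2.
  have h' : {ae leb, forall y : R, mu [set w | u2 w = - y] = 0}.
    case: h => N [mN N0 sN]; exists (-%R @^-1` N); split.
    + by rewrite -[X in measurable X]setTI; exact: (oppr_measurable measurableT).
    + have c0 : (-1 : R) != 0 by rewrite oppr_eq0 oner_eq0.
      have := lebesgue_preimage_affine 0 c0 mN; rewrite normrN1 mul1e N0 => /esym.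
      congr (leb _ = _); apply/seteqP; split=> y /=; by rewrite mulN1r addr0.
    + by move=> y hy; apply: (sN (- y)).
  apply: (aeS _ h') => y hy; apply: orth_dif.
  rewrite -hy; congr (mu _); apply/seteqP; split=> w /=.
    by move/eqP; rewrite addrC addr_eq0 => /eqP.
  by move=> ->; rewrite subrr.
Qed.

(** Integrate [orth_kappa] over x against sin and cos and translate by u1. In
    the addition formulas the terms with the integral of cos x kappa(x) vanish by
    parity, and those with sin x kappa(x) carry a nonzero factor. *)
Lemma deconvolution :
  \int[mu]_w (cos (u1 w) * h1 w) = 0 /\ \int[mu]_w (sin (u1 w) * h1 w) = 0.
Proof.
have mkap := L1_measurable ikap; have mh1 := L1_measurable hh1.
pose Bs := \int[leb]_x (sin x * kap x).
have Bs0 : Bs != 0 by [].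
have cos0 : \int[leb]_x (cos x * kap x) = 0.
  apply: Rint_odd; first exact: L1_cosM.
  by move=> x; rewrite cosN kapN mulrN.
have ms := continuous_measurable_fun (@continuous_sin R).
have mc := continuous_measurable_fun (@continuous_cos R).
have ik x : L1 mu (fun w => kap (x + u1 w) * h1 w).
  apply: (L1_le _ (L1Zl B1 (L1_abs hh1))).
    apply: measurable_funM => //; apply: (measurableT_comp mkap).
    by apply: measurable_funD; mfun.
  move=> w; rewrite normrM ler_wpM2r//; have [i3 i4] := hB1 (x + u1 w).
  exact: (le_trans (le_normr_Rintegral measurableT i3)).
(* phi stands for sin and for cos. *)
have main (phi : R -> R) : measurable_fun setT phi -> (forall x, `|phi x| <= 1) ->
    \int[mu]_w (\int[leb]_x (phi (x - u1 w) * kap x) * h1 w) = 0.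
  move=> mphi phi1.
  have mf : measurable_fun setT (fun z : T * R =>
      phi z.2 * kap (z.2 + u1 z.1) * h1 z.1).
    apply: measurable_funM; last exact: (measurableT_comp mh1).
    apply: measurable_funM; first by apply: (measurableT_comp mphi); mfun.
    apply: (measurableT_comp mkap); apply: measurable_funD; mfun.
    exact: (measurableT_comp mu1).
  have i0 w : L1 leb (fun x => phi x * kap (x + u1 w)).
    have ish := L1_shift (u1 w) ikap.
    apply: (L1_le _ (L1_abs ish)).
      by apply: measurable_funM => //; exact: L1_measurable ish.
    by move=> x; rewrite normrM ler_piMl.
  have i1 w : L1 leb (fun x => phi x * kap (x + u1 w) * h1 w).
    by apply: L1Zr; exact: i0.
  have le1 w : \int[leb]_x `|phi x * kap (x + u1 w) * h1 w| <=
      (\int[leb]_x `|kap x|) * `|h1 w|.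
    under eq_Rint do rewrite normrM.
    have ia := L1_abs (i0 w).
    rewrite RintZr// ler_wpM2r// -(Rint_shift (u1 w) (L1_abs ikap)).
    apply: le_Rint => //; first exact: (L1_shift (u1 w) (L1_abs ikap)).
    by move=> x; rewrite normrM ler_piMl.
  have [_ _ _ e] := Rfubini_mu mf i1 (L1Zl _ (L1_abs hh1)) le1.
  transitivity (\int[mu]_w \int[leb]_x (phi x * kap (x + u1 w) * h1 w)).
    apply: eq_Rint => w; rewrite (RintZr _ (i0 w)); congr (_ * _).
    have ip : L1 leb (fun x => phi (x - u1 w) * kap x).
      have := L1_shift (- u1 w) (i0 w); apply: eq_L1 => x.
      by rewrite subrK.
    rewrite -(Rint_shift (u1 w) ip); apply: eq_Rint => x.
    by rewrite addrK.
  rewrite e; transitivity (\int[leb]_y (cst 0 : R -> R) y); last first.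
    exact: Rint_eq0.
  apply: eq_Rint => x.
  have h := orth_kappa x.
  under eq_Rint do rewrite -mulrA.
  by rewrite RintZl// h mulr0.
have isk := L1_sinM ikap; have ic := L1_cosM ikap.
have icu : L1 mu (fun w => cos (u1 w) * h1 w).
  apply: (L1_le _ (L1_abs hh1)) => [|w].
    by apply: measurable_funM => //; exact: (measurableT_comp mc).
  by rewrite normrM ler_piMl// cos_max.
have isu : L1 mu (fun w => sin (u1 w) * h1 w).
  apply: (L1_le _ (L1_abs hh1)) => [|w].
    by apply: measurable_funM => //; exact: (measurableT_comp ms).
  by rewrite normrM ler_piMl// sin_max.
split.
  have := main sin ms (@sin_max R).
  have -> : (fun w => \int[leb]_x (sin (x - u1 w) * kap x) * h1 w) =
      (fun w => Bs * (cos (u1 w) * h1 w)).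
    apply/funext => w; rewrite mulrA; congr (_ * _).
    transitivity (\int[leb]_x (cos (u1 w) * (sin x * kap x) -
                              sin (u1 w) * (cos x * kap x))).
      by apply: eq_Rint => x; rewrite sinB; ring.
    rewrite RintB; [|exact: L1Zl|exact: L1Zl].
    by rewrite !RintZl// cos0 mulr0 subr0 mulrC.
  by rewrite RintZl// => /eqP; rewrite mulf_eq0 (negbTE Bs0) => /eqP.
have := main cos mc (@cos_max R).
have -> : (fun w => \int[leb]_x (cos (x - u1 w) * kap x) * h1 w) =
    (fun w => Bs * (sin (u1 w) * h1 w)).
  apply/funext => w; rewrite mulrA; congr (_ * _).
  transitivity (\int[leb]_x (cos (u1 w) * (cos x * kap x) +
                            sin (u1 w) * (sin x * kap x))).
    by apply: eq_Rint => x; rewrite cosB; ring.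
  rewrite RintD; [|exact: L1Zl|exact: L1Zl].
  by rewrite !RintZl// cos0 mulr0 add0r mulrC.
by rewrite RintZl// => /eqP; rewrite mulf_eq0 (negbTE Bs0) => /eqP.
Qed.

End deconvolution.

Section homogeneous_orthogonality.
Context {d : measure_display} {T : measurableType d} {R : realType}.
Notation leb := (@lebesgue_measure R).
Variable mu : probability T R.
Variables (u1 u2 h1 h2 : T -> R) (b : R) (k m : nat).
Hypotheses (mu1 : measurable_fun setT u1) (mu2 : measurable_fun setT u2).
Hypotheses (hh1 : L1 mu h1) (hh2 : L1 mu h2).
Hypotheses (bk : b < k%:R) (kb : k%:R - 1 < b).
Hypotheses (b_ge : - 2^-1 <= b) (m_ge : b + 2 <= m%:R).

Let ker (z1 z2 : R) := (z1 ^+ 2 + z2 ^+ 2) `^ b.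

Hypothesis orth : forall x y, mu [set w | y + u2 w = 0] = 0 ->
  [/\ L1 mu (fun w => (x + u1 w) * ker (x + u1 w) (y + u2 w) * h1 w),
      L1 mu (fun w => (y + u2 w) * ker (x + u1 w) (y + u2 w) * h2 w) &
      \int[mu]_w ((x + u1 w) * ker (x + u1 w) (y + u2 w) * h1 w) +
      \int[mu]_w ((y + u2 w) * ker (x + u1 w) (y + u2 w) * h2 w) = 0].

Let kx := kerx b m.
Let ky := kery b m.

(** The orthogonality relations hold for all x, so they can be differenced
    in x under the integral sign. *)
Let orth_dif x y : mu [set w | y + u2 w = 0] = 0 ->
  \int[mu]_w (kx (x + u1 w) (y + u2 w) * h1 w) +
  \int[mu]_w (ky (x + u1 w) (y + u2 w) * h2 w) = 0.
Proof.
move=> hy.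
pose F1 w u := (u + u1 w) * ker (u + u1 w) (y + u2 w) * h1 w.
pose F2 w u := (y + u2 w) * ker (u + u1 w) (y + u2 w) * h2 w.
have hF1 u : L1 mu (F1 ^~ u) by have [] := orth u hy.
have hF2 u : L1 mu (F2 ^~ u) by have [] := orth u hy.
have [i1 e1] := Rint_iter_dif (2 * m) hF1.
have [i2 e2] := Rint_iter_dif (2 * m) hF2.
have E1 w : iter (2 * m) dif (F1 w) x = kx (x + u1 w) (y + u2 w) * h1 w.
  have -> : F1 w = (fun u => h1 w *
      (fun v => v * (v ^+ 2 + (y + u2 w) ^+ 2) `^ b) (u + u1 w)).
    by apply/funext => u; rewrite mulrC.
  rewrite iter_difZ mulrC; congr (_ * _).
  exact: (iter_dif_shift _ (fun v => v * (v ^+ 2 + (y + u2 w) ^+ 2) `^ b)).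
have E2 w : iter (2 * m) dif (F2 w) x = ky (x + u1 w) (y + u2 w) * h2 w.
  have -> : F2 w = (fun u => h2 w *
      (fun v => (y + u2 w) * (v ^+ 2 + (y + u2 w) ^+ 2) `^ b) (u + u1 w)).
    by apply/funext => u; rewrite mulrC.
  rewrite iter_difZ mulrC; congr (_ * _).
  exact: (iter_dif_shift _ (fun v => (y + u2 w) * (v ^+ 2 + (y + u2 w) ^+ 2) `^ b)).
under eq_Rint do rewrite -E1.
under [X in _ + X]eq_Rint do rewrite -E2.
rewrite -e1 -e2 -[LHS]mul1r mulrDr -[1 * _ + _]iter_dif_comb.
have -> : (fun u => 1 * \int[mu]_w F1 w u + 1 * \int[mu]_w F2 w u) = cst 0.
  by apply/funext => u; rewrite !mul1r; have [_ _] := orth u hy.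
have dif0 n x' : iter n dif (cst 0 : R -> R) x' = 0.
  by elim: n x' => // n IH x'; rewrite iterS /dif !IH; ring.
exact: dif0.
Qed.

(** The relations are required for almost every y only, namely when - y is not
    an atom of the law of u2; this suffices because y is integrated out. *)
Lemma homogeneous_orthogonality :
  \int[mu]_w (cos (u1 w) * h1 w) = 0 /\ \int[mu]_w (sin (u1 w) * h1 w) = 0.
Proof.
have [B1 hB1] := kerx_bound bk kb b_ge m_ge.
have [B2 hB2] := kery_bound bk kb b_ge m_ge.
exact: (deconvolution mu1 mu2 hh1 hh2 (measurable_kerx b m) (measurable_kery b m)
  hB1 hB2 (kery_integral0 bk kb b_ge m_ge) (L1_kappa bk kb b_ge m_ge)
  (kappa_odd bk kb b_ge m_ge) (kappa_sin_neq0 bk kb b_ge m_ge) orth_dif).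
Qed.

End homogeneous_orthogonality.

(** * From trigonometric functions to measurable sets *)

Section sign_iteration.
Context {R : realType}.
Implicit Types v : R.

(** The Newton-Schulz polynomial, which maps [-1, 1] to itself and whose
    attracting fixed points are -1 and 1: its iterates converge to the sign. *)
Definition newton_sign v := (3 * v - v ^+ 3) / 2.

Lemma newton_sign_bound v : `|v| <= 1 -> `|newton_sign v| <= 1.
Proof.
rewrite !ler_norml /newton_sign => /andP[v1 v2].
have h1 : 0 <= (1 - v) ^+ 2 * (2 + v) by rewrite mulr_ge0 ?sqr_ge0//; lra.
have h2 : 0 <= (1 + v) ^+ 2 * (2 - v) by rewrite mulr_ge0 ?sqr_ge0//; lra.
by apply/andP; split; nra.
Qed.

Lemma iter_newton_sign_bound n v : `|v| <= 1 -> `|iter n newton_sign v| <= 1.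
Proof. by move=> v1; elim: n => //= n; exact: newton_sign_bound. Qed.

Lemma iter_newton_signN n v : iter n newton_sign (- v) = - iter n newton_sign v.
Proof. by elim: n => //= n ->; rewrite /newton_sign; ring. Qed.

(** From v on, the iterates increase, and each step shrinks the distance to 1 by
    a factor at most 1 - v / 2, since
    1 - newton_sign u = (1 - u) (1 - u) (2 + u) / 2. *)
Lemma iter_newton_sign_ge n v : 0 < v <= 1 ->
  v <= iter n newton_sign v <= 1 /\ 1 - iter n newton_sign v <= (1 - v / 2) ^+ n.
Proof.
move=> /andP[v0 v1]; elim: n => [|n [/andP[IH1 IH2] IH3]].
  by rewrite /= expr0 lexx v1; split=> //; lra.
rewrite iterS exprS; set u := iter n newton_sign v in IH1 IH2 IH3 *.
have u0 : 0 < u by exact: lt_le_trans IH1.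
have q1 : u <= newton_sign u.
  rewrite /newton_sign; have : 0 <= u * ((1 - u) * (1 + u)) by rewrite !mulr_ge0; lra.
  by lra.
have q2 : newton_sign u <= 1.
  have : 0 <= (1 - u) ^+ 2 * (2 + u) by rewrite mulr_ge0 ?sqr_ge0//; lra.
  by rewrite /newton_sign; lra.
have q3 : 1 - newton_sign u <= (1 - v / 2) * (1 - u).
  have -> : 1 - newton_sign u = (1 - u) * ((1 - u) * (2 + u) / 2).
    by rewrite /newton_sign; field.
  rewrite mulrC ler_wpM2r ?subr_ge0//.
  by have := sqr_ge0 u; lra.
split; first by rewrite q2 (le_trans IH1).
by apply: (le_trans q3); rewrite ler_wpM2l//; lra.
Qed.

Lemma cvg_iter_newton_sign v : `|v| <= 1 ->
  iter n newton_sign v @[n --> \oo] --> Num.sg v.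
Proof.
have pos (u : R) : 0 < u <= 1 -> iter n newton_sign u @[n --> \oo] --> (1 : R).
  move=> u01; have /andP[u0 u1] := u01.
  have h : (1 - u / 2) ^+ n @[n --> \oo] --> (0 : R).
    by apply: cvg_expr; rewrite ger0_norm; lra.
  have h' : 1 - (1 - u / 2) ^+ n @[n --> \oo] --> (1 : R).
    by rewrite -[X in _ --> X]subr0; apply: cvgB => //; exact: cvg_cst.
  apply: (@squeeze_cvgr _ _ _ _ (fun n => 1 - (1 - u / 2) ^+ n) (fun=> 1)) h' _;
    last exact: cvg_cst.
  apply: nearW => n.
  have [/andP[_ ->] h2] := iter_newton_sign_ge n u01; rewrite andbT.
  lra.
rewrite ler_norml => /andP[v1 v2].
have [v0|v0|<-] := ltgtP 0 v.
- by rewrite gtr0_sg//; apply: pos; rewrite v0.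
- rewrite ltr0_sg//; have -> : (fun n => iter n newton_sign v) =
      (fun n => - iter n newton_sign (- v)).
    by apply/funext => n; rewrite iter_newton_signN opprK.
  by apply: cvgN; apply: pos; lra.
- rewrite sgr0; have -> : (fun n => iter n newton_sign (0 : R)) = cst 0.
    apply/funext => n; elim: n => //= n ->.
    by rewrite /newton_sign; ring.
  exact: cvg_cst.
Qed.

(** sin keeps the sign of its argument on ]-pi, pi[. *)
Lemma cvg_sign_sin_scaled (x : R) :
  Num.sg (sin (x / n.+1%:R)) @[n --> \oo] --> Num.sg x.
Proof.
have pos (y : R) : 0 < y -> \forall n \near \oo, Num.sg (sin (y / n.+1%:R)) = 1.
  move=> y0; exists (Num.truncn (y / pi)).+1 => // n /= yn.
  rewrite gtr0_sg// sin_gt0_pi// divr_gt0//=.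
  rewrite ltr_pdivrMr ?ltr0n// mulrC -ltr_pdivrMr ?pi_gt0//.
  apply: (lt_le_trans (truncnS_gt _)); rewrite ler_nat.
  exact: (leq_trans yn).
have [x0|x0|<-] := ltgtP 0 x.
- by rewrite gtr0_sg//; apply: cvg_near_cst; exact: pos.
- rewrite ltr0_sg//; apply: cvg_near_cst.
  have Nx0 : 0 < - x by lra.
  apply: filterS (pos _ Nx0) => n.
  by rewrite mulNr sinN sgrN => /eqP; rewrite eqr_oppLR => /eqP.
- rewrite sgr0; apply: cvg_near_cst; apply: nearW => n.
  by rewrite mul0r sin0 sgr0.
Qed.

End sign_iteration.

Section spectral_annihilator.
Context {d : measure_display} {T : measurableType d} {R : realType}.
Variable mu : probability T R.
Variable U : set (T -> R).
Hypothesis U_measurable : forall f, U f -> measurable_fun setT f.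
Hypothesis UD : forall f g, U f -> U g -> U (fun w => f w + g w).
Hypothesis UZ : forall (c : R) f, U f -> U (fun w => c * f w).
Hypothesis UC : forall c : R, U (fun=> c).

(** The Fourier transform of the joint law of any functions of U, weighted by h,
    vanishes: U being a vector space, single elements suffice. *)
Definition annihilated (h : T -> R) := forall f, U f ->
  \int[mu]_w (cos (f w) * h w) = 0 /\ \int[mu]_w (sin (f w) * h w) = 0.

(** The operators of multiplication that preserve the annihilated functions form
    an algebra, whereas the functions orthogonal to all annihilated ones are
    not obviously one. *)
Definition multiplier (phi : T -> R) :=
  [/\ measurable_fun setT phi, exists B, forall w, `|phi w| <= B &
      forall h, L1 mu h -> annihilated h -> annihilated (fun w => phi w * h w)].

Let ms := continuous_measurable_fun (@continuous_sin R).
Let mc := continuous_measurable_fun (@continuous_cos R).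

Lemma L1_bounded_mul (phi h : T -> R) B : measurable_fun setT phi ->
  (forall w, `|phi w| <= B) -> L1 mu h -> L1 mu (fun w => phi w * h w).
Proof.
move=> mphi phiB hh; apply: (L1_le _ (L1Zl B (L1_abs hh))).
  by apply: measurable_funM => //; exact: L1_measurable hh.
by move=> w; rewrite normrM ler_wpM2r.
Qed.

Let L1_cos f h : U f -> L1 mu h -> L1 mu (fun w => cos (f w) * h w).
Proof.
move=> /U_measurable mf; apply: (@L1_bounded_mul _ _ 1) => [|w].
  exact: (measurableT_comp mc).
exact: cos_max.
Qed.

Let L1_sin f h : U f -> L1 mu h -> L1 mu (fun w => sin (f w) * h w).
Proof.
move=> /U_measurable mf; apply: (@L1_bounded_mul _ _ 1) => [|w].
  exact: (measurableT_comp ms).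
exact: sin_max.
Qed.

Lemma multiplier_cst (c : R) : multiplier (fun=> c).
Proof.
split; [exact: measurable_cst|by exists `|c| |].
move=> h hh ah f Uf; have [a1 a2] := ah f Uf.
have ic := L1_cos Uf hh; have isn := L1_sin Uf hh.
split.
  have -> : (fun w => cos (f w) * (c * h w)) = (fun w => c * (cos (f w) * h w)).
    by apply/funext => w; ring.
  by rewrite RintZl// a1 mulr0.
have -> : (fun w => sin (f w) * (c * h w)) = (fun w => c * (sin (f w) * h w)).
  by apply/funext => w; ring.
by rewrite RintZl// a2 mulr0.
Qed.

Lemma multiplierM phi psi : multiplier phi -> multiplier psi ->
  multiplier (fun w => phi w * psi w).
Proof.
move=> [m1 [B1 b1] a1] [m2 [B2 b2] a2]; split; first exact: measurable_funM.
  exists (B1 * B2) => w; rewrite normrM; apply: ler_pM => //.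
move=> h hh ah.
have -> : (fun w => phi w * psi w * h w) = (fun w => phi w * (psi w * h w)).
  by apply/funext => w; rewrite mulrA.
by apply: a1; [exact: L1_bounded_mul b2 hh|exact: a2].
Qed.

Lemma multiplierD phi psi : multiplier phi -> multiplier psi ->
  multiplier (fun w => phi w + psi w).
Proof.
move=> [m1 [B1 b1] a1] [m2 [B2 b2] a2]; split; first exact: measurable_funD.
  by exists (B1 + B2) => w; apply: (le_trans (ler_normD _ _)); exact: lerD.
move=> h hh ah f Uf.
have i1 := L1_bounded_mul m1 b1 hh; have i2 := L1_bounded_mul m2 b2 hh.
have [c1 s1] := a1 h hh ah f Uf; have [c2 s2] := a2 h hh ah f Uf.
split.
  have -> : (fun w => cos (f w) * ((phi w + psi w) * h w)) =
      (fun w => cos (f w) * (phi w * h w) + cos (f w) * (psi w * h w)).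
    by apply/funext => w; ring.
  by rewrite RintD ?c1 ?c2 ?addr0//; exact: L1_cos.
have -> : (fun w => sin (f w) * ((phi w + psi w) * h w)) =
    (fun w => sin (f w) * (phi w * h w) + sin (f w) * (psi w * h w)).
  by apply/funext => w; ring.
by rewrite RintD ?s1 ?s2 ?addr0//; exact: L1_sin.
Qed.

Lemma multiplierZ (c : R) phi : multiplier phi -> multiplier (fun w => c * phi w).
Proof. by move=> hphi; apply: multiplierM => //; exact: multiplier_cst. Qed.

(** The product of sin f with cos g or sin g is a combination of sines or
    cosines of g + f and g - f, which are in U. *)
Lemma multiplier_sin f : U f -> multiplier (fun w => sin (f w)).
Proof.
move=> Uf; have mf := U_measurable Uf.
split; [exact: (measurableT_comp ms)|by exists 1 => w; exact: sin_max|].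
move=> h hh ah g Ug.
have Up := UD Ug Uf; have Um := UD Ug (UZ (-1) Uf).
have [cp sp] := ah _ Up; have [cm sm] := ah _ Um.
have icp := L1_cos Up hh; have isp := L1_sin Up hh.
have icm := L1_cos Um hh; have ism := L1_sin Um hh.
split.
  have -> : (fun w => cos (g w) * (sin (f w) * h w)) =
      (fun w => 2^-1 * (sin (g w + f w) * h w - sin (g w + -1 * f w) * h w)).
    by apply/funext => w; rewrite mulN1r sinD sinB; field.
  by rewrite RintZl ?RintB ?sp ?sm ?subr0 ?mulr0//; exact: L1B.
have -> : (fun w => sin (g w) * (sin (f w) * h w)) =
    (fun w => 2^-1 * (cos (g w + -1 * f w) * h w - cos (g w + f w) * h w)).
  by apply/funext => w; rewrite mulN1r cosB cosD; field.
by rewrite RintZl ?RintB ?cp ?cm ?subr0 ?mulr0//; exact: L1B.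
Qed.

(** Dominated convergence. *)
Lemma multiplier_lim (phi_ : nat -> T -> R) (phi : T -> R) (B : R) :
  (forall n, multiplier (phi_ n)) ->
  (forall n w, `|phi_ n w| <= B) ->
  (forall w, phi_ n w @[n --> \oo] --> phi w) -> multiplier phi.
Proof.
move=> Mphi le_B cv.
have mphi : measurable_fun setT phi.
  apply: (measurable_fun_cvg (h := phi_)) => [n|w _]; last exact: cv.
  by have [] := Mphi n.
have phiB w : `|phi w| <= B.
  have h : `|phi_ n w| @[n --> \oo] --> `|phi w| by exact: cvg_norm (cv w).
  apply: (ler_cvg_to h (cvg_cst B)).
  by apply: nearW => n; exact: le_B.
split=> //; first by exists B.
move=> h hh ah f Uf.
have mf := U_measurable Uf; have mh := L1_measurable hh.
have key (trig : R -> R) : measurable_fun setT trig -> (forall x, `|trig x| <= 1) ->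
    (forall n, \int[mu]_w (trig (f w) * (phi_ n w * h w)) = 0) ->
    \int[mu]_w (trig (f w) * (phi w * h w)) = 0.
  move=> mt t1 z.
  have mtf : measurable_fun setT (fun w => trig (f w)) by exact: (measurableT_comp mt).
  have cvi : \int[mu]_w (trig (f w) * (phi_ n w * h w)) @[n --> \oo] -->
      \int[mu]_w (trig (f w) * (phi w * h w)).
    apply: (@dominated_Rint _ _ _ mu _ _ (fun w => B * `|h w|) _ _ _ _ _).2.
    - move=> n; apply: measurable_funM => //; apply: measurable_funM => //.
      by have [] := Mphi n.
    - by apply: measurable_funM => //; exact: measurable_funM.
    - by apply: L1Zl; exact: L1_abs.
    - by apply: aeW => w; apply: cvgMr; apply: cvgMl; exact: cv.
    - move=> n w; rewrite !normrM; apply: (@le_trans _ _ (1 * (`|phi_ n w| * `|h w|))).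
        by rewrite ler_wpM2r ?mulr_ge0.
      by rewrite mul1r ler_wpM2r.
  apply: (cvg_unique _ cvi) => //=.
  by apply: cvg_near_cst; apply: nearW => n /=; exact: z.
split.
  apply: key => // [x|n]; first exact: cos_max.
  by have [_ _ /(_ h hh ah f Uf)[]] := Mphi n.
apply: key => // [x|n]; first exact: sin_max.
by have [_ _ /(_ h hh ah f Uf)[]] := Mphi n.
Qed.

(** Polynomials in the multiplier sin (f / n) converge to its sign, which in turn
    converges to the sign of f. *)
Lemma multiplier_sg f : U f -> multiplier (fun w => Num.sg (f w)).
Proof.
move=> Uf; have mf := U_measurable Uf.
have Msin (n : nat) : multiplier (fun w => Num.sg (sin (f w / n.+1%:R))).
  have Ufn : U (fun w => f w / n.+1%:R).
    by have := UZ n.+1%:R^-1 Uf; under eq_fun do rewrite mulrC.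
  have mfn := U_measurable Ufn.
  have Mit (j : nat) : multiplier (fun w => iter j newton_sign (sin (f w / n.+1%:R))).
    elim: j => [|j IH]; first exact: multiplier_sin.
    have -> : (fun w => iter j.+1 newton_sign (sin (f w / n.+1%:R))) =
        (fun w => (3 / 2) * iter j newton_sign (sin (f w / n.+1%:R)) +
           (- 2^-1) * (iter j newton_sign (sin (f w / n.+1%:R)) *
            (iter j newton_sign (sin (f w / n.+1%:R)) *
             iter j newton_sign (sin (f w / n.+1%:R))))).
      by apply/funext => w; rewrite iterS /newton_sign; field.
    apply: multiplierD; apply: multiplierZ => //.
    by apply: multiplierM => //; exact: multiplierM.
  apply: (multiplier_lim Mit (B := 1)).
  - by move=> j w; apply: iter_newton_sign_bound; exact: sin_max.
  - by move=> w; apply: cvg_iter_newton_sign; exact: sin_max.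
apply: (multiplier_lim Msin (B := 1)).
- by move=> n w; rewrite normr_sg; case: (_ == _); rewrite ?ler01.
- by move=> w; exact: cvg_sign_sin_scaled.
Qed.

(** With s the sign of f, the indicator is (s + s^2) / 2. *)
Lemma multiplier_pos f : U f -> multiplier (\1_[set w | 0 < f w] : T -> R).
Proof.
move=> Uf; have Ms := multiplier_sg Uf.
have -> : (\1_[set w | 0 < f w] : T -> R) =
    (fun w => 2^-1 * (Num.sg (f w) + Num.sg (f w) * Num.sg (f w))).
  apply/funext => w; rewrite indicE.
  have [w0|w0|w0] := ltgtP 0 (f w).
  - by rewrite mem_set//= gtr0_sg//; field.
  - by rewrite memNset/= ?ltr0_sg//=; [ring|apply/negP; rewrite -leNgt ltW].
  - by rewrite memNset/= -?w0 ?sgr0 ?ltxx//=; ring.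
by apply: multiplierZ; apply: multiplierD => //; exact: multiplierM.
Qed.

Definition multiplier_sets : set (set T) :=
  [set A | measurable A /\ multiplier (\1_A : T -> R)].

Lemma multiplier_setsC A : multiplier_sets A -> multiplier_sets (~` A).
Proof.
move=> [mA MA]; split; first exact: measurableC.
have -> : (\1_(~` A) : T -> R) = (fun w => 1 + (- 1) * \1_A w).
  by apply/funext => w; rewrite !indicE in_setC; case: (_ \in A) => /=; ring.
by apply: multiplierD; [exact: multiplier_cst|exact: multiplierZ].
Qed.

Lemma multiplier_setsU A B :
  multiplier_sets A -> multiplier_sets B -> multiplier_sets (A `|` B).
Proof.
move=> [mA MA] [mB MB]; split; first exact: measurableU.
have -> : (\1_(A `|` B) : T -> R) = (fun w => (\1_A w + \1_B w) + (- 1) * (\1_A w * \1_B w)).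
  apply/funext => w; rewrite !indicE in_setU.
  by case: (_ \in A); case: (_ \in B) => /=; ring.
apply: multiplierD; first exact: multiplierD.
by apply: multiplierZ; exact: multiplierM.
Qed.

Lemma multiplier_sets_sigma_algebra : sigma_algebra [set: T] multiplier_sets.
Proof.
have m0 : multiplier_sets set0.
  split; first exact: measurable0.
  rewrite indic0; exact: multiplier_cst.
split=> // [A hA|A hA]; first by rewrite setTD; exact: multiplier_setsC.
have hAn n : multiplier_sets (\big[setU/set0]_(k < n) A k).
  by elim/big_ind: _ => // B1 B2; exact: multiplier_setsU.
split; first by apply: bigcup_measurable => k _; have [] := hA k.
apply: (multiplier_lim (phi_ := fun n => \1_(\big[setU/set0]_(k < n) A k)) (B := 1)).
- by move=> n; have [] := hAn n.
- by move=> n w; rewrite indicE; case: (_ \in _); rewrite ?normr1 ?normr0.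
- move=> w; apply: cvg_near_cst; rewrite indicE.
  have [|] := boolP (w \in \bigcup_k A k).
    rewrite inE => -[k _ Akw]; exists k.+1 => // n /= kn.
    rewrite indicE mem_set//; rewrite -bigcup_mkord.
    by exists k.
  move=> nw; apply: nearW => n; rewrite indicE memNset//.
  rewrite -bigcup_mkord => -[k _ Akw]; move: nw; rewrite notin_setE; apply.
  by exists k.
Qed.

Lemma multiplier_sets_negligible : measure_is_complete mu ->
  mu.-negligible `<=` multiplier_sets.
Proof.
move=> cmu N nN; have mN : measurable N by exact: cmu.
split=> //; split; first exact: measurable_indic.
  by exists 1 => w; rewrite indicE; case: (_ \in _); rewrite ?normr1 ?normr0.
move=> h hh _ f Uf; have mf := U_measurable Uf; have mh := L1_measurable hh.
have key (trig : R -> R) : measurable_fun setT trig ->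
    \int[mu]_w (trig (f w) * (\1_N w * h w)) = 0.
  move=> mt; rewrite -[RHS](Rint_eq0 mu (f := fun=> 0))//.
  apply: ae_eq_Rint.
  - apply: measurable_funM; first exact: (measurableT_comp mt).
    by apply: measurable_funM => //; exact: measurable_indic.
  - exact: measurable_cst.
  - case: nN => M [mM M0 NM]; exists M; split=> // w /= hw; apply: NM.
    apply: contrapT => nNw; apply: hw.
    by rewrite indicE memNset// mul0r mulr0.
by split; apply: key.
Qed.

(** Rays generate the Borel sets, and a translation of f is in U. *)
Lemma multiplier_sets_preimage f (B : set R) : U f -> measurable B ->
  multiplier_sets (f @^-1` B).
Proof.
move=> Uf mB.
have [s0 sC sU] := multiplier_sets_sigma_algebra.
suff : (@RGenOInfty.G R).-sigma.-measurable `<=` [set C | multiplier_sets (f @^-1` C)].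
  by apply; rewrite -RGenOInfty.measurableE.
apply: smallest_sub.
  split=> [|A hA|A hA] /=.
  - by rewrite preimage_set0.
  - by rewrite setTD preimage_setC -setTD; exact: sC.
  - by rewrite preimage_bigcup; exact: sU.
move=> _ [a ->] /=; split.
  by rewrite -[X in measurable X]setTI; apply: (U_measurable Uf).
have -> : f @^-1` `]a, +oo[ = [set w | 0 < f w + - a].
  by apply/seteqP; split=> w /=; rewrite in_itv/= andbT subr_gt0.
by apply: multiplier_pos; apply: UD => //; exact: UC.
Qed.

(** The multiplied function is annihilated; test this on 0 in U. *)
Lemma annihilated_integral A h : multiplier_sets A -> L1 mu h ->
  annihilated h -> \int[mu]_(w in A) h w = 0.
Proof.
move=> [mA [_ _ /(_ h)MA]] hh ah.
have [h0 _] := MA hh ah _ (UC 0).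
rewrite -[RHS]h0 Rintegral_mkcond; apply: eq_Rint => w.
by rewrite cos0 mul1r patchE indicE; case: ifPn => _; rewrite ?mul1r ?mul0r.
Qed.

End spectral_annihilator.

(** * First variation of the power of the norm *)

Section power_of_modulus.
Context {R : realType}.
Implicit Types (p x y c : R) (z u : R[i]).
Notation normc := ComplexField.Normc.normc.

Lemma powR_mulVr p x : p != 0 -> 0 <= x -> x `^ p = x * x `^ (p - 1).
Proof.
move=> p0 x0; have [->|xn0] := eqVneq x 0; first by rewrite mul0r powR0.
by rewrite -{2}(powRr1 x0) -powRD ?xn0 ?implybT//; congr (_ `^ _); ring.
Qed.

(** The graph of the convex function t^p is above its tangents. The inequality
    is Young's one for x and y^(p-1). *)
Lemma powR_tangent p x y : 1 <= p -> 0 <= x -> 0 <= y ->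
  y `^ p - x `^ p <= p * (y - x) * y `^ (p - 1).
Proof.
move=> p1 x0 y0; have p0 : 0 < p by lra.
have yp : y `^ p = y * y `^ (p - 1) by rewrite powR_mulVr ?gt_eqF.
have [->|pn1] := eqVneq p 1.
  by rewrite subrr powRr0 !powRr1//; lra.
have q0 : 0 < p / (p - 1) by rewrite divr_gt0//; lra.
have pq : p^-1 + (p / (p - 1))^-1 = 1 by field; apply/andP; split; lra.
have := conjugate_powR x0 (powR_ge0 y (p - 1)) p0 q0 pq.
rewrite -powRrM; have -> : (p - 1) * (p / (p - 1)) = p by field; lra.
have -> : x `^ p / p + y `^ p / (p / (p - 1)) = (x `^ p + (p - 1) * y `^ p) / p.
  by field; lra.
rewrite ler_pdivlMr// => h.
have -> : p * (y - x) * y `^ (p - 1) = p * y `^ p - x * y `^ (p - 1) * p.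
  by rewrite yp; ring.
lra.
Qed.

Lemma powR_lipschitz p x y m : 1 <= p -> 0 <= x <= m -> 0 <= y <= m ->
  `|y `^ p - x `^ p| <= p * `|y - x| * m `^ (p - 1).
Proof.
move=> p1; wlog xy : x y / x <= y.
  move=> H hx hy; have [/H|/ltW/H] := leP x y; first exact.
  by rewrite distrC (distrC y) => /(_ hy hx).
move=> /andP[x0 xm] /andP[y0 ym].
rewrite !ger0_norm ?subr_ge0//; last first.
  by rewrite ge0_ler_powR ?nnegrE//; lra.
apply: (le_trans (powR_tangent p1 x0 y0)).
rewrite ler_wpM2l ?mulr_ge0 ?subr_ge0//; first by lra.
by rewrite ge0_ler_powR ?nnegrE//; [lra|exact: le_trans ym].
Qed.

Lemma powRD_le p x y : 0 <= p -> 0 <= x -> 0 <= y ->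
  (x + y) `^ p <= 2 `^ p * (x `^ p + y `^ p).
Proof.
move=> p0; wlog xy : x y / x <= y.
  move=> H hx hy; have [/H|/ltW/H] := leP x y; first exact.
  by rewrite addrC (addrC (x `^ p)); exact.
move=> x0 y0; apply: (@le_trans _ _ ((2 * y) `^ p)).
  by rewrite ge0_ler_powR ?nnegrE//; lra.
rewrite powRM//; rewrite ler_wpM2l ?powR_ge0// lerDr powR_ge0//.
Qed.

Lemma normc_ge0 z : 0 <= normc z.
Proof. by case: z => a b; exact: sqrtr_ge0. Qed.

Lemma normc_real c : normc c%:C%C = `|c|.
Proof. by rewrite /= expr0n/= addr0 sqrtr_sqr. Qed.

Lemma normcE z : normc z = Num.sqrt (complex.Re z ^+ 2 + complex.Im z ^+ 2).
Proof. by case: z. Qed.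

Lemma normcD z u : normc (z + u) <= normc z + normc u.
Proof. exact: le_normcD. Qed.

Lemma normcB_le z u : `|normc (u + z) - normc z| <= normc u.
Proof.
rewrite ler_norml; apply/andP; split; last first.
  by have := normcD u z; lra.
have : normc ((u + z) + (- 1) * u) <= normc (u + z) + normc ((- 1) * u) by exact: normcD.
rewrite ComplexField.Normc.normcM.
have -> : normc (- 1 : R[i]) = 1.
  by have := normc_real (- 1); rewrite rmorphN1 normrN1.
by rewrite mul1r mulN1r addrC addKr; lra.
Qed.

Lemma powR_sqrt p x : 0 <= x -> Num.sqrt x `^ p = x `^ (p / 2).
Proof. by move=> x0; rewrite -powR12_sqrt// -powRrM; congr (_ `^ _); field. Qed.

Lemma powR_normcE p z : normc z `^ p =
  (complex.Re z ^+ 2 + complex.Im z ^+ 2) `^ (p / 2).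
Proof. by rewrite normcE powR_sqrt ?addr_ge0 ?sqr_ge0. Qed.

(** The domination under which the difference quotients of the p-th power of
    the norm may be integrated. *)
Lemma normc_quotient_bound p c z u : 1 <= p -> 0 < c <= 1 ->
  `|c^-1 * (normc (c%:C%C * u + z) `^ p - normc z `^ p)| <=
  p * (normc z + normc u) `^ p.
Proof.
move=> p1 /andP[c0 c1].
have z0 := normc_ge0 z; have u0 := normc_ge0 u.
set m := normc z + normc u.
have m0 : 0 <= m by exact: addr_ge0.
have ncu : normc (c%:C%C * u) = c * normc u.
  by rewrite ComplexField.Normc.normcM normc_real gtr0_norm.
have um : c * normc u <= normc u by rewrite ler_piMl.
have h1 : 0 <= normc z <= m by rewrite z0 lerDl.
have h2 : 0 <= normc (c%:C%C * u + z) <= m.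
  rewrite normc_ge0/=; apply: (le_trans (normcD _ _)).
  by rewrite ncu /m; lra.
rewrite normrM gtr0_norm ?invr_gt0// mulrC ler_pdivrMr//.
apply: (le_trans (powR_lipschitz p1 h1 h2)).
have -> : p * m `^ p * c = p * (c * m) * m `^ (p - 1).
  by rewrite (@powR_mulVr p)// ?gt_eqF//; [ring|lra].
rewrite ler_wpM2r ?powR_ge0// ler_wpM2l//; first by lra.
apply: (le_trans (normcB_le _ _)); rewrite ncu ler_wpM2l//; first exact: ltW.
by rewrite lerDr.
Qed.

(** The left-hand side is at most |z|^(p-1) |u|, and p - 1 is nonnegative even
    when the exponent p/2 - 1 is negative. *)
Lemma homogeneous_kernel_bound p x y z u : 1 <= p -> z != 0 ->
  `|x| <= normc z -> `|y| <= normc u ->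
  `|x * (complex.Re z ^+ 2 + complex.Im z ^+ 2) `^ (p / 2 - 1) * y| <=
  (normc z + normc u) `^ p.
Proof.
move=> p1 z0 xz yu.
have nz0 : normc z != 0.
  by apply: contra z0 => /eqP h; apply/eqP; exact: ComplexField.Normc.eq0_normc.
have gz0 := normc_ge0 z; have gu0 := normc_ge0 u.
have -> : (complex.Re z ^+ 2 + complex.Im z ^+ 2) `^ (p / 2 - 1) = normc z `^ (p - 2).
  by rewrite powR_normcE; congr (_ `^ _); field.
rewrite !normrM (ger0_norm (powR_ge0 _ _)).
set m := normc z + normc u.
have m0 : 0 < m by rewrite ltr_wpDr// lt_def nz0.
have -> : m `^ p = m `^ (p - 1) * m.
  by rewrite mulrC -powR_mulVr ?ltW ?gt_eqF//; lra.
apply: ler_pM => //; first by rewrite mulr_ge0 ?powR_ge0.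
  apply: (@le_trans _ _ (normc z `^ (p - 1))).
    have -> : normc z `^ (p - 1) = normc z * normc z `^ (p - 2).
      rewrite -{2}(powRr1 gz0) -powRD ?nz0 ?implybT//.
      by have -> : 1 + (p - 2) = p - 1 by ring.
    by rewrite ler_wpM2r ?powR_ge0.
  by rewrite ge0_ler_powR ?nnegrE ?lerDl//; lra.
by apply: (le_trans yu); rewrite lerDr.
Qed.

(** |z|^p is (x^2 + y^2)^(p/2), which is differentiable off the origin. *)
Lemma cvg_normc_quotient p z u : z != 0 ->
  n.+1%:R * (normc (n.+1%:R^-1%:C%C * u + z) `^ p - normc z `^ p) @[n --> \oo] -->
  p * (complex.Re z * (complex.Re z ^+ 2 + complex.Im z ^+ 2) `^ (p / 2 - 1) * complex.Re u
     + complex.Im z * (complex.Re z ^+ 2 + complex.Im z ^+ 2) `^ (p / 2 - 1) * complex.Im u).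
Proof.
move=> z0; case: z z0 => x y z0; case: u => v w.
have q0 : 0 < x ^+ 2 + y ^+ 2.
  rewrite lt_def addr_ge0 ?sqr_ge0// andbT paddr_eq0 ?sqr_ge0// !sqrf_eq0.
  by apply: contra z0 => /andP[/eqP -> /eqP ->].
pose q (c : R) := (c * v + x) ^+ 2 + (c * w + y) ^+ 2.
have q00 : q 0 = x ^+ 2 + y ^+ 2 by rewrite /q !mul0r !add0r.
have dq : is_derive (0 : R) 1 q (2 * (x * v + y * w)).
  rewrite /q; apply: is_derive_eq.
  by rewrite !mul0r !add0r /GRing.scale/=; ring.
have q0' : 0 < q 0 by rewrite q00.
have dpow := is_derive1_powR (p / 2) q0'.
have dc := is_derive1_comp dpow dq.
have [dv de] := dc.
(* The derivative is a limit along the punctured neighborhoods of 0. *)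
have seq0 : (n.+1%:R^-1 : R) @[n --> \oo] --> (0 : R)^'.
  move=> A /= [e /= e0 hA]; exists (Num.truncn (e^-1)) => // n /= en.
  have nl : e^-1 < n.+1%:R.
    by apply: (lt_le_trans (truncnS_gt _)); rewrite ler_nat.
  apply: hA; last by rewrite invr_neq0// pnatr_eq0.
  rewrite /ball/= sub0r normrN gtr0_norm ?invr_gt0// invf_plt ?posrE//.
have lim : n.+1%:R^-1^-1 *: (q (n.+1%:R^-1 *: 1 + 0) `^ (p / 2) - q 0 `^ (p / 2))
    @[n --> \oo] --> 'D_1 ((@powR R)^~ (p / 2) \o q) 0.
  exact: (cvg_trans (cvg_app _ seq0) dv).
rewrite de in lim.
rewrite /=; have -> : p * (x * (x ^+ 2 + y ^+ 2) `^ (p / 2 - 1) * v +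
    y * (x ^+ 2 + y ^+ 2) `^ (p / 2 - 1) * w) =
    p / 2 * q 0 `^ (p / 2 - 1) * (2 * (x * v + y * w)).
  by rewrite q00; field.
apply: cvg_trans lim; apply: near_eq_cvg; apply: nearW => n.
rewrite !powR_sqrt ?addr_ge0 ?sqr_ge0// invrK addr0 /GRing.scale/= mulr1 q00 /q.
by rewrite !mul0r subr0 addr0.
Qed.

End power_of_modulus.

Section first_variation.
Context {d : measure_display} {T : measurableType d} {R : realType}.
Variable mu : probability T R.
Variable p : R.
Hypothesis p_ge1 : 1 <= p.
Implicit Types g h f : T -> R[i].
Notation normc := ComplexField.Normc.normc.

(** Membership in L^p in terms of real integrals. *)
Definition Lpow f := [/\ measurable_fun setT (fun w => complex.Re (f w)),
  measurable_fun setT (fun w => complex.Im (f w)) &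
  L1 mu (fun w => normc (f w) `^ p)].

Lemma measurable_normc f :
  measurable_fun setT (fun w => complex.Re (f w)) ->
  measurable_fun setT (fun w => complex.Im (f w)) ->
  measurable_fun setT (fun w => normc (f w)).
Proof.
move=> mr mi; have -> : (fun w => normc (f w)) = (fun w =>
    (complex.Re (f w) ^+ 2 + complex.Im (f w) ^+ 2) `^ 2^-1).
  by apply/funext => w; rewrite powR12_sqrt ?addr_ge0 ?sqr_ge0// normcE.
apply: (measurableT_comp (measurable_powR _)).
by apply: measurable_funD; apply: measurable_funX.
Qed.

Lemma Lpow_sum g h : Lpow g -> Lpow h ->
  L1 mu (fun w => (normc (g w) + normc (h w)) `^ p).
Proof.
move=> [g1 g2 ig] [h1 h2 ih].
apply: (L1_le _ (L1Zl (2 `^ p) (L1D ig ih))).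
  apply: (measurableT_comp (measurable_powR _)).
  by apply: measurable_funD; exact: measurable_normc.
have p0 : 0 <= p by exact: le_trans ler01 p_ge1.
by move=> w; rewrite ger0_norm ?powR_ge0// powRD_le ?normc_ge0.
Qed.

Let re_term g h w := complex.Re (g w) *
  (complex.Re (g w) ^+ 2 + complex.Im (g w) ^+ 2) `^ (p / 2 - 1) * complex.Re (h w).
Let im_term g h w := complex.Im (g w) *
  (complex.Re (g w) ^+ 2 + complex.Im (g w) ^+ 2) `^ (p / 2 - 1) * complex.Im (h w).

Lemma normc_Re (z : R[i]) : `|complex.Re z| <= normc z.
Proof.
by case: z => x y /=; rewrite -sqrtr_sqr ler_wsqrtr// lerDl sqr_ge0.
Qed.

Lemma normc_Im (z : R[i]) : `|complex.Im z| <= normc z.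
Proof.
by case: z => x y /=; rewrite -sqrtr_sqr ler_wsqrtr// lerDr sqr_ge0.
Qed.

Let measurable_ker g : Lpow g -> measurable_fun setT (fun w =>
  (complex.Re (g w) ^+ 2 + complex.Im (g w) ^+ 2) `^ (p / 2 - 1)).
Proof.
move=> [g1 g2 _]; apply: (measurableT_comp (measurable_powR _)).
by apply: measurable_funD; apply: measurable_funX.
Qed.

Let L1_re_term g h : {ae mu, forall w, g w != 0} -> Lpow g -> Lpow h ->
  L1 mu (re_term g h).
Proof.
move=> g0 hg hh; apply: (ae_le_L1 _ (Lpow_sum hg hh)).
  apply: measurable_funM; last by case: hh.
  by apply: measurable_funM; [case: hg|exact: measurable_ker].
apply: filterS g0 => w gw0; apply: homogeneous_kernel_bound => //; exact: normc_Re.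
Qed.

Let L1_im_term g h : {ae mu, forall w, g w != 0} -> Lpow g -> Lpow h ->
  L1 mu (im_term g h).
Proof.
move=> g0 hg hh; apply: (ae_le_L1 _ (Lpow_sum hg hh)).
  apply: measurable_funM; last by case: hh.
  by apply: measurable_funM; [case: hg|exact: measurable_ker].
apply: filterS g0 => w gw0; apply: homogeneous_kernel_bound => //; exact: normc_Im.
Qed.

(** Difference quotients at a minimum are nonnegative from the right; their
    integrals converge by domination. *)
Let variation_ge0 g h : {ae mu, forall w, g w != 0} -> Lpow g -> Lpow h ->
  (forall c : R, 0 < c <= 1 -> Lpow (fun w => c%:C%C * h w + g w) /\
     \int[mu]_w (normc (g w) `^ p) <=
     \int[mu]_w (normc (c%:C%C * h w + g w) `^ p)) ->
  0 <= \int[mu]_w (re_term g h w + im_term g h w).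
Proof.
move=> g0 hg hh opt.
have ig : L1 mu (fun w => normc (g w) `^ p) by case: hg.
have c01 (n : nat) : 0 < (n.+1%:R^-1 : R) <= 1.
  by rewrite invr_gt0 ltr0n/= invf_le1 ?ltr0n// ler1n.
have inn (n : nat) : L1 mu (fun w =>
    n.+1%:R * (normc (n.+1%:R^-1%:C%C * h w + g w) `^ p - normc (g w) `^ p)).
  by apply: L1Zl; apply: L1B => //; have [[]] := opt _ (c01 n).
have i12 := L1D (L1_re_term g0 hg hh) (L1_im_term g0 hg hh).
have [_ cv] : L1 mu (fun w => p * (re_term g h w + im_term g h w)) /\
  \int[mu]_w (n.+1%:R * (normc (n.+1%:R^-1%:C%C * h w + g w) `^ p - normc (g w) `^ p))
    @[n --> \oo] --> \int[mu]_w (p * (re_term g h w + im_term g h w)).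
  apply: (dominated_Rint _ _ (L1Zl p (Lpow_sum hg hh))).
  - by move=> n; exact: L1_measurable (inn n).
  - exact: L1_measurable (L1Zl p i12).
  - by apply: filterS g0 => w gw0; exact: cvg_normc_quotient.
  - move=> n w; have := normc_quotient_bound (g w) (h w) p_ge1 (c01 n).
    by rewrite invrK.
rewrite RintZl// in cv.
have p0 : 0 < p by exact: lt_le_trans ltr01 p_ge1.
rewrite -(pmulr_rge0 _ p0); apply: (ler_cvg_to (cvg_cst 0) cv).
apply: nearW => n; have [[_ _ ih'] le] := opt _ (c01 n).
have iB := L1B ih' ig.
by rewrite /= RintZl// mulr_ge0 ?ler0n// RintB// subr_ge0.
Qed.

(** [variation_ge0] in the directions h and - h. *)
Lemma first_variation g h : {ae mu, forall w, g w != 0} -> Lpow g -> Lpow h ->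
  (forall c : R, Lpow (fun w => c%:C%C * h w + g w) /\
     \int[mu]_w (normc (g w) `^ p) <=
     \int[mu]_w (normc (c%:C%C * h w + g w) `^ p)) ->
  [/\ L1 mu (fun w => complex.Re (g w) *
        (complex.Re (g w) ^+ 2 + complex.Im (g w) ^+ 2) `^ (p / 2 - 1) *
        complex.Re (h w)),
      L1 mu (fun w => complex.Im (g w) *
        (complex.Re (g w) ^+ 2 + complex.Im (g w) ^+ 2) `^ (p / 2 - 1) *
        complex.Im (h w)) &
      \int[mu]_w (complex.Re (g w) *
        (complex.Re (g w) ^+ 2 + complex.Im (g w) ^+ 2) `^ (p / 2 - 1) *
        complex.Re (h w)) +
      \int[mu]_w (complex.Im (g w) *
        (complex.Re (g w) ^+ 2 + complex.Im (g w) ^+ 2) `^ (p / 2 - 1) *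
        complex.Im (h w)) = 0].
Proof.
move=> g0 hg hh opt.
have i1 := L1_re_term g0 hg hh; have i2 := L1_im_term g0 hg hh.
split=> //.
have hNh : Lpow (fun w => - h w).
  have [h1 h2 h3] := hh; split.
  - by under eq_fun do rewrite raddfN; exact: measurableT_comp h1.
  - by under eq_fun do rewrite raddfN; exact: measurableT_comp h2.
  - by under eq_fun do rewrite normcN.
have v1 : 0 <= \int[mu]_w (re_term g h w + im_term g h w).
  by apply: variation_ge0 => // c _; exact: opt.
have v2 : 0 <= \int[mu]_w (re_term g (fun w => - h w) w + im_term g (fun w => - h w) w).
  apply: (variation_ge0 g0 hg hNh) => c _; have [hL hI] := opt (- c).
  have E w : (- c)%:C%C * h w + g w = c%:C%C * - h w + g w.
    by rewrite rmorphN mulNr mulrN.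
  split; first by rewrite -(funext E).
  apply: (le_trans hI); rewrite le_eqVlt; apply/orP; left; apply/eqP.
  by apply: eq_Rint => w; rewrite E.
have E : (fun w => re_term g (fun w => - h w) w + im_term g (fun w => - h w) w) =
    (fun w => - (re_term g h w + im_term g h w)).
  by apply/funext => w; rewrite /re_term /im_term !raddfN/= !mulrN opprD.
move: v2; rewrite E RintN; last exact: L1D.
rewrite RintD// in v1 *; rewrite /re_term /im_term in v1 *; lra.
Qed.

End first_variation.

(** * Contractive projections fixing the constants *)

(** If b = p/2 - 1 is nonnegative, then k is its integer part plus one, and
    k - 1 = b is excluded since it would give p = 2 k. *)
Lemma exponent_bracket {R : realType} (p : R) : 1 <= p ->
  (forall n : nat, (0 < n)%N -> p <> (2 * n)%:R) ->
  exists2 k : nat, p / 2 - 1 < k%:R & k%:R - 1 < p / 2 - 1.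
Proof.
move=> p1 pN; have [b0|b0] := ltP (p / 2 - 1) 0; first by exists 0%N => //; lra.
exists (Num.truncn (p / 2 - 1)).+1; first exact: truncnS_gt.
rewrite -natr1 addrK lt_def truncn_le b0 andbT; apply/eqP => bE.
apply: (pN (Num.truncn (p / 2 - 1)).+1) => //.
rewrite natrM -natr1; lra.
Qed.

(** On a probability space 1 + |f|^p dominates |f|. *)
Lemma Lpow_L1 {d : measure_display} {T : measurableType d} {R : realType}
    (mu : probability T R) (p : R) (f : T -> R[i]) : 1 <= p -> Lpow mu p f ->
  L1 mu (fun w => complex.Re (f w)) /\ L1 mu (fun w => complex.Im (f w)).
Proof.
move=> p1 [mr mi ifp].
have i1 : L1 mu (fun w => 1 + ComplexField.Normc.normc (f w) `^ p).
  by apply: L1D => //; exact: finite_measure_integrable_cst.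
have le1 (x : R) : 0 <= x -> x <= 1 + x `^ p.
  move=> x0; have [x1|/ltW x1] := leP x 1; first by rewrite ler_wpDr ?powR_ge0.
  by rewrite ler_wpDl// -{1}(powRr1 x0) ler_powR.
split; apply: (L1_le _ i1) => // w.
- by apply: (le_trans (normc_Re _)); exact: le1 (normc_ge0 _).
- by apply: (le_trans (normc_Im _)); exact: le1 (normc_ge0 _).
Qed.

Section contraction.
Context {d : measure_display} {T : measurableType d} {R : realType}.
Variable mu : probability T R.
Variables (p : R) (X : set (T -> R[i])) (P : (T -> R[i]) -> (T -> R[i])).
Hypothesis p_ge1 : 1 <= p.
Hypothesis X_closed : closed_subspace mu p X.
Hypothesis X_cst : forall c : R[i], X (fun=> c).
Hypothesis P_contractive : contractive_projection mu p X P.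
Implicit Types (f g h u : T -> R[i]).
Notation normc := ComplexField.Normc.normc.

Let p_gt0 : 0 < p. Proof. exact: lt_le_trans ltr01 p_ge1. Qed.

Lemma cmeasurable_measurable f : cmeasurable_wrt measurable f ->
  measurable_fun setT (fun w => complex.Re (f w)) /\
  measurable_fun setT (fun w => complex.Im (f w)).
Proof.
by move=> [fr fi]; split=> _ Y mY; [apply: fr|apply: fi]; exists Y.
Qed.

Lemma cLnormE f : measurable_fun setT (fun w => complex.Re (f w)) ->
  measurable_fun setT (fun w => complex.Im (f w)) ->
  (cLnorm mu p f `^ p = \int[mu]_w (normc (f w) `^ p)%:E)%E.
Proof.
move=> mr mi; rewrite /cLnorm powR_Lnorm; last by rewrite gt_eqF.
by apply: eq_integral => w _; rewrite abse_EFin ger0_norm ?normc_ge0// poweR_EFin.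
Qed.

Lemma cLp_Lpow f : cLp mu p f -> Lpow mu p f.
Proof.
move=> [/cmeasurable_measurable[mr mi] fin]; split=> //.
apply/L1_ge0P => [|w|]; last by rewrite -cLnormE// poweR_lty.
- apply: (measurableT_comp (measurable_powR _)); exact: measurable_normc.
- exact: powR_ge0.
Qed.

Lemma cLnorm_le1 f : Lpow mu p f ->
  (cLnorm mu p f <= 1)%E <-> \int[mu]_w (normc (f w) `^ p) <= 1.
Proof.
move=> [mr mi ifp]; have E := cLnormE mr mi; rewrite -EFin_Rint// in E.
have p1 : (1 : R) `^ p = 1 by rewrite powR1.
have n0 : (0 <= cLnorm mu p f)%E by exact: Lnorm_ge0.
have fin : (cLnorm mu p f < +oo)%E.
  by apply: (@lty_poweRy _ _ p); [rewrite gt_eqF|rewrite E ltry].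
have [l l0 lE] : exists2 l, 0 <= l & cLnorm mu p f = l%:E.
  by move: n0 fin; case: cLnorm => // l; exists l.
rewrite lE; move: E; rewrite lE poweR_EFin => -[<-]; rewrite lee_fin; split=> l1.
  by rewrite -p1 ge0_ler_powR ?nnegrE// ltW.
rewrite leNgt; apply/negP => l2; move: l1; apply/negP; rewrite -ltNge.
by rewrite -{1}p1 gt0_ltr_powR ?nnegrE.
Qed.

Let X_Lpow f : X f -> Lpow mu p f.
Proof. by have [XL _ _ _] := X_closed; move=> /XL; exact: cLp_Lpow. Qed.

Let X_comb (a : R[i]) f g : X f -> X g -> X (fun w => a * f w + g w).
Proof. by have [_ _ + _] := X_closed; exact. Qed.

Let X_0 : X (fun=> 0). Proof. by have [] := X_closed. Qed.

Let X_P f : X f -> X (P f). Proof. by have [[+ _ _ _ _] _] := P_contractive; exact. Qed.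

Let P_comb (a : R[i]) f g : X f -> X g ->
  {ae mu, forall w, P (fun y => a * f y + g y) w = a * P f w + P g w}.
Proof.
have [[_ _ lin _ _] _] := P_contractive => Xf Xg.
by apply: filterS (lin a f g Xf Xg) => w; exact.
Qed.

Let P_idem f : X f -> {ae mu, forall w, P (P f) w = P f w}.
Proof.
have [[_ _ _ id _] _] := P_contractive => Xf.
by apply: filterS (id f Xf) => w; exact.
Qed.

Let P_0 : {ae mu, forall w, P (fun=> 0) w = 0}.
Proof.
have E : (fun _ : T => 1 * 0 + 0 : R[i]) = (fun=> 0) by apply/funext => w; rewrite mulr0 addr0.
have := P_comb 1 X_0 X_0; rewrite E; apply: filterS => w; rewrite mul1r => /eqP.
by rewrite -subr_eq0 opprD addrA subrr sub0r oppr_eq0 => /eqP.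
Qed.

Let X_Z (a : R[i]) f : X f -> X (fun w => a * f w).
Proof. by move=> Xf; have := X_comb a Xf X_0; under eq_fun do rewrite addr0. Qed.

Let P_Z (a : R[i]) f : X f -> {ae mu, forall w, P (fun y => a * f y) w = a * P f w}.
Proof.
move=> Xf; have E : (fun y => a * f y + 0) = (fun y => a * f y).
  by apply/funext => y; rewrite addr0.
have := P_comb a Xf X_0; rewrite E => h.
by apply: filterS2 h P_0 => w -> ->; rewrite addr0.
Qed.

Let normp f := \int[mu]_w (normc (f w) `^ p).

Let normpZ (a : R) f : 0 <= a -> X f -> normp (fun w => a%:C%C * f w) = a `^ p * normp f.
Proof.
move=> a0 /X_Lpow[_ _ ifp]; rewrite /normp -RintZl//; apply: eq_Rint => w.
by rewrite ComplexField.Normc.normcM normc_real ger0_norm// powRM// normc_ge0.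
Qed.

Let normp_ae f g : X f -> X g -> {ae mu, forall w, f w = g w} -> normp f = normp g.
Proof.
move=> /X_Lpow[_ _ /L1_measurable mf] /X_Lpow[_ _ /L1_measurable mg] fg.
by apply: ae_eq_Rint => //; apply: filterS fg => w ->.
Qed.

(** The operator norm speaks of the unit ball, so f is divided by a number t
    slightly larger than its norm, which is positive even when f is 0. *)
Lemma contraction_normp f : X f -> normp (P f) <= normp f.
Proof.
move=> Xf; have [_ opn] := P_contractive.
have n0 g : 0 <= normp g by apply: Rint_ge0 => w; exact: powR_ge0.
have unit g : X g -> normp g <= 1 -> normp (P g) <= 1.
  move=> Xg g1; apply/cLnorm_le1; first exact: X_Lpow (X_P Xg).
  rewrite -opn; apply: ereal_sup_ubound; exists g => //; split=> //.
  by apply/cLnorm_le1 => //; exact: X_Lpow.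
(* t is chosen so that its p-th power is s. *)
apply/ler_addgt0Pr => e e0; set s := normp f + e.
have s0 : 0 < s by have := n0 f; rewrite /s; lra.
pose t := s `^ p^-1; have t0 : 0 < t by exact: powR_gt0.
have tp : t `^ p = s by rewrite -powRrM mulVf ?gt_eqF// powRr1// ltW.
have it0 : 0 <= t^-1 by rewrite invr_ge0 ltW.
have itp : t^-1 `^ p = s^-1.
  apply: (mulIf (lt0r_neq0 s0)); rewrite -{1}tp -powRM// 1?ltW//.
  by rewrite !mulVf ?gt_eqF// powR1.
have := unit _ (X_Z t^-1%:C%C Xf).
rewrite (normp_ae (X_P (X_Z _ Xf)) (X_Z t^-1%:C%C (X_P Xf)) (P_Z _ Xf)).
rewrite !normpZ//; last exact: X_P.
rewrite itp !(ler_pdivrMl _ _ s0) mulr1; apply.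
by rewrite /s lerDl (ltW e0).
Qed.

Hypothesis P_one : {ae mu, forall w, P (fun=> 1) w = 1}.

(** Membership in the range of P, up to equality almost everywhere. *)
Definition fixed u := X u /\ {ae mu, forall w, P u w = u w}.

Lemma fixed_comb (a : R[i]) u v : fixed u -> fixed v -> fixed (fun w => a * u w + v w).
Proof.
move=> [Xu Pu] [Xv Pv]; split; first exact: X_comb.
by apply: filterS3 (P_comb a Xu Xv) Pu Pv => w -> -> ->.
Qed.

Lemma fixed_cst (c : R[i]) : fixed (fun=> c).
Proof.
split; first exact: X_cst.
have E : (fun=> c) = (fun _ : T => c * 1) by apply/funext => w; rewrite mulr1.
have := P_Z c (X_cst 1); rewrite -E => h.
by apply: filterS2 h P_one => w -> ->; rewrite mulr1.
Qed.

Lemma fixed_range f : X f -> fixed (P f).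
Proof. by move=> Xf; split; [exact: X_P|exact: P_idem]. Qed.

Lemma ReD (z w : R[i]) : complex.Re (z + w) = complex.Re z + complex.Re w.
Proof. by case: z; case: w. Qed.

Lemma ImD (z w : R[i]) : complex.Im (z + w) = complex.Im z + complex.Im w.
Proof. by case: z; case: w. Qed.

Lemma Re_realM (c : R) (z : R[i]) : complex.Re (c%:C%C * z) = c * complex.Re z.
Proof. by case: z => a b /=; rewrite mul0r subr0. Qed.

(** Multiplication by - i exchanges real and imaginary parts; complex linearity
    thus makes statements about real parts sufficient. *)
Lemma Re_NiM (z : R[i]) : complex.Re ((0 -i* 1)%C * z) = complex.Im z.
Proof. by case: z => a b /=; ring. Qed.

(** g = x + i y + u is fixed, P (c h + g) = g and P contracts, hence the norm of
    c h + g is minimal at c = 0. By the hypothesis on y, g is almost nowhere 0. *)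
Let fixed_orthogonality u h x y : fixed u -> X h -> {ae mu, forall w, P h w = 0} ->
  mu [set w | y + complex.Im (u w) = 0] = 0 ->
  let b := p / 2 - 1 in
  let r w := (x + complex.Re (u w)) ^+ 2 + (y + complex.Im (u w)) ^+ 2 in
  [/\ L1 mu (fun w => (x + complex.Re (u w)) * r w `^ b * complex.Re (h w)),
      L1 mu (fun w => (y + complex.Im (u w)) * r w `^ b * complex.Im (h w)) &
      \int[mu]_w ((x + complex.Re (u w)) * r w `^ b * complex.Re (h w)) +
      \int[mu]_w ((y + complex.Im (u w)) * r w `^ b * complex.Im (h w)) = 0].
Proof.
move=> fu Xh Ph0 mu0 /=.
pose g w := ((x + complex.Re (u w)) +i* (y + complex.Im (u w)))%C.
have gE : g = (fun w => 1 * u w + (x +i* y)%C).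
  apply/funext => w; rewrite /g mul1r; case: (u w) => a b /=.
  by congr Complex; rewrite addrC.
have [Xg Pg] : fixed g by rewrite gE; apply: fixed_comb => //; exact: fixed_cst.
have g0 : {ae mu, forall w, g w != 0}.
  exists [set w | y + complex.Im (u w) = 0]; split=> //.
    have [_ mi _] := X_Lpow fu.1.
    rewrite -[X in measurable X]setTI.
    have -> : [set w | y + complex.Im (u w) = 0] = (fun w => complex.Im (u w)) @^-1` [set - y].
      apply/seteqP; split=> w /= => [/eqP|->]; last by rewrite subrr.
      by rewrite addrC addr_eq0 => /eqP.
    exact: mi.
  by move=> w /= /negP; rewrite negbK => /eqP gw; have := congr1 (@complex.Im R) gw.
have opt (c : R) : Lpow mu p (fun w => c%:C%C * h w + g w) /\
     normp g <= normp (fun w => c%:C%C * h w + g w).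
  have XF := X_comb c%:C%C Xh Xg; split; first exact: X_Lpow.
  rewrite (_ : normp g = normp (P (fun w => c%:C%C * h w + g w))).
    exact: contraction_normp XF.
  apply: normp_ae => //; first exact: X_P.
  by apply: filterS3 (P_comb c%:C%C Xh Xg) Ph0 Pg => w -> -> ->; rewrite mulr0 add0r.
exact: (first_variation p_ge1 g0 (X_Lpow Xg) (X_Lpow Xh) opt).
Qed.

Hypothesis p_not_even : forall n : nat, (0 < n)%N -> p <> (2 * n)%:R.

Let Re_L1 f : X f -> L1 mu (fun w => complex.Re (f w)).
Proof. by move=> /X_Lpow /(Lpow_L1 p_ge1)[]. Qed.

Let Im_L1 f : X f -> L1 mu (fun w => complex.Im (f w)).
Proof. by move=> /X_Lpow /(Lpow_L1 p_ge1)[]. Qed.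

Let fixed_Re_fourier u h : fixed u -> X h -> {ae mu, forall w, P h w = 0} ->
  \int[mu]_w (cos (complex.Re (u w)) * complex.Re (h w)) = 0 /\
  \int[mu]_w (sin (complex.Re (u w)) * complex.Re (h w)) = 0.
Proof.
move=> fu Xh Ph0; have [k bk kb] := exponent_bracket p_ge1 p_not_even.
have b_ge : - 2^-1 <= p / 2 - 1.
  by rewrite -subr_ge0 (_ : _ - _ = (p - 1) / 2) ?divr_ge0 ?subr_ge0//; field.
have m_ge : p / 2 - 1 + 2 <= (Num.truncn (p / 2 - 1 + 2)).+1%:R.
  by apply: ltW; exact: truncnS_gt.
have [mr mi _] := X_Lpow fu.1.
apply: (homogeneous_orthogonality mr mi (Re_L1 Xh) (Im_L1 Xh) bk kb b_ge m_ge).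
by move=> x y; exact: fixed_orthogonality.
Qed.

(** The real vector space to which the multiplier argument applies. It also
    contains the imaginary parts of the fixed functions. *)
Let fixed_real : set (T -> R) :=
  [set v | exists2 u, fixed u & v = (fun w => complex.Re (u w))].

Let annihilated_Re h : X h -> {ae mu, forall w, P h w = 0} ->
  annihilated mu fixed_real (fun w => complex.Re (h w)).
Proof. by move=> Xh Ph0 _ [u fu ->]; exact: fixed_Re_fourier. Qed.

Let annihilated_Im h : X h -> {ae mu, forall w, P h w = 0} ->
  annihilated mu fixed_real (fun w => complex.Im (h w)).
Proof.
move=> Xh Ph0; have -> : (fun w => complex.Im (h w)) =
    (fun w => complex.Re ((0 -i* 1)%C * h w)).
  by apply/funext => w; rewrite Re_NiM.
apply: annihilated_Re; first exact: X_Z.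
by apply: filterS2 (P_Z (0 -i* 1)%C Xh) Ph0 => w -> ->; rewrite mulr0.
Qed.

Let fixed_real_measurable v : fixed_real v -> measurable_fun setT v.
Proof. by move=> [u fu ->]; have [] := X_Lpow fu.1. Qed.

Let fixed_realD v w : fixed_real v -> fixed_real w -> fixed_real (fun t => v t + w t).
Proof.
move=> [u1 f1 ->] [u2 f2 ->]; exists (fun t => 1 * u1 t + u2 t).
  exact: fixed_comb.
by apply/funext => t; rewrite mul1r ReD.
Qed.

Let fixed_realZ (c : R) v : fixed_real v -> fixed_real (fun t => c * v t).
Proof.
move=> [u fu ->]; exists (fun t => c%:C%C * u t + 0).
  by apply: fixed_comb => //; exact: fixed_cst.
by apply/funext => t; rewrite addr0 Re_realM.
Qed.

Let fixed_real_cst (c : R) : fixed_real (fun=> c).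
Proof. by exists (fun=> c%:C%C) => //; exact: fixed_cst. Qed.

Let fixed_real_Im u : fixed u -> fixed_real (fun w => complex.Im (u w)).
Proof.
move=> fu; exists (fun w => (0 -i* 1)%C * u w + 0).
  by apply: fixed_comb => //; exact: fixed_cst.
by apply/funext => w; rewrite addr0 Re_NiM.
Qed.

Hypothesis mu_complete : measure_is_complete mu.

(** The multiplier sets are one of the complete sigma-algebras of which the
    generated one is the smallest. *)
Let generated_multiplier : generated_sigma_algebra mu (P @` X) `<=`
  multiplier_sets mu fixed_real.
Proof.
have mU := fixed_real_measurable; have UD := fixed_realD.
have UZ := fixed_realZ; have UC := fixed_real_cst.
apply: smallest_sub; last exact: multiplier_sets_negligible.
split; first split.
- exact: multiplier_sets_sigma_algebra.
- by move=> A [].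
- exact: multiplier_sets_negligible.
- move=> _ [f Xf <-]; have fPf := fixed_range Xf.
  split=> _ [B mB <-]; rewrite setTI.
  + by apply: multiplier_sets_preimage => //; exists (P f).
  + by apply: (multiplier_sets_preimage mu mU UD UZ UC (fixed_real_Im fPf)).
Qed.

Lemma contractive_projection_condexp f : X f ->
  is_condexp mu (generated_sigma_algebra mu (P @` X)) f (P f).
Proof.
move=> Xf; have XPf := X_P Xf.
split.
- by split; [exact: Re_L1|exact: Im_L1].
- by split; [exact: Re_L1|exact: Im_L1].
- by split=> A hA; move=> G [[_ FG] _]; have [] := FG _ (imageP P Xf); auto.
- move=> A /generated_multiplier MA.
  have mA : measurable A by case: MA.
  pose h w := (-1 : R[i]) * P f w + f w.
  have Xh : X h by exact: X_comb.
  have Ph0 : {ae mu, forall w, P h w = 0}.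
    apply: filterS2 (P_comb (-1) XPf Xf) (P_idem Xf) => w -> ->.
    by rewrite mulN1r addNr.
  have onA (g : T -> R) : L1 mu g -> mu.-integrable A (EFin \o g).
    exact: integrableS.
  have zero (g1 g2 : T -> R) : L1 mu g1 -> L1 mu g2 ->
      \int[mu]_(w in A) (g2 w - g1 w) = 0 ->
      \int[mu]_(w in A) g1 w = \int[mu]_(w in A) g2 w.
    move=> i1 i2; rewrite RintegralB//; [|exact: onA|exact: onA].
    by move=> /eqP; rewrite subr_eq0 => /eqP.
  have hR := annihilated_integral fixed_real_cst MA (Re_L1 Xh) (annihilated_Re Xh Ph0).
  have hI := annihilated_integral fixed_real_cst MA (Im_L1 Xh) (annihilated_Im Xh Ph0).
  rewrite /cintegral; congr Complex; apply: zero.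
  + exact: Re_L1.
  + exact: Re_L1.
  + by rewrite -[RHS]hR; apply: eq_Rintegral => w _; rewrite /h mulN1r ReD raddfN addrC.
  + exact: Im_L1.
  + exact: Im_L1.
  + by rewrite -[RHS]hI; apply: eq_Rintegral => w _; rewrite /h mulN1r ImD raddfN addrC.
Qed.

End contraction.

Theorem theorem1p6 (d : measure_display) (T : measurableType d) (R : realType)
    (mu : probability T R) (p : R)
    (X : set (T -> R[i])) (P : (T -> R[i]) -> (T -> R[i])) :
  measure_is_complete mu ->
  1 <= p ->
  (forall n : nat, (0 < n)%N -> p <> (2 * n)%:R) ->
  closed_subspace mu p X ->
  (forall c : R[i], X (fun=> c)) ->
  contractive_projection mu p X P ->
  P (fun=> 1) = (fun=> 1) %[ae mu] ->
  forall f, X f ->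
    is_condexp mu (generated_sigma_algebra mu (P @` X)) f (P f).
Proof.
move=> mu_complete p1 pN Xcl Xcst Pcon P1.
have P1' : {ae mu, forall w, P (fun=> 1) w = 1} by apply: filterS P1 => w; exact.
move=> f Xf; exact: (contractive_projection_condexp p1 Xcl Xcst Pcon P1' pN mu_complete Xf).
Qed.
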